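(* Let $\ell\geq 1$, let $A,E\in\mathbb{R}^{m,n}$, and let $h>0$ be a real parameter. 1. If $m=n$ and $A$ has no purely imaginary eigenvalues, consider the complex iteration $\widehat{X}_{k+1}=\widehat{X}_k\, r_{\ell\ell}\left(I-\widehat{X}_k^2\right)$, $\widehat{X}_0=A+ihE$. Then for all sufficiently small $h$ all iterates $\widehat{X}_k\in\mathbb{C}^{n,n}$ are nonsingular, and for every $k\ge 0$, (i) $\mathrm{Re}(\widehat{X}_k)=X_k+\mathcal{O}(h^2)$, where $X_k\to\mathrm{sign}(A)$, so that $\mathrm{Re}(\widehat{X}_k)\to\mathrm{sign}(A)+\mathcal{O}(h^2)$; (ii) $\mathrm{Im}(\widehat{X}_k/h)=E_k+\mathcal{O}(h^2)$, where $E_k\to L_{\mathrm{sign}}(A,E)$, so that $\mathrm{Im}(\widehat{X}_k/h)\to L_{\mathrm{sign}}(A,E)+\mathcal{O}(h^2)$. Here $X_k,E_k$ are generated by the real coupled iteration $X_{k+1}=X_k g(X_k)$, $E_{k+1}=E_k g(X_k)+X_k L_g(X_k,E_k)$, $X_0=A$, $E_0=E$, with $g(X)=r_{\ell\ell}(I-X^2)$. 2. If $m\geq n$ and $A$ has full rank, consider the complex iteration $\widehat{X}_{k+1}=\widehat{X}_k\, r_{\ell\ell}\left(I-\widehat{X}_k^T\widehat{X}_k\right)$, $\widehat{X}_0=A+ihE$ ($T$ the non-conjugating transpose). Then for all sufficiently small $h$ all iterates $\widehat{X}_k\in\mathbb{C}^{m,n}$ have full rank, and for every $k\ge 0$, (i)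 $\mathrm{Re}(\widehat{X}_k)=X_k+\mathcal{O}(h^2)$, where $X_k\to\mathcal{P}(A)$, so that $\mathrm{Re}(\widehat{X}_k)\to\mathcal{P}(A)+\mathcal{O}(h^2)$; (ii) $\mathrm{Im}(\widehat{X}_k/h)=E_k+\mathcal{O}(h^2)$, where $E_k\to L_{\mathcal{P}}(A,E)$, so that $\mathrm{Im}(\widehat{X}_k/h)\to L_{\mathcal{P}}(A,E)+\mathcal{O}(h^2)$. Here $X_k,E_k$ are generated by the real coupled iteration $X_{k+1}=X_k \tilde g(X_k)$, $E_{k+1}=E_k \tilde g(X_k)+X_k L_{\tilde g}(X_k,E_k)$, $X_0=A$, $E_0=E$, with $\tilde g(X)=r_{\ell\ell}(I_n-X^TX)$. Additionally, if $A\in\mathbb{R}^{n,n}$ belongs to $\mathbb{G}$, then in both iterations, for every $k\geq 0$, $$\mathrm{dist}\left(\mathrm{Re}(\widehat{X}_k),\mathbb{G}\right)=\min_{G\in\mathbb{G}}\left\|\mathrm{Re}(\widehat{X}_k)-G\right\|=\mathcal{O}(h^2).$$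
   Context: $r_{\ell\ell}(\xi)=p_\ell(\xi)/q_\ell(\xi)$ is the $[\ell/\ell]$ Padé approximant to $(1-\xi)^{-1/2}$: $p_\ell,q_\ell$ are polynomials of degree $\ell$, $q_\ell(0)=1$, and $(1-\xi)^{-1/2}-r_{\ell\ell}(\xi)=\mathcal{O}(\xi^{2\ell+1})$; for a matrix argument $Y$, $r_{\ell\ell}(Y)=p_\ell(Y)q_\ell(Y)^{-1}$. $L_g(X,E)$ denotes the Fréchet derivative of $g$ at $X$ in direction $E$; explicitly $L_g(X,E)=L_{r_{\ell\ell}}(I-X^2,-(XE+EX))$ and $L_{\tilde g}(X,E)=L_{r_{\ell\ell}}(I-X^TX,-(X^TE+E^TX))$. $\mathrm{sign}(A)=Z\,\mathrm{diag}(-I_p,I_{n-p})Z^{-1}$ for a Jordan form $A=Z\,\mathrm{diag}(J_1,J_2)Z^{-1}$ with $J_1$ ($p\times p$) collecting eigenvalues with negative real part and $J_2$ those with positive real part. $\mathcal{P}(A)$ is the orthogonal polar factor of $A$, $\mathcal{P}(A)=A(A^TA)^{-1/2}$ for real full-rank $A$. $L_{\mathrm{sign}}, L_{\mathcal{P}}$ are the Fréchet derivatives of these maps. $\mathbb{G}$ denotes the automorphism group $\{X\in\mathbb{R}^{n,n}: X^TMX=M\}$ for a fixed $M\in\{J_{2n},\Sigma_{p,q},R_n\}$, where $J_{2n}=\begin{bmatrix}0&I_n\\-I_n&0\end{bmatrix}$ (symplectic), $\Sigma_{p,q}=\mathrm{diag}(I_p,-I_q)$ (pseudo-orthogonal),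 and $R_n$ the $n\times n$ reverse identity (perplectic). $\mathrm{Re}$, $\mathrm{Im}$ are entrywise. A matrix-valued quantity $Q(h)$ satisfies $Q(h)=B+\mathcal{O}(h^2)$ if there is a constant $C$ with $\|Q(h)-B\|_F\le Ch^2$ as $h\to 0$. *)

(* Defs.v *)
From HB Require Import structures.
From mathcomp Require Import all_boot all_order all_algebra.
From mathcomp Require Import all_classical all_reals all_analysis.
From mathcomp Require Import complex.
Set Implicit Arguments. Unset Strict Implicit. Unset Printing Implicit Defensive.
Import Order.TTheory GRing.Theory Num.Theory.
Import numFieldNormedType.Exports.
Local Open Scope ring_scope.
Local Open Scope classical_set_scope.

Definition mpow (K : pzRingType) (n : nat) (Y : 'M[K]_n) (k : nat) : 'M[K]_n :=
  iter k (mulmx Y) 1%:M.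

Definition mxeval (K : comNzRingType) (n : nat) (p : {poly K}) (Y : 'M[K]_n) : 'M[K]_n :=
  \sum_(i < size p) p`_i *: mpow Y i.

Definition rmx (K : fieldType) (n : nat) (p q : {poly K}) (Y : 'M[K]_n) : 'M[K]_n :=
  mxeval p Y *m invmx (mxeval q Y).

Definition frob (R : realType) (m n : nat) (A : 'M[R]_(m, n)) : R :=
  Num.sqrt (\sum_(i < m) \sum_(j < n) A i j ^+ 2).

Definition is_pade_invsqrt (R : realType) (l : nat) (p q : {poly R}) : Prop :=
  size p = l.+1 /\ size q = l.+1 /\ q.[0] = 1 /\
  exists C : R, exists delta : R, 0 < delta /\
    forall x : R, `|x| < delta ->
      `|(Num.sqrt (1 - x))^-1 - p.[x] / q.[x]| <= C * `|x| ^+ (2 * l).+1.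

Definition cmx (R : realType) (m n : nat) (A : 'M[R]_(m, n)) : 'M[R[i]]_(m, n) :=
  map_mx (fun x => (x%:C)%C) A.
Definition Remx (R : realType) (m n : nat) (A : 'M[R[i]]_(m, n)) : 'M[R]_(m, n) :=
  map_mx (@complex.Re R) A.
Definition Immx (R : realType) (m n : nat) (A : 'M[R[i]]_(m, n)) : 'M[R]_(m, n) :=
  map_mx (@complex.Im R) A.
Definition cpoly (R : realType) (p : {poly R}) : {poly R[i]} :=
  map_poly (fun x => (x%:C)%C) p.

Definition is_sign_of (R : realType) (n : nat) (A S : 'M[R]_n) : Prop :=
  exists p q : nat, exists e : (p + q)%N = n,
  exists Z : 'M[R[i]]_(p + q), exists J1 : 'M[R[i]]_p, exists J2 : 'M[R[i]]_q,
    Z \in unitmx /\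
    (forall lam, root (char_poly J1) lam -> complex.Re lam < 0) /\
    (forall lam, root (char_poly J2) lam -> 0 < complex.Re lam) /\
    castmx (esym e, esym e) (cmx A) = Z *m block_mx J1 0 0 J2 *m invmx Z /\
    castmx (esym e, esym e) (cmx S) = Z *m block_mx (- 1%:M) 0 0 1%:M *m invmx Z.

Definition msign (R : realType) (n : nat) (A : 'M[R]_n) : 'M[R]_n :=
  xget 0 (is_sign_of A).

Definition no_imag_eig (R : realType) (n : nat) (A : 'M[R]_n) : Prop :=
  forall lam : R[i], root (char_poly (cmx A)) lam -> complex.Re lam != 0.

Definition is_spd (R : realType) (n : nat) (H : 'M[R]_n) : Prop :=
  H^T = H /\ forall x : 'cV[R]_n, x != 0 -> 0 < (x^T *m H *m x) 0 0.

Definition spd_sqrt (R : realType) (n : nat) (M : 'M[R]_n) : 'M[R]_n :=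
  xget 0 (fun H => is_spd H /\ H *m H = M).

Definition polar (R : realType) (m n : nat) (A : 'M[R]_(m, n)) : 'M[R]_(m, n) :=
  A *m invmx (spd_sqrt (A^T *m A)).

Definition Lr (R : realType) (n : nat) (p q : {poly R}) (Y F : 'M[R]_n) : 'M[R]_n :=
  'd (rmx p q) Y F.

Definition gs (R : realType) (n : nat) (p q : {poly R}) (X : 'M[R]_n) : 'M[R]_n :=
  rmx p q (1%:M - X *m X).
Definition Lgs (R : realType) (n : nat) (p q : {poly R}) (X E : 'M[R]_n) : 'M[R]_n :=
  Lr p q (1%:M - X *m X) (- (X *m E + E *m X)).

Definition sign_iter (R : realType) (n : nat) (p q : {poly R}) (A E : 'M[R]_n)
    (k : nat) : 'M[R]_n * 'M[R]_n :=
  iter k (fun XE => (XE.1 *m gs p q XE.1,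
                     XE.2 *m gs p q XE.1 + XE.1 *m Lgs p q XE.1 XE.2)) (A, E).

Definition csign_iter (R : realType) (n : nat) (p q : {poly R}) (A E : 'M[R]_n) (h : R)
    (k : nat) : 'M[R[i]]_n :=
  iter k (fun X => X *m rmx (cpoly p) (cpoly q) (1%:M - X *m X))
    (cmx A + ('i)%C *: cmx (h *: E)).

Definition gp (R : realType) (m n : nat) (p q : {poly R}) (X : 'M[R]_(m, n)) : 'M[R]_n :=
  rmx p q (1%:M - X^T *m X).
Definition Lgp (R : realType) (m n : nat) (p q : {poly R}) (X E : 'M[R]_(m, n)) : 'M[R]_n :=
  Lr p q (1%:M - X^T *m X) (- (X^T *m E + E^T *m X)).

Definition polar_iter (R : realType) (m n : nat) (p q : {poly R}) (A E : 'M[R]_(m, n))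
    (k : nat) : 'M[R]_(m, n) * 'M[R]_(m, n) :=
  iter k (fun XE => (XE.1 *m gp p q XE.1,
                     XE.2 *m gp p q XE.1 + XE.1 *m Lgp p q XE.1 XE.2)) (A, E).

Definition cpolar_iter (R : realType) (m n : nat) (p q : {poly R}) (A E : 'M[R]_(m, n))
    (h : R) (k : nat) : 'M[R[i]]_(m, n) :=
  iter k (fun X => X *m rmx (cpoly p) (cpoly q) (1%:M - X^T *m X))
    (cmx A + ('i)%C *: cmx (h *: E)).

(* J_(2k) = [[0, I_k], [-I_k, 0]] (for N = 2k), Sigma_(p, N-p) = diag(I_p, -I_(N-p)),
   R_N = reverse identity *)
Definition Jmx (R : realType) (N : nat) : 'M[R]_N :=
  \matrix_(i, j) (if (j : nat) == (i + N./2)%N then 1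
                  else if (i : nat) == (j + N./2)%N then -1 else 0).
Definition Sigmx (R : realType) (N p : nat) : 'M[R]_N :=
  \matrix_(i, j) (if i == j then (if (i < p)%N then 1 else -1) else 0).
Definition Rmx (R : realType) (N : nat) : 'M[R]_N :=
  \matrix_(i, j) (if (i + j)%N == N.-1 then 1 else 0).

Definition structure_mx (R : realType) (N : nat) (M : 'M[R]_N) : Prop :=
  (~~ odd N /\ M = Jmx R N) \/ (exists p, (p <= N)%N /\ M = Sigmx R N p) \/ M = Rmx R N.

Definition autgroup (R : realType) (N : nat) (M : 'M[R]_N) : set 'M[R]_N :=
  [set X | X^T *m M *m X = M].

(* dist(Y, G) = min_{G in G} ||Y - G||_F  (inf; attained since G is closed) *)
Definition dist_set (R : realType) (N : nat) (Y : 'M[R]_N) (G : set 'M[R]_N) : R :=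
  inf [set frob (Y - X) | X in G].

(* Main.v *)
(* With G_0 = 1 and G_(k+1) = G_k r(I - Y G_k^2), the sign iterates are A G_k(A^2)
   and the polar iterates A G_k(A^T A), so that both parts concern the single family
   of rational matrix functions G_k and its limit Y^(-1/2).

   The Padé condition forces q^2 - (1-x) p^2 = c x^N with N = 2l+1.  Hence
   Z = I - Y G_k^2 is mapped to c q(Z)^(-2) Z^N: the iteration contracts near Z = 0,
   its domain of convergence is open, and the limit is locally bounded there.  A
   function of matrices that commutes with intertwiners and is locally bounded is
   automatically locally Lipschitz and differentiable: evaluate it at the block
   matrices [T F; 0 T'], whose off-diagonal block is a divided difference and can be
   rescaled by a similarity.

   A complex matrix X + ihE is represented by the real block matrix
   [X E; -h^2 E X], the entries being Re and Im/h.  It lies within O(h^2) of the dual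
   number [X E; 0 X], at which G_k and its limit return values together with Fréchet
   derivatives.  All the O(h^2) estimates are therefore instances of the Lipschitz
   property.

   Convergence for spectra off the imaginary axis comes from the Cayley transform: if
   K^2 = Y with the spectrum of K in the right half plane, then
   (I - K G_k)(I + K G_k)^(-1) is the N^k-th power of (I - K)(I + K)^(-1), whose
   spectral radius is less than 1. *)

(* The differentials in the statement are those of [msign] and [polar], which rest on choices made
   by [xget]. They can be computed only if the closed forms A Ginf(A^2) and A Ginf(A^T A) hold on a
   whole neighbourhood of A. Hence the converse facts as well: convergence at A^2 excludes imaginary
   eigenvalues and convergence at A^T A forces full rank, so that the open condition [reg]
   identifies both functions near A.

   The thresholds on h in the nonsingularity claims must not depend on k. They come from the
   openness of [reg], a condition on the whole sequence, and not from estimates made stage by stage.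

   Membership in an automorphism group rests on a second consequence of the Padé condition, the
   reciprocity r(1 - 1/x) r(1 - x) = 1. It gives G_k(Y^(-1)) = G_k(Y)^(-1). If Y^T M Y = M, then M
   intertwines Y^T with Y^(-1), so that G_k(Y)^T M G_k(Y) = M too. The real iterates therefore stay
   in the group exactly, and the distance bound reduces to the O(h^2) estimate of the real part. *)
Require Import Defs.
From HB Require Import structures.
From mathcomp Require Import all_boot all_order all_algebra.
From mathcomp Require Import all_classical all_reals all_analysis.
From mathcomp Require Import complex ring lra zify.
Import Order.TTheory GRing.Theory Num.Theory.
Import numFieldNormedType.Exports.
Local Open Scope ring_scope.
Local Open Scope classical_set_scope.
Set Implicit Arguments. Unset Strict Implicit. Unset Printing Implicit Defensive.

(** * Polynomials and rational functions of matrices *)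

Section MatrixPolynomials.
Variable K : comNzRingType.
Implicit Types p q : {poly K}.

Lemma mpowS n (Y : 'M[K]_n) k : mpow Y k.+1 = Y *m mpow Y k.
Proof. by []. Qed.

(** [V] is rectangular because it will be an eigenvector, a block inclusion or projection, or a
    similarity. *)
Lemma mpow_intertwine m n (V : 'M[K]_(m, n)) T T' k :
  T *m V = V *m T' -> mpow T k *m V = V *m mpow T' k.
Proof.
move=> e; elim: k => [|k IH]; first by rewrite /mpow /= mul1mx mulmx1.
by rewrite !mpowS -mulmxA IH !mulmxA e.
Qed.

Lemma mpowSr n (Y : 'M[K]_n) k : mpow Y k.+1 = mpow Y k *m Y.
Proof. by rewrite mpowS (mpow_intertwine (T' := Y)). Qed.

Lemma mpowD n (Y : 'M[K]_n) j k : mpow Y (j + k) = mpow Y j *m mpow Y k.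
Proof.
elim: j => [|j IH]; first by rewrite /mpow /= mul1mx.
by rewrite addSn !mpowS IH mulmxA.
Qed.

Lemma mpowM n (Y : 'M[K]_n) j k : mpow Y (j * k) = mpow (mpow Y j) k.
Proof.
elim: k => [|k IH]; first by rewrite muln0.
by rewrite mulnS mpowD IH -mpowS.
Qed.

Lemma mpow1 n k : mpow (1%:M : 'M[K]_n) k = 1%:M.
Proof. by elim: k => // k IH; rewrite mpowS IH mul1mx. Qed.

Lemma mpow_mulC n (Y Z : 'M[K]_n) k : Y *m Z = Z *m Y ->
  mpow (Y *m Z) k = mpow Y k *m mpow Z k.
Proof.
move=> e; elim: k => [|k IH]; first by rewrite /mpow /= mul1mx.
rewrite !mpowS IH -!mulmxA; congr (_ *m _); rewrite !mulmxA; congr (_ *m _).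
by rewrite (mpow_intertwine _ e).
Qed.

Lemma trmx_mpow n (Y : 'M[K]_n) k : (mpow Y k)^T = mpow Y^T k.
Proof.
elim: k => [|k IH]; first by rewrite /mpow /= trmx1.
by rewrite mpowS trmx_mul IH -mpowSr.
Qed.

Lemma mpowE n (Y : 'M[K]_n.+1) k : mpow Y k = Y ^+ k.
Proof. by elim: k => // k IH; rewrite mpowS IH exprS. Qed.

Lemma mxeval_horner n p (Y : 'M[K]_n.+1) : mxeval p Y = horner_mx Y p.
Proof.
rewrite -[in RHS](coefK p) poly_def rmorph_sum /=; apply: eq_bigr => i _.
by rewrite linearZ /= rmorphXn /= horner_mx_X mpowE.
Qed.

Lemma mx0E (T : 'M[K]_0) T' : T = T'.
Proof. by rewrite [LHS]flatmx0 [RHS]flatmx0. Qed.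

Lemma mxevalD n p q (Y : 'M[K]_n) : mxeval (p + q) Y = mxeval p Y + mxeval q Y.
Proof. by case: n Y => [|n] Y; [exact: mx0E|rewrite !mxeval_horner rmorphD]. Qed.

Lemma mxevalN n p (Y : 'M[K]_n) : mxeval (- p) Y = - mxeval p Y.
Proof. by case: n Y => [|n] Y; [exact: mx0E|rewrite !mxeval_horner rmorphN]. Qed.

Lemma mxevalB n p q (Y : 'M[K]_n) : mxeval (p - q) Y = mxeval p Y - mxeval q Y.
Proof. by rewrite mxevalD mxevalN. Qed.

Lemma mxevalM n p q (Y : 'M[K]_n) : mxeval (p * q) Y = mxeval p Y *m mxeval q Y.
Proof. by case: n Y => [|n] Y; [exact: mx0E|rewrite !mxeval_horner rmorphM]. Qed.

Lemma mxevalZ n c p (Y : 'M[K]_n) : mxeval (c *: p) Y = c *: mxeval p Y.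
Proof. by case: n Y => [|n] Y; [exact: mx0E|rewrite !mxeval_horner linearZ]. Qed.

Lemma mxevalC n c (Y : 'M[K]_n) : mxeval c%:P Y = c%:M.
Proof. by case: n Y => [|n] Y; [exact: mx0E|rewrite !mxeval_horner horner_mx_C]. Qed.

Lemma mxeval1 n (Y : 'M[K]_n) : mxeval 1 Y = 1%:M.
Proof. exact: mxevalC. Qed.

Lemma mxevalX n (Y : 'M[K]_n) : mxeval 'X Y = Y.
Proof. by case: n Y => [|n] Y; [exact: mx0E|rewrite !mxeval_horner horner_mx_X]. Qed.

Lemma mxevalXn n p (Y : 'M[K]_n) k : mxeval (p ^+ k) Y = mpow (mxeval p Y) k.
Proof.
elim: k => [|k IH]; first by rewrite expr0 mxeval1.
by rewrite exprS mxevalM IH.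
Qed.

Lemma mxeval_comp n p q (Y : 'M[K]_n) : mxeval (p \Po q) Y = mxeval p (mxeval q Y).
Proof.
elim/poly_ind: p => [|p c IH]; first by rewrite comp_poly0 /mxeval size_poly0 !big_ord0.
rewrite comp_polyD comp_polyM comp_polyX comp_polyC !(mxevalD, mxevalM) IH.
by rewrite !mxevalC mxevalX.
Qed.

Lemma mxeval_intertwine m n p (V : 'M[K]_(m, n)) T T' :
  T *m V = V *m T' -> mxeval p T *m V = V *m mxeval p T'.
Proof.
move=> e; rewrite mulmx_suml mulmx_sumr; apply: eq_bigr => i _.
by rewrite -scalemxAl (mpow_intertwine _ e) scalemxAr.
Qed.

Lemma trmx_mxeval n p (Y : 'M[K]_n) : (mxeval p Y)^T = mxeval p Y^T.
Proof.
by rewrite /mxeval linear_sum; apply: eq_bigr => i _; rewrite linearZ /= trmx_mpow.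
Qed.

End MatrixPolynomials.

Lemma mxeval_scalar (K : comNzRingType) n (p : {poly K}) (c : K) :
  mxeval p (c%:M : 'M[K]_n) = (p.[c])%:M.
Proof.
elim/poly_ind: p => [|p a IH].
  by rewrite /mxeval size_poly0 big_ord0 horner0 raddf0.
by rewrite mxevalD mxevalM IH mxevalX mxevalC !hornerE -scalar_mxM raddfD.
Qed.

Section MatrixRational.
Variable K : fieldType.
Variables p q : {poly K}.

Lemma invmx_intertwine m n (V : 'M[K]_(m, n)) T T' :
  T \in unitmx -> T' \in unitmx -> T *m V = V *m T' -> invmx T *m V = V *m invmx T'.
Proof. by move=> uT uT' e; rewrite -[RHS](mulKmx uT) (mulmxA T) e mulmxK. Qed.

(** A singular [T] obeys this too, [invmx T] being [T] itself then. *)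
Lemma invmx_comm n (V T : 'M[K]_n) : T *m V = V *m T -> invmx T *m V = V *m invmx T.
Proof.
have [uT|nT] := boolP (T \in unitmx); first exact: invmx_intertwine.
by rewrite /invmx (negPf nT).
Qed.

Lemma mxrow_unitP n (T : 'M[K]_n) : reflect (forall v : 'rV_n, v *m T = 0 -> v = 0) (T \in unitmx).
Proof.
apply: (iffP idP) => [uT v /(congr1 (mulmx^~ (invmx T)))|h].
  by rewrite mulmxK // mul0mx.
rewrite -row_free_unit -kermx_eq0; apply/eqP/row_matrixP => i; rewrite row0.
by apply: h; rewrite -row_mul mulmx_ker row0.
Qed.

Lemma invmx_eq n (T V : 'M[K]_n) : T *m V = 1%:M -> invmx T = V.
Proof. by move=> e; have [uT _] := mulmx1_unit e; rewrite -[RHS](mulKmx uT) e mulmx1. Qed.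

Lemma unit_block_diag m n (S : 'M[K]_m) (T : 'M[K]_n) :
  (block_mx S 0 0 T \in unitmx) = (S \in unitmx) && (T \in unitmx).
Proof. by rewrite !unitmxE det_ublock unitrM. Qed.

Lemma mulmx_conj n (Q X Y : 'M[K]_n) : Q \in unitmx ->
  (Q *m X *m invmx Q) *m (Q *m Y *m invmx Q) = Q *m (X *m Y) *m invmx Q.
Proof. by move=> uQ; rewrite -!mulmxA (mulKmx uQ). Qed.

Lemma mulmx_conjV n (Q X Y : 'M[K]_n) : Q \in unitmx ->
  (invmx Q *m X *m Q) *m (invmx Q *m Y *m Q) = invmx Q *m (X *m Y) *m Q.
Proof. by move=> uQ; rewrite -!mulmxA (mulKVmx uQ). Qed.

Lemma eigenrow_conj n (Q X : 'M[K]_n) (v : 'rV_n) z : Q \in unitmx ->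
  v *m (Q *m X *m invmx Q) = z *: v -> (v *m Q) *m X = z *: (v *m Q).
Proof. by move=> uQ ev; rewrite scalemxAl -ev -!mulmxA (mulVmx uQ) mulmx1. Qed.

Lemma rmx_intertwine m n (V : 'M[K]_(m, n)) T T' :
  mxeval q T \in unitmx -> mxeval q T' \in unitmx -> T *m V = V *m T' ->
  rmx p q T *m V = V *m rmx p q T'.
Proof.
move=> uT uT' e; rewrite /rmx -mulmxA (invmx_intertwine uT uT' (mxeval_intertwine q e)).
by rewrite mulmxA (mxeval_intertwine _ e) mulmxA.
Qed.

Lemma mxeval_comm n (T V : 'M[K]_n) (r : {poly K}) :
  T *m V = V *m T -> mxeval r T *m V = V *m mxeval r T.
Proof. exact: mxeval_intertwine. Qed.

Lemma mxeval_comm2 n (T : 'M[K]_n) (r s : {poly K}) :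
  mxeval r T *m mxeval s T = mxeval s T *m mxeval r T.
Proof. by rewrite -!mxevalM mulrC. Qed.

Lemma rmx_comm n (T V : 'M[K]_n) : T *m V = V *m T -> rmx p q T *m V = V *m rmx p q T.
Proof.
move=> e; rewrite /rmx -mulmxA (invmx_comm (mxeval_comm _ e)).
by rewrite mulmxA (mxeval_comm _ e) mulmxA.
Qed.

Lemma trmx_rmx n (T : 'M[K]_n) : (rmx p q T)^T = rmx p q T^T.
Proof.
rewrite /rmx trmx_mul trmx_inv !trmx_mxeval.
by apply: invmx_comm; exact: mxeval_comm2.
Qed.

(* A G_k(A^2) and A G_k(A^T A) are the sign and polar iterates; G_k Y tends to
   Y^(-1/2).  Since invmx fixes singular matrices, the iterates are meaningful only
   under [Gdom]. *)
Fixpoint Giter n (Y : 'M[K]_n) k : 'M[K]_n :=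
  if k is k'.+1 then Giter Y k' *m rmx p q (1%:M - Y *m (Giter Y k' *m Giter Y k'))
  else 1%:M.

Definition Ziter n (Y : 'M[K]_n) k := 1%:M - Y *m (Giter Y k *m Giter Y k).

Lemma GiterS n (Y : 'M[K]_n) k : Giter Y k.+1 = Giter Y k *m rmx p q (Ziter Y k).
Proof. by []. Qed.

Definition Gdom n (Y : 'M[K]_n) k := forall j, (j < k)%N -> mxeval q (Ziter Y j) \in unitmx.

Lemma Giter_intertwine m n (V : 'M[K]_(m, n)) Y Y' k :
  Gdom Y k -> Gdom Y' k -> Y *m V = V *m Y' -> Giter Y k *m V = V *m Giter Y' k.
Proof.
move=> + + e; elim: k => [|k IH] uY uY'; first by rewrite mul1mx mulmx1.
have hG : Giter Y k *m V = V *m Giter Y' k.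
  by apply: IH => j jk; [apply: uY|apply: uY']; apply: ltnW.
rewrite !GiterS -mulmxA (rmx_intertwine (T' := Ziter Y' k)) ?uY ?uY' //.
  by rewrite mulmxA hG mulmxA.
rewrite mulmxBl mulmxBr mul1mx mulmx1; congr (_ - _).
by rewrite -!mulmxA hG (mulmxA _ V) hG !mulmxA e.
Qed.

(** Within a single matrix, commutation survives singular denominators; this is what separates it
    from [Giter_intertwine]. *)
Lemma Giter_comm n (V Y : 'M[K]_n) k : Y *m V = V *m Y -> Giter Y k *m V = V *m Giter Y k.
Proof.
move=> e; elim: k => [|k IH]; first by rewrite mul1mx mulmx1.
rewrite GiterS -mulmxA rmx_comm; first by rewrite mulmxA IH mulmxA.
rewrite mulmxBl mulmxBr mul1mx mulmx1; congr (_ - _).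
by rewrite -!mulmxA IH (mulmxA _ V) IH !mulmxA e.
Qed.

Lemma Giter_commY n (Y : 'M[K]_n) k : Giter Y k *m Y = Y *m Giter Y k.
Proof. exact: Giter_comm. Qed.

Lemma Ziter_comm n (V Y : 'M[K]_n) k : Y *m V = V *m Y -> Ziter Y k *m V = V *m Ziter Y k.
Proof.
move=> e; rewrite mulmxBl mulmxBr mul1mx mulmx1; congr (_ - _).
by rewrite -!mulmxA (Giter_comm _ e) (mulmxA _ V) (Giter_comm _ e) !mulmxA e.
Qed.

Lemma trmx_Giter n (Y : 'M[K]_n) k : (Giter Y k)^T = Giter Y^T k.
Proof.
elim: k => [|k IH]; first by rewrite trmx1.
have eZ : (Ziter Y k)^T = Ziter Y^T k.
  rewrite /Ziter linearB /= trmx1 !trmx_mul IH; congr (_ - _).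
  by rewrite -mulmxA Giter_commY !mulmxA Giter_commY.
rewrite !GiterS trmx_mul trmx_rmx eZ IH.
by rewrite rmx_comm //; apply: Ziter_comm; rewrite Giter_commY.
Qed.

Lemma trmx_Ziter n (Y : 'M[K]_n) k : (Ziter Y k)^T = Ziter Y^T k.
Proof.
rewrite /Ziter linearB /= trmx1 !trmx_mul trmx_Giter; congr (_ - _).
by rewrite -mulmxA Giter_commY !mulmxA Giter_commY.
Qed.

Lemma Gdom_tr n (Y : 'M[K]_n) k : Gdom Y k -> Gdom Y^T k.
Proof. by move=> u j jk; rewrite -trmx_Ziter -trmx_mxeval unitmx_tr u. Qed.

Lemma Gdom_lt n (Y : 'M[K]_n) j k : (j <= k)%N -> Gdom Y k -> Gdom Y j.
Proof. by move=> jk u i ij; apply: u; apply: leq_trans ij jk. Qed.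

(** Valid over any field, so that it serves both the real iteration and the complex one. *)
Lemma sign_iterE n (A : 'M[K]_n) k :
  iter k (fun X => X *m rmx p q (1%:M - X *m X)) A = A *m Giter (A *m A) k.
Proof.
elim: k => [|k /= ->]; first by rewrite mulmx1.
suff -> : A *m Giter (A *m A) k *m (A *m Giter (A *m A) k) =
    A *m A *m (Giter (A *m A) k *m Giter (A *m A) k) by rewrite [RHS]mulmxA.
rewrite -!mulmxA (mulmxA _ A) Giter_comm ?mulmxA //.
Qed.

Lemma polar_iterE m n (A : 'M[K]_(m, n)) k :
  iter k (fun X => X *m rmx p q (1%:M - X^T *m X)) A = A *m Giter (A^T *m A) k.
Proof.
elim: k => [|k /= ->]; first by rewrite mulmx1.
suff -> : (A *m Giter (A^T *m A) k)^T *m (A *m Giter (A^T *m A) k) =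
    A^T *m A *m (Giter (A^T *m A) k *m Giter (A^T *m A) k) by rewrite [RHS]mulmxA.
rewrite trmx_mul trmx_Giter trmx_mul trmxK [RHS]mulmxA -Giter_commY.
by rewrite !mulmxA.
Qed.

End MatrixRational.

(** * Identities satisfied by the Padé approximant *)

Section PadeIdentities.
Variable R : realType.
Implicit Types p q : {poly R}.

Lemma horner_bounded p : exists2 B : R, 0 <= B & forall x, `|x| <= 1 -> `|p.[x]| <= B.
Proof.
elim/poly_ind: p => [|p c [B B0 hB]]; first by exists 0 => // x _; rewrite horner0 normr0.
exists (B + `|c|) => [|x x1]; first by rewrite addr_ge0.
rewrite !hornerE (le_trans (ler_normD _ _)) // lerD2r normrM.
by rewrite -[B]mulr1 ler_pM // hB.
Qed.

Lemma polyD0 p : exists p1, p = p.[0]%:P + 'X * p1.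
Proof.
elim/poly_ind: p => [|p c _]; first by exists 0; rewrite horner0 mulr0 addr0.
by exists p; rewrite !hornerE mulrC addrC.
Qed.

(** The hypothesis leaves out x = 0 so that it survives division by X in the induction on [N]; the
    constant term vanishes by letting x tend to 0. *)
Lemma polyX_dvd_bigO p N (C delta : R) : 0 < delta ->
  (forall x, 0 < `|x| < delta -> `|p.[x]| <= C * `|x| ^+ N) ->
  exists p', p = p' * 'X^N.
Proof.
move=> d0; elim: N p => [|N IH] p h; first by exists p; rewrite expr0 mulr1.
have [p1 ep] := polyD0 p; have [B B0 hB] := horner_bounded p1.
have C0 : 0 <= C.
  have hx : 0 < `|delta / 2| < delta by rewrite gtr0_norm; lra.
  have := le_trans (normr_ge0 _) (h _ hx).
  by rewrite pmulr_lge0 // exprn_gt0 //; case/andP: hx.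
have p0 : p.[0] = 0.
  apply/eqP; rewrite -normr_le0; apply/ler_addgt0Pr => e e0; rewrite add0r.
  (* One sample point replaces the limit: it is so small that x B and C x, which bound the two terms
     below, add up to at most e. *)
  pose x := Num.min (Num.min (1 : R) (delta / 2)) (e / (B + C + 1)).
  have x0 : 0 < x by rewrite !lt_min ltr01 !divr_gt0 //; lra.
  have x1 : x <= 1 by rewrite !ge_min lexx.
  have xd : x < delta.
    have : x <= delta / 2 by rewrite !ge_min lexx orbT.
    lra.
  have xe : x * (B + C + 1) <= e.
    by rewrite -ler_pdivlMr ?ge_min ?lexx ?orbT //; lra.
  have ax : `|x| = x by rewrite gtr0_norm.
  have hx := h x; rewrite ax x0 xd {1}ep !hornerE in hx; have {}hx := hx isT.
  have hb := hB x; rewrite ax x1 in hb; have {}hb := hb isT.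
  have : `|p.[0]| <= `|p.[0] + x * p1.[x]| + `|x * p1.[x]|.
    by rewrite -{1}[p.[0]](addrK (x * p1.[x])) ler_normB.
  have : `|x * p1.[x]| <= x * B by rewrite normrM ax ler_wpM2l // ltW.
  have : C * x ^+ N.+1 <= C * x.
    by rewrite ler_wpM2l // exprS ler_piMr ?exprn_ile1 // ltW.
  nra.
have [x hx|p' ep'] := IH p1; last by exists p'; rewrite ep p0 add0r ep' exprSr mulrC mulrA.
have x0 : 0 < `|x| by case/andP: hx.
have := h x hx; rewrite {1}ep p0 add0r hornerM hornerX normrM exprS mulrCA.
by rewrite ler_pM2l.
Qed.

Lemma sqrt1B_le2 (x : R) : `|x| <= 1 -> Num.sqrt (1 - x) <= 2.
Proof.
move=> x1; rewrite -(@ler_pXn2r _ 2) ?nnegrE ?sqrtr_ge0 // sqr_sqrtr.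
  by have := ler_norm (- x); rewrite normrN; lra.
by have := ler_norm x; lra.
Qed.

Variables (l : nat) (p q : {poly R}).
Hypothesis pade : is_pade_invsqrt l p q.
Let N := (2 * l).+1%N.

Lemma pade_q0 : q.[0] = 1. Proof. by case: pade => _ [_ []]. Qed.

Lemma pade_p0 : p.[0] = 1.
Proof.
case: pade => _ [_ [q0 [C [d [d0]]]]] /(_ 0); rewrite normr0 => /(_ d0).
rewrite subr0 sqrtr1 q0 invr1 mulr1 expr0n mulr0 normr_le0 subr_eq0.
by move/eqP => <-.
Qed.

(** With s = sqrt(1 - x) the residual is s q (1/s - p/q) (q + s p), hence O(x^N). Its degree is at
    most 2l + 1 = N, which leaves only a multiple of x^N. *)
Lemma pade_residual : exists c, q ^+ 2 - (1 - 'X) * p ^+ 2 = c *: 'X^N.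
Proof.
case: pade => sp [sq [q0 [C [d [d0 h]]]]].
have [q1 eq1] := polyD0 q; rewrite q0 in eq1.
have [B1 B10 hB1] := horner_bounded q1.
have [Bp Bp0 hBp] := horner_bounded p; have [Bq Bq0 hBq] := horner_bounded q.
(* Below 1/(B1 + 1) the denominator q = 1 + x q1 cannot vanish; below 1 the bounds on p, q and q1
   apply. *)
pose e := Num.min (Num.min d 1) (1 / (B1 + 1)).
have e0 : 0 < e by rewrite !lt_min d0 ltr01 divr_gt0 //; lra.
have [|D eD] := @polyX_dvd_bigO (q ^+ 2 - (1 - 'X) * p ^+ 2) N
    ((2 * Bq * (Bq + 2 * Bp)) * C) e e0.
  move=> x /andP[x0]; rewrite !lt_min => /andP[/andP[xd x1] xB].
  have x1' : `|x| <= 1 by apply: ltW.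
  have {}hBp := hBp x x1'; have {}hBq := hBq x x1'; have {}hB1 := hB1 x x1'.
  rewrite ltr_pdivlMr in xB; last by lra.
  have qn0 : q.[x] != 0.
    apply/eqP => qx; have := congr1 (horner^~ x) eq1; rewrite /= qx !hornerE => e1.
    have e2 : x * q1.[x] = -1 by apply/eqP; rewrite -subr_eq0 opprK addrC -e1.
    have : `|x * q1.[x]| = 1 by rewrite e2 normrN1.
    by rewrite normrM; nra.
  have sx : 0 < 1 - x by have := ler_norm x; lra.
  pose s := Num.sqrt (1 - x).
  have s0 : 0 < s by rewrite sqrtr_gt0.
  have s2 : s ^+ 2 = 1 - x by rewrite sqr_sqrtr // ltW.
  have sle2 : s <= 2 by exact: sqrt1B_le2.
  have -> : (q ^+ 2 - (1 - 'X) * p ^+ 2).[x] =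
      (s * q.[x] * (s^-1 - p.[x] / q.[x])) * (q.[x] + s * p.[x]).
    have -> : (q ^+ 2 - (1 - 'X) * p ^+ 2).[x] = q.[x] ^+ 2 - s ^+ 2 * p.[x] ^+ 2.
      by rewrite hornerD hornerN !hornerM hornerD hornerN hornerX -polyC1 hornerC s2; ring.
    by field; rewrite qn0 gt_eqF.
  have hh := h x xd; rewrite -/s in hh.
  rewrite !normrM mulrAC -[leRHS]mulrA ler_pM // ?mulr_ge0 //.
  rewrite ler_pM // ?mulr_ge0 // ?(ler_pM _ _ _ hBq) // ?(gtr0_norm s0) //.
  rewrite (le_trans (ler_normD _ _)) // lerD // normrM (gtr0_norm s0).
  by rewrite ler_pM // ltW.
have sD : (size (q ^+ 2 - (1 - 'X) * p ^+ 2)%R <= N.+1)%N.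
  rewrite (leq_trans (size_polyD _ _)) // size_polyN geq_max.
  rewrite (leq_trans (size_poly_exp_leq _ _)) ?sq; last by rewrite /N; lia.
  rewrite (leq_trans (size_polyMleq _ _)) //.
  have := size_poly_exp_leq p 2; rewrite sp.
  have : (size (1 - 'X : {poly R})%R <= 2)%N.
    by rewrite -size_polyN opprB size_XsubC.
  move: (size (1 - 'X : {poly R})%R) (size (p ^+ 2)%R) => a b; rewrite /N; clear.
  by lia.
have [D0|D0] := eqVneq D 0; first by exists 0; rewrite eD D0 mul0r scale0r.
move: sD; rewrite {1}eD size_Mmonic ?monicXn // size_polyXn addnS /= addnC -addn1 leq_add2l.
by move/size1_polyC => eD0; exists D`_0; rewrite eD eD0 mul_polyC coefC.
Qed.

(** The substitution x = 1 - X^2 makes 1 - x a square, so that the residual becomes a difference of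
    two squares of polynomials. *)
Let mirror (r : {poly R}) := r \Po (1 - 'X^2).

Lemma size_mirror r : (size (mirror r) <= ((size r).-1 * 2).+1)%N.
Proof.
have h : ((size (1 - 'X^2 : {poly R})%R).-1 <= 2)%N.
  rewrite -subn1 leq_subLR (leq_trans (size_polyD _ _)) //.
  by rewrite size_polyN size_polyXn size_poly1.
apply: leq_trans (size_comp_poly_leq _ _) _.
by rewrite ltnS leq_mul2l h orbT.
Qed.

Lemma mirror_opp r : (mirror r) \Po (- 'X) = mirror r.
Proof.
by rewrite /mirror -comp_polyA comp_polyB comp_Xn_poly sqrrN comp_polyC.
Qed.

(* The residual at 1 - X^2 factors as (Q - X P)(Q + X P); the second factor does not
   vanish at 1, so (X - 1)^N divides the first, which has degree at most N. *)
Lemma pade_cayley : exists2 a : R, a != 0 &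
  mirror q - 'X * mirror p = a *: (1 - 'X) ^+ N /\
  mirror q + 'X * mirror p = a *: (1 + 'X) ^+ N.
Proof.
have [c ec] := pade_residual.
set F := mirror q - 'X * mirror p; set F' := mirror q + 'X * mirror p.
have at1 r : (mirror r).[1] = r.[0] /\ (mirror r).[-1] = r.[0].
  by rewrite /mirror !horner_comp !hornerE; split; congr (_.[_]); ring.
have FF' : F * F' = c *: (1 - 'X^2) ^+ N.
  rewrite -(comp_Xn_poly _ N) -comp_polyZ -ec comp_polyB !comp_polyM.
  rewrite comp_polyB comp_polyX comp_polyC /F /F' /mirror.
  by rewrite polyC1; ring.
have F1 : F'.[1] != 0.
  by rewrite /F' !hornerE !(at1 _).1 pade_p0 pade_q0 -mulr2n pnatr_eq0.
have cop : coprimep (('X - 1%:P) ^+ N) F'.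
  by rewrite coprimep_expl // coprimep_sym coprimep_XsubC /root.
have : (('X - 1%:P) ^+ N %| F)%R.
  rewrite -(Gauss_dvdpl _ cop) FF' -mul_polyC dvdp_mull //.
  rewrite (_ : 1 - 'X^2 = ('X - 1%:P) * (- (1 + 'X))); last by rewrite polyC1; ring.
  by rewrite exprMn dvdp_mulIl.
have sF : (size F <= N.+1)%N.
  rewrite (leq_trans (size_polyD _ _)) // size_polyN geq_max.
  have := size_mirror q; have := size_mirror p.
  case: pade => -> [-> _] /= hp hq.
  have lN : (l * 2 <= 2 * l)%N by rewrite mulnC.
  rewrite (leq_trans hq) ?ltnS /N; last by apply: leq_trans lN _.
  rewrite (leq_trans (size_polyMleq _ _)) // size_polyX /= ltnS.
  by rewrite (leq_trans hp) // ltnS.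
case/dvdpP => u eF.
(* The value at -1 excludes a zero quotient, hence a = 0. *)
have Fm1 : F.[-1] = 2 by rewrite /F !hornerE !(at1 _).2 pade_p0 pade_q0; ring.
have u0 : u != 0 by apply: contra_eq_neq Fm1 => u0; rewrite eF u0 mul0r horner0 eq_sym pnatr_eq0.
have eu : u = (u`_0)%:P.
  apply: size1_polyC; move: sF; rewrite eF size_Mmonic ?monic_exp ?monicXsubC //.
  by rewrite size_exp_XsubC addnS /= addnC -addn1 leq_add2l.
exists (u`_0 * (-1) ^+ N).
  by rewrite mulf_neq0 ?signr_eq0 //; apply: contraNneq u0 => e; rewrite eu e.
have eF2 : F = (u`_0 * (-1) ^+ N) *: (1 - 'X) ^+ N.
  rewrite eF {1}eu mul_polyC -scalerA; congr (_ *: _).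
  rewrite polyC1 -(opprB 1 'X) [LHS]exprNn -mul_polyC.
  by rewrite polyC_exp polyCN polyC1.
(* The second identity is the first one at -X, mirrored polynomials being even. *)
split=> //; have := congr1 (fun r => r \Po (- 'X)) eF2.
rewrite /F comp_polyB comp_polyM !mirror_opp comp_polyX mulNr opprK -/F' => ->.
rewrite comp_polyZ; congr (_ *: _).
by rewrite rmorphXn /= comp_polyB comp_polyX comp_polyC opprK polyC1.
Qed.

Lemma coef_1DXn (n i : nat) : ((1 + 'X : {poly R}) ^+ n)`_i = 'C(n, i)%:R.
Proof.
rewrite addrC exprD1n coef_sum; under eq_bigr do rewrite coefMn coefXn.
have [lin|lni] := ltnP i n.+1.
  rewrite (bigD1 (Ordinal lin)) //= eqxx big1 ?addr0 // => j ji.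
  by rewrite (_ : i == j = false) ?mul0rn //; apply/negbTE; rewrite eq_sym.
rewrite bin_small // big1 // => j _; rewrite (_ : i == j = false) ?mul0rn //.
by apply/negbTE; rewrite neq_ltn (leq_trans (ltn_ord j) lni) orbT.
Qed.

(** In a (1 + X)^N the even coefficients come from q and the odd ones from X p. Since N is odd, the
    symmetry of binomials exchanges the exponents 2j and N - 2j = 2(l - j) + 1. *)
Lemma pade_reversal j : (j <= l)%N -> (p \Po (1 - 'X))`_(l - j) = (q \Po (1 - 'X))`_j.
Proof.
move=> jl; have [a a0 [_ e]] := pade_cayley.
have em r : mirror r = (r \Po (1 - 'X)) \Po 'X^2.
  by rewrite -comp_polyA comp_polyB comp_polyX comp_polyC polyC1.
rewrite !em in e.
have := congr1 (fun r : {poly R} => r`_(2 * j)) e.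
have := congr1 (fun r : {poly R} => r`_(2 * (l - j)).+1) e.
rewrite /= !coefD !coefXM !coef_comp_poly_Xn // !coefZ !coef_1DXn /=.
rewrite !dvdn_mulr // !mulKn //.
have -> : (2 %| (2 * (l - j)).+1)%N = false by rewrite dvdn2 /= oddM.
rewrite add0r => ->.
have -> : (if (2 * j == 0)%N then 0 else if (2 %| (2 * j).-1)%N then
   (p \Po (1 - 'X))`_((2 * j).-1 %/ 2) else 0) = 0.
  case: eqP => // /eqP j0; rewrite (_ : (2 %| _)%N = false) //.
  case: j j0 {jl} => // j _; rewrite mulnS /= dvdn2 /= oddM //.
rewrite addr0 => ->; congr (_ * _%:R); rewrite -bin_sub; last by rewrite /N; lia.
by congr ('C(_, _)); rewrite /N; lia.
Qed.

End PadeIdentities.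

Lemma size_comp_1B (R : realType) (p : {poly R}) : (size (p \Po (1 - 'X)) <= size p)%N.
Proof.
have -> : 1 - 'X = - ('X - 1%:P) :> {poly R} by rewrite opprB.
by rewrite size_comp_poly2 // size_polyN size_XsubC.
Qed.

Lemma mxeval_widen (K : comNzRingType) n (p : {poly K}) (Y : 'M[K]_n) d : (size p <= d)%N ->
  mxeval p Y = \sum_(i < d) p`_i *: mpow Y i.
Proof.
move=> sd; rewrite /mxeval (big_ord_widen _ (fun i => p`_i *: mpow Y i) sd) big_mkcond.
apply: eq_bigr => i _; case: ifPn => //; rewrite -leqNgt => h.
by rewrite nth_default // scale0r.
Qed.

Lemma mxeval_comp_1B (K : comNzRingType) n (p : {poly K}) (Y : 'M[K]_n) :
  mxeval (p \Po (1 - 'X)) Y = mxeval p (1%:M - Y).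
Proof. by rewrite mxeval_comp mxevalB mxeval1 mxevalX. Qed.

(** The reversal of coefficients read as x^l q(1 - 1/x) = p(1 - x); it is the source of the
    reciprocity of r. *)
Lemma pade_mirror (R : realType) (l : nat) (p q : {poly R}) n (Y : 'M[R]_n) :
  is_pade_invsqrt l p q -> Y \in unitmx ->
  mpow Y l *m mxeval q (1%:M - invmx Y) = mxeval p (1%:M - Y).
Proof.
move=> pade uY; case: (pade) => sp [sq _].
rewrite -!mxeval_comp_1B (@mxeval_widen _ _ (q \Po _) _ l.+1); last first.
  by rewrite -sq size_comp_1B.
rewrite (@mxeval_widen _ _ (p \Po _) _ l.+1); last by rewrite -sp size_comp_1B.
rewrite mulmx_sumr [RHS](reindex_inj rev_ord_inj) /=; apply: eq_bigr => i _.
have il : (i <= l)%N by rewrite -ltnS.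
rewrite subSS (pade_reversal pade il) -scalemxAr; congr (_ *: _).
by rewrite -{1}(subnK il) mpowD -mulmxA -mpow_mulC ?mulmxV ?mulVmx // mpow1 mulmx1.
Qed.

(** * Norm, convergence and Lipschitz estimates *)

Section EntrywiseNorm.
Variable R : realType.

(** The entrywise 1-norm is submultiplicative for all shapes, additive over blocks, and dominates
    the Frobenius norm. *)
Definition nrm m n (A : 'M[R]_(m, n)) : R := \sum_i \sum_j `|A i j|.

Lemma nrm_ge0 m n (A : 'M[R]_(m, n)) : 0 <= nrm A.
Proof. by rewrite sumr_ge0 // => i _; rewrite sumr_ge0. Qed.

Lemma nrm_entry m n (A : 'M[R]_(m, n)) i j : `|A i j| <= nrm A.
Proof.
rewrite /nrm (bigD1 i) //= (bigD1 j) //= -addrA lerDl addr_ge0 ?sumr_ge0 //.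
by move=> k _; rewrite sumr_ge0.
Qed.

Lemma nrm0 m n : nrm (0 : 'M[R]_(m, n)) = 0.
Proof. by rewrite /nrm big1 // => i _; rewrite big1 // => j _; rewrite mxE normr0. Qed.

Lemma nrm0_eq0 m n (A : 'M[R]_(m, n)) : nrm A <= 0 -> A = 0.
Proof.
move=> h; apply/matrixP => i j; rewrite mxE; apply/eqP; rewrite -normr_le0.
exact: le_trans (nrm_entry A i j) h.
Qed.

Lemma nrmD m n (A B : 'M[R]_(m, n)) : nrm (A + B) <= nrm A + nrm B.
Proof.
rewrite /nrm -big_split ler_sum //= => i _; rewrite -big_split ler_sum //= => j _.
by rewrite mxE ler_normD.
Qed.

Lemma nrmN m n (A : 'M[R]_(m, n)) : nrm (- A) = nrm A.
Proof. by apply: eq_bigr => i _; apply: eq_bigr => j _; rewrite mxE normrN. Qed.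

Lemma nrm_distC m n (A B : 'M[R]_(m, n)) : nrm (A - B) = nrm (B - A).
Proof. by rewrite -nrmN opprB. Qed.

Lemma nrm_subr m n (A B : 'M[R]_(m, n)) : nrm A <= nrm (A - B) + nrm B.
Proof. by rewrite -{1}(subrK B A) nrmD. Qed.

Lemma nrmZ m n c (A : 'M[R]_(m, n)) : nrm (c *: A) = `|c| * nrm A.
Proof.
rewrite /nrm mulr_sumr; apply: eq_bigr => i _; rewrite mulr_sumr.
by apply: eq_bigr => j _; rewrite mxE normrM.
Qed.

Lemma nrmM m n r (A : 'M[R]_(m, n)) (B : 'M[R]_(n, r)) : nrm (A *m B) <= nrm A * nrm B.
Proof.
rewrite /nrm mulr_suml ler_sum // => i _.
apply: (@le_trans _ _ (\sum_j \sum_k `|A i k| * `|B k j|)).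
  apply: ler_sum => j _; rewrite mxE (le_trans (ler_norm_sum _ _ _)) //.
  by apply: ler_sum => k _; rewrite normrM.
rewrite exchange_big mulr_suml ler_sum //= => k _.
rewrite -mulr_sumr ler_wpM2l // (bigD1 k) //= lerDl sumr_ge0 // => k' _.
by rewrite sumr_ge0.
Qed.

Lemma nrm_tr m n (A : 'M[R]_(m, n)) : nrm A^T = nrm A.
Proof.
rewrite /nrm exchange_big; apply: eq_bigr => i _.
by apply: eq_bigr => j _; rewrite mxE.
Qed.

Lemma nrm_row_mx m n1 n2 (A : 'M[R]_(m, n1)) (B : 'M[R]_(m, n2)) :
  nrm (row_mx A B) = nrm A + nrm B.
Proof.
rewrite /nrm -big_split; apply: eq_bigr => i _; rewrite big_split_ord /=.
by congr (_ + _); apply: eq_bigr => j _; rewrite ?row_mxEl ?row_mxEr.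
Qed.

Lemma nrm_col_mx m1 m2 n (A : 'M[R]_(m1, n)) (B : 'M[R]_(m2, n)) :
  nrm (col_mx A B) = nrm A + nrm B.
Proof. by rewrite -nrm_tr tr_col_mx nrm_row_mx !nrm_tr. Qed.

Lemma nrm_block m1 m2 n1 n2 (A : 'M[R]_(m1, n1)) (B : 'M[R]_(m1, n2))
  (C : 'M[R]_(m2, n1)) (D : 'M[R]_(m2, n2)) :
  nrm (block_mx A B C D) = nrm A + nrm B + (nrm C + nrm D).
Proof. by rewrite /block_mx nrm_col_mx !nrm_row_mx. Qed.

Lemma nrm_submx m1 m2 n1 n2 (A : 'M[R]_(m1 + m2, n1 + n2)) :
  [/\ nrm (ulsubmx A) <= nrm A, nrm (ursubmx A) <= nrm A,
      nrm (dlsubmx A) <= nrm A & nrm (drsubmx A) <= nrm A].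
Proof.
rewrite -{2 4 6 8}(submxK A) nrm_block.
have := (nrm_ge0 (ulsubmx A), nrm_ge0 (ursubmx A), nrm_ge0 (dlsubmx A), nrm_ge0 (drsubmx A)).
by case=> [[[h1 h2] h3] h4]; split; lra.
Qed.

Lemma nrm1 n : nrm (1%:M : 'M[R]_n) = n%:R.
Proof.
rewrite /nrm (eq_bigr (fun=> 1)) ?sumr_const ?card_ord // => i _.
rewrite (bigD1 i) //= mxE eqxx normr1 big1 ?addr0 // => j ji.
by rewrite mxE eq_sym (negPf ji) normr0.
Qed.

Lemma frob_nrm m n (A : 'M[R]_(m, n)) : frob A <= nrm A.
Proof.
have sq (I : finType) (u : I -> R) : (forall i, 0 <= u i) ->
    \sum_i u i ^+ 2 <= (\sum_i u i) ^+ 2.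
  move=> u0; rewrite expr2 mulr_suml ler_sum // => i _.
  by rewrite expr2 ler_wpM2l // (bigD1 i) //= lerDl sumr_ge0.
rewrite /frob -(ger0_norm (nrm_ge0 A)) -sqrtr_sqr ler_sqrt ?exprn_ge0 ?nrm_ge0 //.
apply: le_trans (sq _ (fun i => \sum_j `|A i j|) _); last by move=> i; rewrite sumr_ge0.
apply: ler_sum => i _; apply: le_trans (sq _ (fun j => `|A i j|) _) => //.
by apply: ler_sum => j _; rewrite real_normK // num_real.
Qed.

Lemma mx_norm_nrm m n (A : 'M[R]_(m, n)) : `|A| <= nrm A.
Proof.
rewrite [leLHS]/Num.Def.normr/= mx_normrE (bigmax_le _ (nrm_ge0 A)) //= => -[i j] _ /=.
exact: nrm_entry.
Qed.

Lemma nrm_mx_norm m n (A : 'M[R]_(m, n)) : nrm A <= (m * n)%:R * `|A|.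
Proof.
apply: (@le_trans _ _ (\sum_(i < m) \sum_(j < n) `|A|)).
  apply: ler_sum => i _; apply: ler_sum => j _.
  by rewrite [leRHS]/Num.Def.normr/= mx_normrE; apply/bigmax_geP; right => /=; exists (i, j).
by rewrite !sumr_const !card_ord -mulrnA mulr_natl mulnC.
Qed.

Lemma near_nrm m n (A : 'M[R]_(m, n)) (P : 'M[R]_(m, n) -> Prop) :
  (exists2 d, 0 < d & forall B, nrm (B - A) < d -> P B) <-> (\forall B \near A, P B).
Proof.
split=> [[d d0 h]|/nbhs_normP [d /= d0 h]].
  apply/nbhs_normP; exists (d / ((m * n)%:R + 1)) => /=.
    by rewrite divr_gt0 // ltr_wpDl.
  move=> B /=; rewrite ltr_pdivlMr ?ltr_wpDl // => hB; apply: h.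
  rewrite nrm_distC; apply: le_lt_trans (nrm_mx_norm _) _.
  by apply: le_lt_trans hB; rewrite mulrC ler_wpM2l // lerDl.
exists d => // B hB; apply: h => /=; apply: le_lt_trans (mx_norm_nrm _) _.
by rewrite nrm_distC.
Qed.

Lemma near_nrm_lt m n (A : 'M[R]_(m, n)) e : 0 < e -> \forall B \near A, nrm (B - A) < e.
Proof. by move=> e0; apply/near_nrm; exists e. Qed.

Definition cvm m n (X : nat -> 'M[R]_(m, n)) L := nrm (X k - L) @[k --> \oo] --> (0 : R).

Lemma cvmP m n (X : nat -> 'M[R]_(m, n)) L : cvm X L <-> X @ \oo --> L.
Proof.
split=> h.
  apply/cvgrPdist_lt => e e0; move/cvgrPdist_lt: h => /(_ e e0).
  apply: filterS => k; rewrite sub0r normrN ger0_norm ?nrm_ge0 // nrm_distC.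
  exact: le_lt_trans (mx_norm_nrm _).
apply/cvgrPdist_lt => e e0.
have H : \forall k \near \oo, nrm (X k - L) < e := h _ (near_nrm_lt L e0).
apply: filterS H => k /= hk.
by rewrite sub0r normrN ger0_norm ?nrm_ge0.
Qed.

Lemma cvm_le m n (X : nat -> 'M[R]_(m, n)) L (u : nat -> R) :
  (forall k, nrm (X k - L) <= u k) -> u @ \oo --> 0 -> cvm X L.
Proof.
move=> h u0; apply: (squeeze_cvgr _ (cvg_cst (0 : R)) u0).
by near=> k; rewrite nrm_ge0 h.
Unshelve. all: by end_near. Qed.

Lemma cvm_unique m n (X : nat -> 'M[R]_(m, n)) L L' : cvm X L -> cvm X L' -> L = L'.
Proof.
move=> /cvmP h /cvmP h'.
by rewrite -(cvg_lim (@norm_hausdorff _ _) h) -(cvg_lim (@norm_hausdorff _ _) h').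
Qed.

Lemma cvm_cst m n (L : 'M[R]_(m, n)) : cvm (fun=> L) L.
Proof. by apply/cvmP; exact: cvg_cst. Qed.

Lemma cvmD m n (X Y : nat -> 'M[R]_(m, n)) L M :
  cvm X L -> cvm Y M -> cvm (fun k => X k + Y k) (L + M).
Proof. by move=> /cvmP h /cvmP h'; apply/cvmP; exact: cvgD. Qed.

Lemma cvmN m n (X : nat -> 'M[R]_(m, n)) L : cvm X L -> cvm (fun k => - X k) (- L).
Proof. by move=> /cvmP h; apply/cvmP; exact: cvgN. Qed.

Lemma cvmM m n r (X : nat -> 'M[R]_(m, n)) (Y : nat -> 'M[R]_(n, r)) L M :
  cvm X L -> cvm Y M -> cvm (fun k => X k *m Y k) (L *m M).
Proof.
move=> h h'; pose u k := nrm (X k - L); pose v k := nrm (Y k - M).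
apply: (@cvm_le _ _ _ _ (fun k => u k * v k + (u k * nrm M + nrm L * v k))) => [k|].
  have -> : X k *m Y k - L *m M =
      (X k - L) *m (Y k - M) + ((X k - L) *m M + L *m (Y k - M)).
    rewrite !mulmxBl !mulmxBr !addrA [X in _ = X + _ - _]addrC.
    rewrite opprB; set a := X k *m Y k; set b := L *m Y k; set c := X k *m M; set d := L *m M.
    by apply/matrixP => i j; rewrite !mxE; ring.
  apply: le_trans (nrmD _ _) _; rewrite lerD ?nrmM //.
  by apply: le_trans (nrmD _ _) _; rewrite lerD ?nrmM.
rewrite (_ : nbhs (0 : R) = nbhs (0 * 0 + (0 * nrm M + nrm L * 0))); last first.
  by rewrite !(mul0r, mulr0, addr0).
apply: cvgD; first exact: cvgM.
by apply: cvgD; apply: cvgM => //; exact: cvg_cst.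
Qed.

Lemma cvm_comp m n r s (f : 'M[R]_(m, n) -> 'M[R]_(r, s)) (X : nat -> 'M[R]_(m, n)) L C :
  (forall A B, nrm (f A - f B) <= C * nrm (A - B)) -> cvm X L -> cvm (f \o X) (f L).
Proof.
move=> hf h; apply: (@cvm_le _ _ _ _ (fun k => C * nrm (X k - L))) => [k|]; first exact: hf.
by rewrite -[0 : R](mulr0 C); apply: cvgM => //; exact: cvg_cst.
Qed.

Lemma cvm_submx m1 m2 n1 n2 (X : nat -> 'M[R]_(m1 + m2, n1 + n2)) L : cvm X L ->
  [/\ cvm (fun k => ulsubmx (X k)) (ulsubmx L), cvm (fun k => ursubmx (X k)) (ursubmx L),
      cvm (fun k => dlsubmx (X k)) (dlsubmx L) & cvm (fun k => drsubmx (X k)) (drsubmx L)].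
Proof.
move=> h; split; [apply: (cvm_comp (f := ulsubmx) (C := 1) _ h)
  |apply: (cvm_comp (f := ursubmx) (C := 1) _ h)|apply: (cvm_comp (f := dlsubmx) (C := 1) _ h)
  |apply: (cvm_comp (f := drsubmx) (C := 1) _ h)] => A B; rewrite mul1r -!linearB;
  by case: (nrm_submx (A - B)).
Qed.

Lemma cvm_tr m n (X : nat -> 'M[R]_(m, n)) L : cvm X L -> cvm (fun k => (X k)^T) L^T.
Proof.
move=> h; apply: (cvm_comp (C := 1) _ h) => A B.
by rewrite mul1r -raddfB nrm_tr.
Qed.

Lemma cvm_eq m n (X Y : nat -> 'M[R]_(m, n)) L : (forall k, X k = Y k) -> cvm X L -> cvm Y L.
Proof. by move=> e h; rewrite /cvm -(funext e). Qed.

Lemma cvm_block m1 m2 n1 n2 (A : nat -> 'M[R]_(m1, n1)) (B : nat -> 'M[R]_(m1, n2))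
  (C : nat -> 'M[R]_(m2, n1)) (D : nat -> 'M[R]_(m2, n2)) a b c d :
  cvm A a -> cvm B b -> cvm C c -> cvm D d ->
  cvm (fun k => block_mx (A k) (B k) (C k) (D k)) (block_mx a b c d).
Proof.
move=> ha hb hc hd; apply: (@cvm_le _ _ _ _ (fun k => nrm (A k - a) + nrm (B k - b)
  + (nrm (C k - c) + nrm (D k - d)))) => [k|].
  by rewrite opp_block_mx add_block_mx nrm_block.
rewrite (_ : nbhs (0 : R) = nbhs (0 + 0 + (0 + 0) : R)); last by rewrite !addr0.
by apply: cvgD; apply: cvgD.
Qed.

(** Each entry is a telescoping series dominated by a geometric one. *)
Lemma cvm_geometric m n (X : nat -> 'M[R]_(m, n)) C :
  (forall k, nrm (X k.+1 - X k) <= C * (2^-1) ^+ k) -> exists L, cvm X L.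
Proof.
move=> h.
have ent i j : cvgn (fun k => X k i j).
  have e : (fun k => X k i j) = (fun k => X 0%N i j + series (telescope (fun k => X k i j)) k).
    by apply/funext => k; rewrite telescopeK /= addrC subrK.
  rewrite e; apply: is_cvgD; first exact: is_cvg_cst.
  apply: normed_cvg.
  apply: (@series_le_cvg _ _ (geometric C (2^-1 : R))) => [k|k|k|].
  - exact: normr_ge0.
  - exact: le_trans (nrm_ge0 _) (h k).
  - apply: le_trans (h k); rewrite /telescope.
    by have := nrm_entry (X k.+1 - X k) i j; rewrite !mxE.
  - by apply: is_cvg_geometric_series; rewrite gtr0_norm ?invr_gt0 // invf_lt1 // ltr1n.
exists (\matrix_(i, j) lim ((fun k => X k i j) @ \oo)).
pose s k := \sum_i \sum_j `|X k i j - lim ((fun k => X k i j) @ \oo)|.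
apply: (@cvm_le _ _ _ _ s) => [k|].
  by apply: ler_sum => i _; apply: ler_sum => j _; rewrite !mxE.
have sum0 (I : Type) (r : seq I) (u : I -> nat -> R) :
    (forall i, u i @ \oo --> 0) -> (fun k => \sum_(i <- r) u i k) @ \oo --> 0.
  move=> hu; elim: r => [|i r IH].
    by under eq_fun do rewrite big_nil; exact: cvg_cst.
  under eq_fun do rewrite big_cons.
  rewrite (_ : nbhs (0 : R) = nbhs (0 + 0 : R)); last by rewrite addr0.
  by apply: cvgD.
apply: (sum0 _ _ (fun i k => \sum_j _)) => i; apply: (sum0 _ _ (fun j k => `|_|)) => j.
rewrite -[0 : R](@normr0 _ R); apply: cvg_norm.
by rewrite -(subrr (lim ((fun k => X k i j) @ \oo))); apply: cvgB; [exact: ent|exact: cvg_cst].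
Qed.

End EntrywiseNorm.

Section LipschitzAtPoint.
Variable R : realType.

(** Lipschitz relative to the centre [x] only. This is stable under products and inverses, and it
    already transports an O(h^2) error from argument to value. *)
Definition lipat m n r s (f : 'M[R]_(m, n) -> 'M[R]_(r, s)) x :=
  exists C : R, \forall y \near x, nrm (f y - f x) <= C * nrm (y - x).

Lemma lipat_cvg m n r s (f : 'M[R]_(m, n) -> 'M[R]_(r, s)) x (P : 'M[R]_(r, s) -> Prop) :
  lipat f x -> (\forall z \near f x, P z) -> \forall y \near x, P (f y).
Proof.
case=> C hC /near_nrm [d d0 hP].
have hd : 0 < d / (`|C| + 1) by rewrite divr_gt0 // ltr_wpDl.
near=> y; apply: hP; apply: le_lt_trans (_ : C * nrm (y - x) < d); first by near: y.
have h : nrm (y - x) < d / (`|C| + 1) by near: y; exact: near_nrm_lt.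
rewrite ltr_pdivlMr ?ltr_wpDl // in h.
apply: le_lt_trans h; rewrite mulrC ler_wpM2l ?nrm_ge0 //.
by rewrite (le_trans (ler_norm C)) // lerDl.
Unshelve. all: by end_near. Qed.

Lemma lipat_bounded m n r s (f : 'M[R]_(m, n) -> 'M[R]_(r, s)) x : lipat f x ->
  \forall y \near x, nrm (f y) <= nrm (f x) + 1.
Proof.
move=> h; apply: (lipat_cvg (P := fun z => nrm z <= nrm (f x) + 1) h).
apply/near_nrm; exists 1 => // z hz; have := nrm_subr z (f x).
by move/le_trans; apply; rewrite addrC lerD2l ltW.
Qed.

Lemma lipat_cst m n r s (A : 'M[R]_(r, s)) (x : 'M[R]_(m, n)) : lipat (fun=> A) x.
Proof. by exists 0; near=> y; rewrite subrr nrm0 mul0r.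
Unshelve. all: by end_near. Qed.

Lemma lipat_id m n (x : 'M[R]_(m, n)) : lipat id x.
Proof. by exists 1; near=> y; rewrite mul1r.
Unshelve. all: by end_near. Qed.

Lemma lipatD m n r s (f g : 'M[R]_(m, n) -> 'M[R]_(r, s)) x :
  lipat f x -> lipat g x -> lipat (fun y => f y + g y) x.
Proof.
case=> C hC [D hD]; exists (C + D); near=> y; rewrite opprD addrACA mulrDl.
apply: le_trans (nrmD _ _) _; apply: lerD.
  by near: y.
by near: y.
Unshelve. all: by end_near. Qed.

Lemma lipatN m n r s (f : 'M[R]_(m, n) -> 'M[R]_(r, s)) x :
  lipat f x -> lipat (fun y => - f y) x.
Proof.
by case=> C hC; exists C; near=> y; rewrite -opprD nrmN; near: y.
Unshelve. all: by end_near. Qed.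

Lemma lipatM m n r s t (f : 'M[R]_(m, n) -> 'M[R]_(r, s)) (g : 'M[R]_(m, n) -> 'M[R]_(s, t)) x :
  lipat f x -> lipat g x -> lipat (fun y => f y *m g y) x.
Proof.
move=> hf hg; case: (hf) (hg) => C hC [D hD].
exists (C * (nrm (g x) + 1) + nrm (f x) * D); near=> y.
have -> : f y *m g y - f x *m g x = (f y - f x) *m g y + f x *m (g y - g x).
  by rewrite mulmxBl mulmxBr addrA subrK.
have hCy : nrm (f y - f x) <= C * nrm (y - x) by near: y.
have hDy : nrm (g y - g x) <= D * nrm (y - x) by near: y.
apply: le_trans (nrmD _ _) _; rewrite [leRHS]mulrDl; apply: lerD.
  apply: le_trans (nrmM _ _) _; rewrite mulrAC ler_pM ?nrm_ge0 //.
  by near: y; exact: lipat_bounded.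
by apply: le_trans (nrmM _ _) _; rewrite -mulrA ler_wpM2l ?nrm_ge0.
Unshelve. all: by end_near. Qed.

(** If v T = 0 then v = v (T0 - T) T0^(-1), whose norm is at most half that of v. The same halving
    bounds the inverse. *)
Lemma invmx_near n (T0 T : 'M[R]_n) : T0 \in unitmx ->
  nrm (T - T0) * nrm (invmx T0) <= 2^-1 ->
  T \in unitmx /\ nrm (invmx T) <= 2 * nrm (invmx T0).
Proof.
move=> uT0 h; have uT : T \in unitmx.
  apply/mxrow_unitP => v vT; apply: nrm0_eq0.
  have e : v = v *m ((T0 - T) *m invmx T0).
    by rewrite mulmxBl mulmxV // mulmxBr mulmx1 mulmxA vT mul0mx subr0.
  have : nrm v <= nrm v * 2^-1.
    rewrite {1}e (le_trans (nrmM _ _)) // ler_wpM2l ?nrm_ge0 //.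
    by rewrite (le_trans (nrmM _ _)) // nrm_distC.
  have := nrm_ge0 v; lra.
split=> //.
have e : invmx T = invmx T0 + invmx T *m ((T0 - T) *m invmx T0).
  by rewrite mulmxA mulmxBr mulVmx // mulmxBl mul1mx -mulmxA mulmxV // mulmx1 subrKC.
have : nrm (invmx T) <= nrm (invmx T0) + nrm (invmx T) * 2^-1.
  rewrite {1}e (le_trans (nrmD _ _)) // lerD2l (le_trans (nrmM _ _)) //.
  by rewrite ler_wpM2l ?nrm_ge0 // (le_trans (nrmM _ _)) // nrm_distC.
lra.
Qed.

Lemma near_unitmx n (T0 : 'M[R]_n) : T0 \in unitmx ->
  \forall T \near T0, T \in unitmx /\ nrm (invmx T) <= 2 * nrm (invmx T0).
Proof.
move=> uT0; apply/near_nrm; exists (2^-1 / (nrm (invmx T0) + 1)).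
  by rewrite divr_gt0 // ?invr_gt0 // ltr_wpDl ?nrm_ge0.
move=> T hT; apply: invmx_near => //; rewrite ltr_pdivlMr ?ltr_wpDl ?nrm_ge0 // in hT.
by apply: le_trans (ltW hT); rewrite ler_wpM2l ?nrm_ge0 // lerDl.
Qed.

Lemma lipat_inv m n r (f : 'M[R]_(m, n) -> 'M[R]_r) x : f x \in unitmx ->
  lipat f x -> lipat (fun y => invmx (f y)) x.
Proof.
move=> uf hf; case: (hf) => C hC; exists (2 * nrm (invmx (f x)) * C * nrm (invmx (f x))).
near=> y.
have [uy hy] : f y \in unitmx /\ nrm (invmx (f y)) <= 2 * nrm (invmx (f x)).
  by near: y; apply: (lipat_cvg (P := fun T => T \in unitmx /\
    nrm (invmx T) <= 2 * nrm (invmx (f x))) hf); exact: near_unitmx.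
have -> : invmx (f y) - invmx (f x) = invmx (f y) *m (f x - f y) *m invmx (f x).
  by rewrite mulmxBr mulVmx // mulmxBl mul1mx -mulmxA mulmxV // mulmx1.
apply: le_trans (nrmM _ _) _; rewrite mulrAC ler_wpM2r ?nrm_ge0 //.
apply: le_trans (nrmM _ _) _; rewrite -[leRHS]mulrA ler_pM ?nrm_ge0 //.
by rewrite nrm_distC; near: y.
Unshelve. all: by end_near. Qed.

Lemma lipat_mxeval m n r (f : 'M[R]_(m, n) -> 'M[R]_r) x (p : {poly R}) :
  lipat f x -> lipat (fun y => mxeval p (f y)) x.
Proof.
move=> hf; elim/poly_ind: p => [|p c IH].
  rewrite (_ : (fun y => _) = (fun=> 0 : 'M[R]_r)); first exact: lipat_cst.
  by apply/funext => y; rewrite -polyC0 mxevalC raddf0.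
rewrite (_ : (fun y => _) = (fun y => mxeval p (f y) *m f y + c%:M)).
  by apply: lipatD; [exact: lipatM|exact: lipat_cst].
by apply/funext => y; rewrite mxevalD mxevalM mxevalX mxevalC.
Qed.

Lemma lipat_rmx m n r (f : 'M[R]_(m, n) -> 'M[R]_r) x (p q : {poly R}) :
  mxeval q (f x) \in unitmx -> lipat f x -> lipat (fun y => rmx p q (f y)) x.
Proof.
move=> u hf; apply: lipatM; first exact: lipat_mxeval.
by apply: lipat_inv => //; exact: lipat_mxeval.
Qed.

Lemma lipat_Ziter_of n p q (Y : 'M[R]_n) k :
  lipat (fun Y => Giter p q Y k) Y -> lipat (fun Y => Ziter p q Y k) Y.
Proof.
move=> h; apply: lipatD; first exact: lipat_cst.
by apply: lipatN; apply: lipatM; [exact: lipat_id|exact: lipatM].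
Qed.

Lemma lipat_Giter n p q (Y : 'M[R]_n) k : Gdom p q Y k ->
  lipat (fun Y => Giter p q Y k) Y.
Proof.
elim: k => [|k IH] u; first exact: lipat_cst.
have h : lipat (fun Y => Giter p q Y k) Y by apply: IH; apply: Gdom_lt u.
apply: lipatM => //; apply: lipat_rmx; first exact: u.
exact: lipat_Ziter_of.
Qed.

Lemma lipat_Ziter n p q (Y : 'M[R]_n) k : Gdom p q Y k ->
  lipat (fun Y => Ziter p q Y k) Y.
Proof. by move=> u; apply: lipat_Ziter_of; exact: lipat_Giter. Qed.

Lemma near_Gdom n p q (Y : 'M[R]_n) k : Gdom p q Y k -> \forall Y' \near Y, Gdom p q Y' k.
Proof.
elim: k => [|k IH] u; first by near=> y; move=> j.
have [u1 u2] : Gdom p q Y k /\ mxeval q (Ziter p q Y k) \in unitmx.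
  by split; [exact: Gdom_lt u|exact: u].
near=> Y' => j; rewrite ltnS leq_eqVlt => /orP[/eqP ->|].
  near: Y'; apply: (lipat_cvg (f := fun Y => mxeval q (Ziter p q Y k))
    (P := fun T => T \in unitmx)).
    by apply: lipat_mxeval; exact: lipat_Ziter.
  by apply: filterS (near_unitmx u2) => T [].
by move: j; near: Y'; exact: IH.
Unshelve. all: by end_near. Qed.

Lemma mxeval_bounded n (p : {poly R}) : exists2 B : R, 0 < B &
  forall Z : 'M[R]_n, nrm Z <= 1 -> nrm (mxeval p Z) <= B.
Proof.
elim/poly_ind: p => [|p c [B B0 hB]].
  by exists 1 => // Z _; rewrite -polyC0 mxevalC raddf0 nrm0.
exists (B + nrm (c%:M : 'M[R]_n)) => [|Z Z1]; first by rewrite ltr_pwDl ?nrm_ge0.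
rewrite mxevalD mxevalM mxevalX mxevalC (le_trans (nrmD _ _)) // lerD2r.
by rewrite (le_trans (nrmM _ _)) // -[B]mulr1 ler_pM ?nrm_ge0 ?hB.
Qed.

End LipschitzAtPoint.

(** * Stability of the iteration near its fixed points *)

Section Stability.
Variables (R : realType) (l : nat) (p q : {poly R}).
Hypotheses (l_gt0 : (1 <= l)%N) (pade : is_pade_invsqrt l p q).

Local Notation G := (Giter p q).
Local Notation Z := (Ziter p q).

Lemma pade_step n (T : 'M[R]_n) c : q ^+ 2 - (1 - 'X) * p ^+ 2 = c *: 'X^((2 * l).+1) ->
  mxeval q T \in unitmx ->
  1%:M - (1%:M - T) *m (rmx p q T *m rmx p q T) =
  (invmx (mxeval q T) *m invmx (mxeval q T)) *m (c *: mpow T (2 * l).+1).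
Proof.
move=> ec u; have := congr1 (fun r => mxeval r T) ec.
rewrite /= mxevalZ (mxevalXn 'X) mxevalB !expr2 !mxevalM mxevalB mxeval1 !mxevalX.
move=> <-; rewrite mulmxBr; congr (_ - _).
  by rewrite -mulmxA (mulmxA _ (mxeval q T)) mulVmx // mul1mx mulVmx.
set I := invmx (mxeval q T); set P := mxeval p T.
have cI V : T *m V = V *m T -> I *m V = V *m I.
  by move=> e; apply: invmx_comm; exact: mxeval_comm.
have cP : I *m P = P *m I by apply: cI; rewrite -(mxeval_comm _ (erefl (T *m T))).
have cT : I *m (1%:M - T) = (1%:M - T) *m I by apply: cI; rewrite mulmxBl mulmxBr mulmx1 mul1mx.
have eD V : I *m ((1%:M - T) *m V) = (1%:M - T) *m (I *m V) by rewrite !mulmxA cT.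
have eP V : I *m (P *m V) = P *m (I *m V) by rewrite !mulmxA cP.
by rewrite -[RHS]mulmxA !eD; congr (_ *m _); rewrite /rmx -/I -/P -!mulmxA !eP cP !eP.
Qed.

Lemma ZiterS n (Y : 'M[R]_n) k :
  Z Y k.+1 = 1%:M - (1%:M - Z Y k) *m (rmx p q (Z Y k) *m rmx p q (Z Y k)).
Proof.
rewrite {1}/Ziter GiterS; congr (_ - _).
have -> : 1%:M - Z Y k = Y *m (G Y k *m G Y k) by rewrite /Ziter subKr.
have e : rmx p q (Z Y k) *m G Y k = G Y k *m rmx p q (Z Y k).
  by apply: rmx_comm; apply: Ziter_comm; rewrite Giter_commY.
move: (rmx p q _) (G Y k) e => r g e.
by rewrite -!mulmxA (mulmxA r g) e -!mulmxA.
Qed.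

(** The factor 1/4 in the second bound is calibrated for [stable_tail]: while Z halves at each step,
    the factors of G must have a product bounded by 2. *)
Lemma stable_radius n : exists2 eta : R, 0 < eta & forall T : 'M[R]_n, nrm T <= eta ->
  [/\ mxeval q T \in unitmx,
      nrm (rmx p q T - 1%:M) <= (4 * eta)^-1 * nrm T &
      nrm (1%:M - (1%:M - T) *m (rmx p q T *m rmx p q T)) <= 2^-1 * nrm T].
Proof.
have [c ec] := pade_residual pade.
have [q1 eq1] := polyD0 q; rewrite (pade_q0 pade) in eq1.
have [s1 es1] := polyD0 (p - q).
rewrite hornerD hornerN (pade_q0 pade) (pade_p0 pade) subrr add0r in es1.
have [Bq Bq0 hBq] := mxeval_bounded n q1; have [Bs Bs0 hBs] := mxeval_bounded n s1.
have [Bx Bx0 hBx] := mxeval_bounded n ('X^((2 * l).-1) : {poly R}).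
(* Bounds the inverse of q(T): the identity has norm n, and the added 1 keeps [I] positive in size
   0. *)
pose I := 2 * (n%:R + 1) : R.
have n0 : 0 <= n%:R :> R by [].
have I0 : 0 < I by rewrite /I; lra.
pose K1 := Bs * I; pose K2 := I * I * (`|c| + 1) * Bx.
have K10 : 0 < K1 by rewrite mulr_gt0.
have K20 : 0 < K2 by rewrite !mulr_gt0 // ltr_wpDl.
(* In this order: polynomial bounds on the unit ball, q(T) within reach of the identity, the bound
   on r - 1, and the contraction by 1/2. For the last one, T^N is split into T^(2l-1), bounded by
   [Bx], and T^2, bounded by eta |T|. *)
pose eta := Num.min (Num.min 1 (2^-1 / (Bq * I))) (Num.min ((4 * K1)^-1) ((2 * K2)^-1)).
have eta0 : 0 < eta by rewrite !lt_min ltr01 divr_gt0 ?invr_gt0 ?mulr_gt0.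
have e1 : eta <= 1 by rewrite !ge_min lexx.
have e2 : eta * (Bq * I) <= 2^-1 by rewrite -ler_pdivlMr ?mulr_gt0 // !ge_min lexx !orbT.
have e3 : eta <= (4 * K1)^-1 by rewrite !ge_min lexx !orbT.
have e4 : eta <= (2 * K2)^-1 by rewrite !ge_min lexx !orbT.
exists eta => // T hT; have T1 : nrm T <= 1 by apply: le_trans hT e1.
have T0 := nrm_ge0 T.
have [u hu] : mxeval q T \in unitmx /\ nrm (invmx (mxeval q T)) <= 2 * nrm (invmx (1%:M : 'M[R]_n)).
  apply: invmx_near; rewrite ?unitmx1 // invmx1 nrm1.
  rewrite {1}eq1 polyC1 mxevalD mxevalM mxeval1 mxevalX addrC addKr.
  apply: le_trans e2; rewrite mulrA; apply: ler_pM; rewrite ?nrm_ge0 //; last by rewrite /I; lra.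
  by rewrite (le_trans (nrmM _ _)) // ler_pM ?nrm_ge0 ?hBq.
rewrite invmx1 nrm1 in hu.
have {}hu : nrm (invmx (mxeval q T)) <= I by apply: le_trans hu _; rewrite /I; lra.
split=> //.
  have -> : rmx p q T - 1%:M = T *m mxeval s1 T *m invmx (mxeval q T).
    by rewrite -{1}(mulmxV u) -mulmxBl -mxevalB es1 mxevalM mxevalX.
  apply: (@le_trans _ _ (K1 * nrm T)).
    rewrite (le_trans (nrmM _ _)) // /K1 mulrAC ler_pM ?nrm_ge0 //.
    by rewrite mulrC (le_trans (nrmM _ _)) // ler_wpM2l ?hBs.
  rewrite ler_wpM2r // -[K1]invrK lef_pV2 ?posrE ?invr_gt0 ?mulr_gt0 //.
  by rewrite -(ler_pM2l (_ : 0 < 4^-1 :> R)) ?invr_gt0 // mulKf ?pnatr_eq0 // -invfM.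
rewrite (pade_step ec u) (le_trans (nrmM _ _)) // nrmZ.
have hp : nrm (mpow T (2 * l).+1) <= Bx * (eta * nrm T).
  have -> : ((2 * l).+1 = (2 * l).-1 + 2)%N by rewrite addn2 prednK // muln_gt0.
  rewrite mpowD (le_trans (nrmM _ _)) // ler_pM ?nrm_ge0 //.
    by have := hBx T T1; rewrite mxevalXn mxevalX.
  by rewrite !mpowS mulmx1 (le_trans (nrmM _ _)) // ler_wpM2r.
have hI : nrm (invmx (mxeval q T) *m invmx (mxeval q T)) <= I * I.
  by rewrite (le_trans (nrmM _ _)) // ler_pM ?nrm_ge0.
apply: (@le_trans _ _ ((I * I) * ((`|c| + 1) * (Bx * (eta * nrm T))))).
  apply: ler_pM; rewrite ?mulr_ge0 ?nrm_ge0 //.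
  by apply: ler_pM; rewrite ?nrm_ge0 // lerDl.
have -> : (I * I) * ((`|c| + 1) * (Bx * (eta * nrm T))) = K2 * eta * nrm T by rewrite /K2; ring.
rewrite ler_wpM2r // mulrC -ler_pdivlMr //; apply: le_trans e4 _.
by rewrite invfM.
Qed.

(** Stated through the residual and not through convergence of G: smallness of one residual can be
    tested on a neighbourhood, and convergence of G follows from it. *)
Definition reg n (Y : 'M[R]_n) := (forall k, Gdom p q Y k) /\ cvm (Z Y) 0.

Definition Ginf n (Y : 'M[R]_n) : 'M[R]_n := lim (G Y @ \oo).

Lemma stable_tail n : exists2 eta : R, 0 < eta & forall (Y : 'M[R]_n) k, nrm (Z Y k) <= eta ->
  forall j, [/\ mxeval q (Z Y (k + j)) \in unitmx, nrm (Z Y (k + j)) <= eta * 2^-1 ^+ j,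
    nrm (G Y (k + j)) <= (2 - 2^-1 ^+ j) * nrm (G Y k) &
    nrm (G Y (k + j).+1 - G Y (k + j)) <= nrm (G Y k) * 2^-1 ^+ j].
Proof.
have [eta e0 he] := stable_radius n; exists eta => // Y k hk j.
have p0 i : 0 < 2^-1 ^+ i :> R by rewrite exprn_gt0 ?invr_gt0.
have p1 i : 2^-1 ^+ i <= 1 :> R by rewrite exprn_ile1 ?invr_ge0 // invf_le1 ?ler1n.
have zeta i : nrm (Z Y (k + i)) <= eta * 2^-1 ^+ i -> nrm (Z Y (k + i)) <= eta.
  by move/le_trans; apply; rewrite ger_pMr.
have dif i : nrm (Z Y (k + i)) <= eta * 2^-1 ^+ i ->
    nrm (G Y (k + i).+1 - G Y (k + i)) <= nrm (G Y (k + i)) * (4^-1 * 2^-1 ^+ i).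
  move=> hZ; have [_ hr _] := he _ (zeta i hZ).
  rewrite GiterS -{2}(mulmx1 (G Y (k + i))) -mulmxBr (le_trans (nrmM _ _)) //.
  rewrite ler_wpM2l ?nrm_ge0 // (le_trans hr) // mulrC ler_pdivrMr ?mulr_gt0 //.
  by apply: le_trans hZ _; rewrite [leRHS](_ : _ = eta * 2^-1 ^+ i) //; field.
have main i : nrm (Z Y (k + i)) <= eta * 2^-1 ^+ i /\
    nrm (G Y (k + i)) <= (2 - 2^-1 ^+ i) * nrm (G Y k).
  elim: i => [|i [IHZ IHG]].
    by rewrite addn0 !expr0 mulr1; split=> //; rewrite (_ : 2 - 1 = 1) ?mul1r //; ring.
  rewrite addnS; split.
    have [_ _ hz] := he _ (zeta i IHZ).
    by rewrite ZiterS (le_trans hz) // exprS mulrCA ler_pM2l ?invr_gt0.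
  have := nrm_subr (G Y (k + i).+1) (G Y (k + i)); move/le_trans; apply.
  (* With a = 2^(-i), the induction closes because (1 + a/4)(2 - a) <= 2 - a/2. *)
  apply: (@le_trans _ _ ((1 + 4^-1 * 2^-1 ^+ i) * nrm (G Y (k + i)))).
    by rewrite mulrDl mul1r addrC lerD2l mulrC dif.
  apply: (@le_trans _ _ ((1 + 4^-1 * 2^-1 ^+ i) * ((2 - 2^-1 ^+ i) * nrm (G Y k)))).
    by rewrite ler_wpM2l // addr_ge0 // mulr_ge0 // ?invr_ge0 // ltW.
  rewrite mulrA ler_wpM2r ?nrm_ge0 // exprS; have := p0 i; have := p1 i.
  by move: (2^-1 ^+ i) => a *; nra.
have [mZ mG] := main j; split=> //.
  by have [u _ _] := he _ (zeta j mZ).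
apply: le_trans (dif j mZ) _; apply: (@le_trans _ _ (2 * nrm (G Y k) * (4^-1 * 2^-1 ^+ j))).
  rewrite ler_wpM2r ?mulr_ge0 ?invr_ge0 ?(ltW (p0 _)) //.
  apply: le_trans mG _; rewrite ler_wpM2r ?nrm_ge0 //; have := p0 j; lra.
by have := nrm_ge0 (G Y k); have := p0 j; move: (nrm _) (2^-1 ^+ j) => a b *; nra.
Qed.

Lemma cvg_shiftm m n (X : nat -> 'M[R]_(m, n)) k L : cvm (fun j => X (k + j)%N) L -> cvm X L.
Proof. by rewrite /cvm => h; rewrite -(cvg_shiftn k); under eq_fun do rewrite addnC. Qed.

Lemma pow2V_cvg (C : R) : (C * 2^-1 ^+ j) @[j --> \oo] --> (0 : R).
Proof.
rewrite -[X in _ --> X](mulr0 C); apply: cvgM; first exact: cvg_cst.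
by apply: cvg_expr; rewrite gtr0_norm ?invr_gt0 // invf_lt1 // ltr1n.
Qed.

(** A test at one finite stage, where everything is continuous in Y. Openness of [reg] and local
    boundedness of [Ginf] follow from it. *)
Lemma reg_criterion n : exists2 eta : R, 0 < eta & forall (Y : 'M[R]_n) k,
  Gdom p q Y k -> nrm (Z Y k) <= eta ->
  [/\ reg Y, cvm (G Y) (Ginf Y) & nrm (Ginf Y) <= 2 * nrm (G Y k)].
Proof.
have [eta e0 he] := stable_tail n; exists eta => // Y k u hk; have {}he := he Y k hk.
have hreg : reg Y.
  split.
    move=> i j ji; have [jk|kj] := ltnP j k; first exact: u.
    by rewrite -(subnKC kj); case: (he (j - k)%N).
  apply: (@cvg_shiftm _ _ _ k); apply: (cvm_le _ (pow2V_cvg eta)) => j.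
  by rewrite subr0; case: (he j).
have [L hL] : exists L, cvm (fun j => G Y (k + j)) L.
  apply: (cvm_geometric (C := nrm (G Y k))) => j; rewrite addnS.
  by case: (he j).
have hL' := cvg_shiftm hL; have eL : Ginf Y = L.
  by apply: (cvg_lim (@norm_hausdorff _ _)); apply/cvmP.
split=> //; rewrite eL //.
apply/ler_addgt0Pr => e ep.
have /cvgrPdist_lt /(_ e ep) [j _ /(_ j (leqnn j))] := hL.
rewrite /= sub0r normrN ger0_norm ?nrm_ge0 // nrm_distC => hj.
have := nrm_subr L (G Y (k + j)); move/le_trans; apply.
rewrite addrC lerD ?(ltW hj) //; case: (he j) => _ _ /le_trans + _; apply.
by rewrite ler_wpM2r ?nrm_ge0 // gerBl exprn_ge0 ?invr_ge0.
Qed.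

Lemma cvm_near_lt m n (X : nat -> 'M[R]_(m, n)) L e : 0 < e -> cvm X L ->
  exists K, forall k, (K <= k)%N -> nrm (X k - L) < e.
Proof.
move=> e0 /cvgrPdist_lt /(_ e e0) [K _ h]; exists K => k /h.
by rewrite /= sub0r normrN ger0_norm ?nrm_ge0.
Qed.

Lemma reg_cvg n (Y : 'M[R]_n) : reg Y -> cvm (G Y) (Ginf Y).
Proof.
have [eta e0 he] := reg_criterion n; move=> [u hz].
have [k /(_ k (leqnn k)) hk] := cvm_near_lt e0 hz; rewrite subr0 in hk.
by case: (he Y k (u k) (ltW hk)).
Qed.

Lemma near_reg n (Y : 'M[R]_n) : reg Y ->
  exists C, \forall Y' \near Y, reg Y' /\ nrm (Ginf Y') <= C.
Proof.
have [eta e0 he] := reg_criterion n; move=> [u hz].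
have [k /(_ k (leqnn k)) hk] := cvm_near_lt e0 hz; rewrite subr0 in hk.
exists (2 * (nrm (G Y k) + 1)); near=> Y'.
have [||r _ h] := he Y' k.
- by near: Y'; exact: near_Gdom.
- near: Y'; apply: (lipat_cvg (f := fun Y => Z Y k) (P := fun T => nrm T <= eta)).
    exact: lipat_Ziter.
  apply/near_nrm; exists (eta - nrm (Z Y k)) => [|T hT]; first by rewrite subr_gt0.
  have := nrm_subr T (Z Y k); lra.
split=> //; apply: le_trans h _; rewrite ler_pM2l //.
by near: Y'; apply: (lipat_bounded (f := fun Y => G Y k)); exact: lipat_Giter.
Unshelve. all: by end_near. Qed.

End Stability.

(** * Differentiability of matrix functions through block triangular matrices *)

Section QuadraticExpansion.
Variable R : realType.

Lemma linear_nrm m n r s (L : 'M[R]_(m, n) -> 'M[R]_(r, s)) : linear L ->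
  exists2 K : R, 0 <= K & forall H, nrm (L H) <= K * nrm H.
Proof.
move=> linL; pose LL := GRing.isLinear.Build _ _ _ _ L linL.
pose L' : {linear 'M[R]_(m, n) -> 'M[R]_(r, s)} := HB.pack L LL.
pose K := \sum_i \sum_j nrm (L' (delta_mx i j)).
have K0 : 0 <= K by rewrite sumr_ge0 // => i _; rewrite sumr_ge0 // => j _; rewrite nrm_ge0.
exists K => // H; rewrite -[L H]/(L' H) {1}(matrix_sum_delta H) linear_sum.
have nrm_sum (I : finType) (F : I -> 'M[R]_(r, s)) : nrm (\sum_i F i) <= \sum_i nrm (F i).
  elim/big_ind2 : _ => [|a b c d ha hc|//]; first by rewrite nrm0.
  by rewrite (le_trans (nrmD _ _)) // lerD.
rewrite (le_trans (nrm_sum _ _)) // mulr_suml ler_sum // => i _.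
rewrite linear_sum (le_trans (nrm_sum _ _)) // mulr_suml ler_sum // => j _.
by rewrite linearZ nrmZ mulrC ler_wpM2l ?nrm_ge0 ?nrm_entry.
Qed.

(** An explicit quadratic remainder, instead of a little-o, makes the product and chain rules plain
    norm estimates. *)
Definition quad_expansion m n r s (g : 'M[R]_(m, n) -> 'M[R]_(r, s)) A
    (L : 'M[R]_(m, n) -> 'M[R]_(r, s)) :=
  exists C, exists2 d, 0 < d &
    forall H, nrm H < d -> nrm (g (A + H) - g A - L H) <= C * nrm H ^+ 2.

Lemma quad_expansion_diff m n r s (g : 'M[R]_(m, n) -> 'M[R]_(r, s)) A L H :
  linear L -> quad_expansion g A L -> 'd g A H = L H.
Proof.
move=> linL [C [d d0 h]]; pose LL := GRing.isLinear.Build _ _ _ _ L linL.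
pose L' : {linear 'M[R]_(m, n) -> 'M[R]_(r, s)} := HB.pack L LL.
have [K K0 hK] := linear_nrm linL.
suff -> : 'd g A = L' :> ('M[R]_(m, n) -> 'M[R]_(r, s)) by [].
pose mn := (m * n)%:R : R.
apply: diff_unique.
  apply: (@linear_bounded_continuous _ _ _ L').1.
  apply/linear_boundedP; exists (K * mn); split; first by rewrite num_real.
  move=> M hM x; apply: le_trans (mx_norm_nrm _) _; apply: le_trans (hK x) _.
  apply: (@le_trans _ _ (K * mn * `|x|)); last by rewrite ler_wpM2r // ltW.
  by rewrite -mulrA ler_wpM2l ?nrm_mx_norm.
apply/eqaddoP => e e0 /=.
pose B := `|C| * mn ^+ 2 + 1.
have B0 : 0 < B by rewrite ltr_wpDl // mulr_ge0 ?exprn_ge0.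
suff : \forall x \near (0 : 'M[R]_(m, n)), nrm (g (A + x) - g A - L x) <= e * `|x|.
  apply: filterS => x /= hx; apply: le_trans (mx_norm_nrm _) _; apply: le_trans hx.
  rewrite [X in nrm X](_ : _ = g (A + x) - g A - L x) //.
  transitivity (g (x + A) - (g A + L x)); first by [].
  by rewrite opprD addrA [x + A]addrC.
near=> x.
have x1 : nrm x < d by rewrite -[x]subr0; near: x; exact: near_nrm_lt.
have x2 : nrm x < e / B by rewrite -[x]subr0; near: x; apply: near_nrm_lt; rewrite divr_gt0.
apply: le_trans (h x x1) _; rewrite ltr_pdivlMr // in x2.
have hx := nrm_mx_norm x; rewrite -/mn in hx.
have x0 := nrm_ge0 x; have nx0 := normr_ge0 x.
have hmn : 0 <= mn by [].
have s1 : C * nrm x ^+ 2 <= `|C| * (nrm x * (mn * `|x|)).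
  apply: le_trans (_ : `|C| * nrm x ^+ 2 <= _).
    by rewrite ler_wpM2r ?exprn_ge0 // ler_norm.
  by rewrite ler_wpM2l // expr2 ler_wpM2l.
apply: le_trans s1 _; rewrite !mulrA ler_wpM2r //.
case: (posnP (m * n)) => [mn0|mn0]; first by rewrite /mn mn0 mulr0 ltW.
apply: le_trans (ltW x2); rewrite mulrAC [leLHS]mulrC ler_wpM2l // /B.
have : mn <= mn ^+ 2 by rewrite expr2 ler_peMl // ler1n.
by move=> hh; apply: (@le_trans _ _ (`|C| * mn ^+ 2)); rewrite ?ler_wpM2l // lerDl.
Unshelve. all: by end_near. Qed.

End QuadraticExpansion.

Section MatrixFunction.
Variables (R : realType) (f : forall n, 'M[R]_n -> 'M[R]_n) (D : forall n, 'M[R]_n -> Prop).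
Arguments f {n}. Arguments D {n}.
(** The four properties below are shared by [rmx p q], with invertible denominator as domain, and by
    [Ginf], with [reg] as domain. *)
Hypothesis f_intertwine : forall m n (V : 'M[R]_(m, n)) T T',
  D T -> D T' -> T *m V = V *m T' -> f T *m V = V *m f T'.
Hypothesis f_near : forall n (T : 'M[R]_n), D T ->
  exists C, \forall T' \near T, D T' /\ nrm (f T') <= C.
Hypothesis D_diag : forall m n (T : 'M[R]_m) (T' : 'M[R]_n), D T -> D T' ->
  D (block_mx T 0 0 T').
Hypothesis D_similar : forall n (P T T' : 'M[R]_n), P \in unitmx -> T *m P = P *m T' ->
  D T -> D T'.

(* A similarity by diag(s, 1) scales F by s, which brings the matrix close to
   diag(T, T'). *)
Lemma D_triangular m n (T : 'M[R]_m) F (T' : 'M[R]_n) : D T -> D T' -> D (block_mx T F 0 T').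
Proof.
move=> hT hT'; have [C /near_nrm [d d0 hd]] := f_near (D_diag hT hT').
pose s := d / 2 / (nrm F + 1); have F0 := nrm_ge0 F.
have s0 : 0 < s by rewrite !divr_gt0 // ltr_wpDl.
apply: (@D_similar _ (block_mx s%:M 0 0 1%:M) (block_mx T (s *: F) 0 T')).
- by rewrite unit_block_diag unitmx1 -scalemx1 unitmxZ ?unitmx1 // unitfE gt_eqF.
- rewrite !mulmx_block !(mulmx0, mul0mx, mulmx1, mul1mx, addr0, add0r).
  by rewrite mul_scalar_mx mul_mx_scalar mul_scalar_mx.
case: (hd (block_mx T (s *: F) 0 T')) => //.
rewrite opp_block_mx add_block_mx nrm_block !subrr !nrm0 oppr0 !addr0 add0r.
rewrite nrmZ gtr0_norm // /s mulrAC ltr_pdivrMr ?ltr_wpDl //.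
have := mulr_ge0 (ltW d0) F0; lra.
Qed.

Definition Dquot m n (T : 'M[R]_m) F (T' : 'M[R]_n) := ursubmx (f (block_mx T F 0 T')).

(** The projection [0 I] on the second block gives the bottom row, the inclusion [I; 0] of the first
    block gives the left column. *)
Lemma f_triangular m n (T : 'M[R]_m) F (T' : 'M[R]_n) : D T -> D T' ->
  f (block_mx T F 0 T') = block_mx (f T) (Dquot T F T') 0 (f T').
Proof.
move=> hT hT'; have hB := D_triangular F hT hT'.
have := f_intertwine (V := row_mx 0 1%:M) hT' hB.
rewrite mul_row_block mul_mx_row !(mulmx0, mul0mx, mulmx1, mul1mx, addr0, add0r).
move=> /(_ erefl); rewrite -{1}(submxK (f (block_mx T F 0 T'))) mul_row_block.
rewrite !(mul0mx, mul1mx, add0r) mul_mx_row mulmx0 mulmx1 => /eq_row_mx [edl edr].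
have := f_intertwine (V := col_mx 1%:M 0) hB hT.
rewrite mul_block_col mul_col_mx !(mulmx0, mul0mx, mulmx1, mul1mx, addr0, add0r).
move=> /(_ erefl); rewrite -{1}(submxK (f (block_mx T F 0 T'))) mul_block_col.
rewrite !(mulmx0, mulmx1, addr0) mul_col_mx mul1mx mul0mx => /eq_col_mx [eul _].
by rewrite -[LHS]submxK eul -edl -edr.
Qed.

(** One matrix, with diagonal (diag(T, T), T') and F1 stacked on F2, handles all combinations at
    once: [c I, d I] intertwines it with the combination c F1 + d F2. The pairs (1, 0) and (0, 1)
    then identify its two halves. *)
Lemma Dquot_linear m n (T : 'M[R]_m) (T' : 'M[R]_n) a b F1 F2 : D T -> D T' ->
  Dquot T (a *: F1 + b *: F2) T' = a *: Dquot T F1 T' + b *: Dquot T F2 T'.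
Proof.
move=> hT hT'; have hTT := D_diag hT hT.
pose B3 := block_mx (block_mx T 0 0 T) (col_mx F1 F2) 0 T'.
have gen c d : Dquot T (c *: F1 + d *: F2) T' =
    c *: usubmx (Dquot (block_mx T 0 0 T) (col_mx F1 F2) T') +
    d *: dsubmx (Dquot (block_mx T 0 0 T) (col_mx F1 F2) T').
  have hB3 : D B3 by exact: D_triangular.
  have hB := D_triangular (c *: F1 + d *: F2) hT hT'.
  pose V := block_mx (row_mx c%:M d%:M) 0 0 1%:M : 'M[R]_(m + n, (m + m) + n).
  have e : block_mx T (c *: F1 + d *: F2) 0 T' *m V = V *m B3.
    rewrite /V /B3 !mulmx_block !(mulmx0, mul0mx, mulmx1, mul1mx, addr0, add0r).
    rewrite mul_row_block mul_mx_row mul_row_col !mul_scalar_mx !mul_mx_scalar.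
    by rewrite !scaler0 addr0 add0r.
  have := f_intertwine hB hB3 e.
  rewrite !f_triangular // /V !mulmx_block.
  rewrite !(mulmx0, mul0mx, mulmx1, mul1mx, addr0, add0r) => /eq_block_mx [_ -> _ _].
  by rewrite -{1}(vsubmxK (Dquot (block_mx T 0 0 T) (col_mx F1 F2) T')) mul_row_col !mul_scalar_mx.
have e1 := gen 1 0; have e2 := gen 0 1.
rewrite !(scale1r, scale0r, addr0, add0r) in e1 e2.
by rewrite gen e1 e2.
Qed.

Lemma DquotZ m n (T : 'M[R]_m) (T' : 'M[R]_n) a F : D T -> D T' ->
  Dquot T (a *: F) T' = a *: Dquot T F T'.
Proof.
by move=> hT hT'; have := Dquot_linear a 0 F 0 hT hT'; rewrite !scale0r !addr0.
Qed.

(** The column [I; I] intertwines [T, T' - T; 0, T'] with T'. *)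
Lemma f_diff_quot n (T T' : 'M[R]_n) : D T -> D T' -> f T' - f T = Dquot T (T' - T) T'.
Proof.
move=> hT hT'; have hB := D_triangular (T' - T) hT hT'.
have := f_intertwine (V := col_mx 1%:M 1%:M) hB hT'.
rewrite f_triangular // !mul_block_col !mul_col_mx !(mulmx1, mul1mx, mul0mx, add0r) addrC subrK.
by move=> /(_ erefl) /eq_col_mx [<- _]; rewrite addrC addKr.
Qed.

(* Rescale T1 - T2 to a fixed small size: its divided difference is then a block of
   f at a matrix close to diag(T, T), hence bounded. *)
Lemma f_lipschitz n (T : 'M[R]_n) : D T -> exists C, exists2 d, 0 < d &
  forall T1 T2, nrm (T1 - T) < d -> nrm (T2 - T) < d ->
    [/\ D T1, D T2 & nrm (f T1 - f T2) <= C * nrm (T1 - T2)].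
Proof.
move=> hT; have [C /near_nrm [d d0 hd]] := f_near (D_diag hT hT).
have [C1 /near_nrm [d1 d10 hd1]] := f_near hT.
exists (C / (d / 4)); exists (Num.min (d / 4) d1); first by rewrite lt_min d10 divr_gt0.
move=> T1 T2; rewrite !lt_min => /andP[h1 /hd1 [D1 _]] /andP[h2 /hd1 [D2 _]]; split=> //.
have [T12|T12] := leP (nrm (T1 - T2)) 0.
  have /eqP := nrm0_eq0 T12; rewrite subr_eq0 => /eqP ->.
  by rewrite !subrr !nrm0 mulr0.
set s := nrm (T1 - T2) in T12 *.
rewrite (f_diff_quot D2 D1).
pose F := (d / 4 / s) *: (T1 - T2).
have -> : T1 - T2 = (s / (d / 4)) *: F.
  rewrite /F scalerA [X in X *: _](_ : _ = 1) ?scale1r //.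
  by field; rewrite !gt_eqF.
rewrite DquotZ // nrmZ gtr0_norm ?divr_gt0 //.
rewrite [leRHS](_ : _ = s / (d / 4) * C); last by rewrite mulrC mulrA [RHS]mulrAC.
rewrite ler_pM2l ?divr_gt0 //.
have nF : nrm F = d / 4 by rewrite nrmZ gtr0_norm ?divr_gt0 // -/s divfK // gt_eqF.
have [_ /le_trans h] : D (block_mx T2 F 0 T1) /\ nrm (f (block_mx T2 F 0 T1)) <= C.
  apply: hd; rewrite opp_block_mx add_block_mx nrm_block !subr0 nrm0 nF; lra.
rewrite /Dquot; apply: le_trans (_ : nrm (f (block_mx T2 F 0 T1)) <= _); last exact: h.
by case: (nrm_submx (f (block_mx T2 F 0 T1))).
Qed.

Lemma f_lipat n (T : 'M[R]_n) : D T -> lipat f T.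
Proof.
move=> hT; have [C [d d0 h]] := f_lipschitz hT; exists C; apply/near_nrm; exists d => // T1 h1.
by case: (h T1 T) => //; rewrite subrr nrm0.
Qed.

Lemma Dquot_is_linear n (T : 'M[R]_n) : D T -> linear (fun H => Dquot T H T).
Proof.
by move=> hT a F1 F2; rewrite -{1}(scale1r F2) Dquot_linear // scale1r.
Qed.

(** The increment f(T + H) - f(T) is the divided difference at (T, T + H). Moving its second
    argument back to T costs one more factor |H|, by the Lipschitz bound at diag(T, T). *)
Lemma f_quad_expansion n (T : 'M[R]_n) : D T ->
  quad_expansion (@f n) T (fun H => Dquot T H T).
Proof.
move=> hT; have [C [d d0 hd]] := f_lipschitz (D_diag hT hT).
have [C1 /near_nrm [d1 d10 hd1]] := f_near hT.
exists (C / (d / 4)); exists (Num.min (d / 4) d1); first by rewrite lt_min d10 divr_gt0.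
move=> H; rewrite lt_min => /andP[H1 H2].
have DH : D (T + H) by case: (hd1 (T + H)); rewrite // [T + H]addrC addrK.
have [h0|h0] := leP (nrm H) 0.
  have -> := nrm0_eq0 h0; rewrite nrm0 expr0n mulr0 addr0 subrr sub0r.
  by rewrite -(scale0r (0 : 'M[R]_n)) DquotZ // scale0r nrmN nrm0.
set s := nrm H in h0 H1 *.
rewrite (f_diff_quot hT DH) (_ : T + H - T = H); last by rewrite addrC addKr.
(* [F] is H rescaled to norm d/4, which keeps the block matrices within d of diag(T, T); the factor
   [c] carries one power of |H|. *)
pose c := s / (d / 4); pose F := c^-1 *: H.
have c0 : 0 < c by rewrite !divr_gt0.
have eH : H = c *: F by rewrite /F scalerA mulfV ?gt_eqF // scale1r.
have nF : nrm F = d / 4.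
  by rewrite nrmZ gtr0_norm ?invr_gt0 // -/s /c invf_div divfK // gt_eqF.
have e T' : D T' -> Dquot T H T' = c *: Dquot T F T' by move=> ?; rewrite -DquotZ // -eH.
rewrite !e // -scalerBr nrmZ gtr0_norm //.
have [] := hd (block_mx T F 0 (T + H)) (block_mx T F 0 T).
- rewrite opp_block_mx add_block_mx nrm_block !subrr subr0 !nrm0 nF.
  rewrite (_ : T + H - T = H); last by rewrite addrC addKr.
  by rewrite -/s; lra.
- by rewrite opp_block_mx add_block_mx nrm_block !subrr subr0 !nrm0 nF; lra.
move=> _ _; rewrite opp_block_mx add_block_mx nrm_block !subrr !nrm0.
rewrite (_ : T + H - T = H); last by rewrite addrC addKr.
rewrite -/s !add0r => h.
have {}h : nrm (Dquot T F (T + H) - Dquot T F T) <= C * s.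
  apply: le_trans h; rewrite /Dquot -!linearB.
  by case: (nrm_submx (f (block_mx T F 0 (T + H)) - f (block_mx T F 0 T))).
rewrite [leRHS](_ : _ = c * (C * s)); first by rewrite ler_pM2l.
by rewrite /c; field; rewrite gt_eqF.
Qed.

End MatrixFunction.

(** * Block diagonal matrices and similarity *)

Section BlockDiagonal.
Variable K : fieldType.
Variables p q : {poly K}.

Lemma mulmx_block_diag m n (A A' : 'M[K]_m) (B B' : 'M[K]_n) :
  block_mx A 0 0 B *m block_mx A' 0 0 B' = block_mx (A *m A') 0 0 (B *m B').
Proof. by rewrite mulmx_block !(mulmx0, mul0mx, addr0, add0r). Qed.

Lemma mxeval_diag m n (r : {poly K}) (A : 'M[K]_m) (B : 'M[K]_n) :
  mxeval r (block_mx A 0 0 B) = block_mx (mxeval r A) 0 0 (mxeval r B).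
Proof.
elim/poly_ind: r => [|r c IH].
  by rewrite -polyC0 !mxevalC !raddf0 -(block_mx0 K).
rewrite !(mxevalD, mxevalM, mxevalX, mxevalC) IH mulmx_block_diag scalar_mx_block.
by rewrite add_block_mx !addr0.
Qed.

Lemma invmx_diag m n (A : 'M[K]_m) (B : 'M[K]_n) : A \in unitmx -> B \in unitmx ->
  invmx (block_mx A 0 0 B) = block_mx (invmx A) 0 0 (invmx B).
Proof. by move=> uA uB; apply: invmx_eq; rewrite mulmx_block_diag !mulmxV // -scalar_mx_block. Qed.

Lemma rmx_diag m n (A : 'M[K]_m) (B : 'M[K]_n) :
  mxeval q A \in unitmx -> mxeval q B \in unitmx ->
  rmx p q (block_mx A 0 0 B) = block_mx (rmx p q A) 0 0 (rmx p q B).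
Proof. by move=> uA uB; rewrite /rmx !mxeval_diag invmx_diag // mulmx_block_diag. Qed.

Lemma Ziter_diag_of m n (A : 'M[K]_m) (B : 'M[K]_n) k :
  Giter p q (block_mx A 0 0 B) k = block_mx (Giter p q A k) 0 0 (Giter p q B k) ->
  Ziter p q (block_mx A 0 0 B) k = block_mx (Ziter p q A k) 0 0 (Ziter p q B k).
Proof.
by move=> e; rewrite /Ziter e !mulmx_block_diag scalar_mx_block opp_block_mx add_block_mx !subr0.
Qed.

Lemma Giter_diag m n (A : 'M[K]_m) (B : 'M[K]_n) k : Gdom p q A k -> Gdom p q B k ->
  Giter p q (block_mx A 0 0 B) k = block_mx (Giter p q A k) 0 0 (Giter p q B k).
Proof.
elim: k => [|k IH] uA uB; first by rewrite /= -scalar_mx_block.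
have e := IH (Gdom_lt (leqnSn k) uA) (Gdom_lt (leqnSn k) uB).
rewrite !GiterS e (Ziter_diag_of e) rmx_diag ?mulmx_block_diag //; first exact: uA.
exact: uB.
Qed.

Lemma Gdom_diag m n (A : 'M[K]_m) (B : 'M[K]_n) k :
  Gdom p q (block_mx A 0 0 B) k <-> Gdom p q A k /\ Gdom p q B k.
Proof.
elim: k => [|k IH]; first by split=> // _; split.
have step : Gdom p q A k -> Gdom p q B k ->
    (mxeval q (Ziter p q (block_mx A 0 0 B) k) \in unitmx) =
    (mxeval q (Ziter p q A k) \in unitmx) && (mxeval q (Ziter p q B k) \in unitmx).
  by move=> uA uB; rewrite (Ziter_diag_of (Giter_diag uA uB)) mxeval_diag unit_block_diag.
split=> [u|[uA uB]].
  have [uA uB] := IH.1 (Gdom_lt (leqnSn k) u).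
  have := u k (leqnn _); rewrite step // => /andP[hA hB].
  by split=> j; rewrite ltnS leq_eqVlt => /orP[/eqP -> //|]; [exact: uA|exact: uB].
have uA' := Gdom_lt (leqnSn k) uA; have uB' := Gdom_lt (leqnSn k) uB.
move=> j; rewrite ltnS leq_eqVlt => /orP[/eqP ->|jk].
  by rewrite step // uA // uB.
exact: (IH.2 (conj uA' uB')).
Qed.

Lemma mxeval_similar n (r : {poly K}) (P T T' : 'M[K]_n) : P \in unitmx ->
  T *m P = P *m T' -> mxeval r T \in unitmx -> mxeval r T' \in unitmx.
Proof.
move=> uP e u; have := mxeval_intertwine r e => /(congr1 (fun M => M \in unitmx)).
by rewrite /= !unitmx_mul u uP /= => <-.
Qed.

Lemma Giter_similar n (P T T' : 'M[K]_n) k : P \in unitmx -> T *m P = P *m T' ->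
  Gdom p q T k -> Gdom p q T' k /\ Giter p q T k *m P = P *m Giter p q T' k.
Proof.
move=> uP e; elim: k => [|k IH] u; first by split=> //; rewrite mul1mx mulmx1.
have [u' eG] := IH (Gdom_lt (leqnSn k) u).
have eZ : Ziter p q T k *m P = P *m Ziter p q T' k.
  rewrite mulmxBl mulmxBr mul1mx mulmx1; congr (_ - _).
  by rewrite -!mulmxA eG (mulmxA _ P) eG !mulmxA e.
have uT' : Gdom p q T' k.+1.
  move=> j; rewrite ltnS leq_eqVlt => /orP[/eqP ->|]; last exact: u'.
  by apply: (mxeval_similar uP eZ); apply: u.
by split=> //; exact: Giter_intertwine.
Qed.

(* [S k] stands for the second factor of the Gram matrix: [X k] itself for the
   sign iteration, a transpose of [X k] for the polar one. *)
Lemma pair_iterE m n (X : nat -> 'M[K]_(m, n)) (S : nat -> 'M[K]_(n, m)) :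
  (forall k, X k.+1 = X k *m rmx p q (1%:M - S k *m X k)) ->
  (forall k, S k.+1 = rmx p q (1%:M - S k *m X k) *m S k) ->
  forall k, [/\ X k = X 0%N *m Giter p q (S 0%N *m X 0%N) k,
    S k = Giter p q (S 0%N *m X 0%N) k *m S 0%N &
    1%:M - S k *m X k = Ziter p q (S 0%N *m X 0%N) k].
Proof.
move=> hX hS; set Y := S 0%N *m X 0%N.
have main k : X k = X 0%N *m Giter p q Y k -> S k = Giter p q Y k *m S 0%N ->
    1%:M - S k *m X k = Ziter p q Y k.
  move=> IX IS; rewrite /Ziter IS IX; congr (_ - _).
  transitivity (Giter p q Y k *m Y *m Giter p q Y k); first by rewrite !mulmxA.
  by rewrite Giter_commY mulmxA.
suff XS k : X k = X 0%N *m Giter p q Y k /\ S k = Giter p q Y k *m S 0%N.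
  by move=> k; have [IX IS] := XS k; split=> //; exact: main.
elim: k => [|k [IX IS]]; first by rewrite mulmx1 mul1mx.
have e := main k IX IS.
have eZ : rmx p q (Ziter p q Y k) *m Giter p q Y k = Giter p q Y k *m rmx p q (Ziter p q Y k).
  by apply: rmx_comm; apply: Ziter_comm; rewrite Giter_commY.
rewrite hX hS e {1}IX {1}IS GiterS; split; first by rewrite [RHS]mulmxA.
by rewrite [LHS]mulmxA eZ.
Qed.

End BlockDiagonal.

Section RmxDerivative.
Variables (R : realType) (p q : {poly R}).

Let f n := @rmx R n p q.
Let D n (T : 'M[R]_n) : Prop := mxeval q T \in unitmx.

Lemma rmx_near_bounded n (T : 'M[R]_n) : D T ->
  exists C, \forall T' \near T, D T' /\ nrm (rmx p q T') <= C.
Proof.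
move=> u; exists (nrm (rmx p q T) + 1); near=> T'; split; near: T'.
  apply: (lipat_cvg (f := fun T => mxeval q T) (P := fun T => T \in unitmx)).
    by apply: lipat_mxeval; exact: lipat_id.
  by apply: filterS (near_unitmx u) => A [].
by apply: lipat_bounded; apply: (lipat_rmx (f := id)) => //; exact: lipat_id.
Unshelve. all: by end_near. Qed.

Lemma rmx_dom_diag m n (T : 'M[R]_m) (T' : 'M[R]_n) : D T -> D T' -> D (block_mx T 0 0 T').
Proof. by rewrite /D => u u'; rewrite mxeval_diag unit_block_diag u u'. Qed.

(** Here the analytic derivative [Lr] becomes a block of a matrix, after which the coupled iteration
    is pure algebra. *)
Lemma rmx_triangular n (Y F : 'M[R]_n) : mxeval q Y \in unitmx ->
  mxeval q (block_mx Y F 0 Y) \in unitmx /\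
  rmx p q (block_mx Y F 0 Y) = block_mx (rmx p q Y) (Lr p q Y F) 0 (rmx p q Y).
Proof.
move=> u.
have inter m' n' (V : 'M[R]_(m', n')) T T' : D T -> D T' -> T *m V = V *m T' ->
  f T *m V = V *m f T' by exact: rmx_intertwine.
have sim n' (P T T' : 'M[R]_n') : P \in unitmx -> T *m P = P *m T' -> D T -> D T'.
  exact: mxeval_similar.
split; first exact: (D_triangular rmx_near_bounded rmx_dom_diag sim).
apply: etrans (f_triangular inter rmx_near_bounded rmx_dom_diag sim F u u) _.
congr block_mx; rewrite /Lr.
have lin := Dquot_is_linear inter rmx_near_bounded rmx_dom_diag sim u.
by rewrite (quad_expansion_diff F lin (f_quad_expansion inter rmx_near_bounded rmx_dom_diag sim u)).
Qed.

(** Transposition makes the block matrix lower triangular; exchanging the two blocks makes it upper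
    triangular again. *)
Lemma trmx_Lr n (Y F : 'M[R]_n) : mxeval q Y \in unitmx -> (Lr p q Y F)^T = Lr p q Y^T F^T.
Proof.
move=> u; have [uB eB] := rmx_triangular F u.
have uT : mxeval q Y^T \in unitmx by rewrite -trmx_mxeval unitmx_tr.
have [uB' eB'] := rmx_triangular F^T uT.
have e : (block_mx Y F 0 Y)^T *m block_mx 0 1%:M 1%:M 0 =
    block_mx 0 1%:M 1%:M 0 *m block_mx Y^T F^T 0 Y^T.
  by rewrite tr_block_mx !mulmx_block trmx0 !(mulmx0, mul0mx, addr0, add0r, mulmx1, mul1mx).
have := rmx_intertwine p _ uB' e; rewrite -trmx_mxeval unitmx_tr => /(_ uB).
rewrite -trmx_rmx eB eB' tr_block_mx !mulmx_block trmx0.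
rewrite !(mulmx0, mul0mx, addr0, add0r, mulmx1, mul1mx).
by case/eq_block_mx.
Qed.

End RmxDerivative.

(** * The limit Y^(-1/2) as a matrix function *)

Section InverseSquareRoot.
Variables (R : realType) (l : nat) (p q : {poly R}).
Hypotheses (l_gt0 : (1 <= l)%N) (pade : is_pade_invsqrt l p q).
Local Notation G := (Giter p q).
Local Notation Z := (Ziter p q).
Local Notation reg := (reg p q).
Local Notation Ginf := (Ginf p q).

Let reg_cvg := @reg_cvg R l p q l_gt0 pade.

Lemma Ginf_intertwine m n (V : 'M[R]_(m, n)) T T' : reg T -> reg T' ->
  T *m V = V *m T' -> Ginf T *m V = V *m Ginf T'.
Proof.
move=> hT hT' e; have h : cvm (fun k => G T k *m V) (Ginf T *m V).
  by apply: cvmM; [exact: reg_cvg|exact: cvm_cst].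
apply: (cvm_unique h); apply: (cvm_eq (X := fun k => V *m G T' k)).
  by move=> k; rewrite (Giter_intertwine (hT.1 k) (hT'.1 k)).
by apply: cvmM; [exact: cvm_cst|exact: reg_cvg].
Qed.

Lemma reg_diag m n (T : 'M[R]_m) (T' : 'M[R]_n) :
  reg (block_mx T 0 0 T') <-> reg T /\ reg T'.
Proof.
split=> [[u hz]|[[uT hT] [uT' hT']]].
  have uk k : Gdom p q T k /\ Gdom p q T' k by apply/Gdom_diag.
  have e k : Z (block_mx T 0 0 T') k = block_mx (Z T k) 0 0 (Z T' k).
    by apply: Ziter_diag_of; apply: Giter_diag; case: (uk k).
  have [h1 _ _ h2] := cvm_submx hz.
  split; split=> [k|]; try by case: (uk k).
    have <- : ulsubmx (0 : 'M[R]_(m + n)) = 0 by apply/matrixP => i j; rewrite !mxE.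
    by apply: cvm_eq h1 => k; rewrite e block_mxKul.
  have <- : drsubmx (0 : 'M[R]_(m + n)) = 0 by apply/matrixP => i j; rewrite !mxE.
  by apply: cvm_eq h2 => k; rewrite e block_mxKdr.
split=> [k|]; first exact/Gdom_diag.
apply: (cvm_eq (X := fun k => block_mx (Z T k) 0 0 (Z T' k))).
  by move=> k; rewrite Ziter_diag_of // Giter_diag.
by rewrite -(block_mx0 R); apply: cvm_block => //; exact: cvm_cst.
Qed.

Lemma reg_similar n (P T T' : 'M[R]_n) : P \in unitmx -> T *m P = P *m T' ->
  reg T -> reg T'.
Proof.
move=> uP e [u hz]; split=> [k|]; first by case: (Giter_similar uP e (u k)).
rewrite -(mul0mx _ P) -(mulmx0 _ (invmx P)).
apply: (cvm_eq (X := fun k => invmx P *m Z T k *m P)) => [k|].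
  have [_ eG] := Giter_similar uP e (u k).
  rewrite -[RHS](mulKmx uP) -mulmxA; congr (_ *m _).
  rewrite mulmxBl mulmxBr mul1mx mulmx1; congr (_ - _).
  by rewrite -!mulmxA eG (mulmxA _ P) eG !mulmxA e.
by apply: cvmM; [apply: cvmM => //|]; exact: cvm_cst.
Qed.

Let gnear n (T : 'M[R]_n) : reg T -> exists C, \forall T' \near T, reg T' /\ nrm (Ginf T') <= C.
Proof. exact: (near_reg l_gt0 pade). Qed.

Let gdiag m n (T : 'M[R]_m) (T' : 'M[R]_n) : reg T -> reg T' -> reg (block_mx T 0 0 T').
Proof. by move=> hT hT'; apply/reg_diag. Qed.

Lemma reg_triangular m n (T : 'M[R]_m) F (T' : 'M[R]_n) :
  reg T -> reg T' -> reg (block_mx T F 0 T').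
Proof. exact: (D_triangular gnear gdiag reg_similar). Qed.

Definition DGinf n (Y F : 'M[R]_n) := ursubmx (Ginf (block_mx Y F 0 Y)).

Lemma Ginf_triangular n (Y F : 'M[R]_n) : reg Y ->
  Ginf (block_mx Y F 0 Y) = block_mx (Ginf Y) (DGinf Y F) 0 (Ginf Y).
Proof.
by move=> hY; exact: (f_triangular Ginf_intertwine gnear gdiag reg_similar F hY hY).
Qed.

Lemma lipat_Ginf n (Y : 'M[R]_n) : reg Y -> lipat (fun Y => Ginf Y) Y.
Proof. exact: (f_lipat Ginf_intertwine gnear gdiag reg_similar). Qed.

Lemma DGinf_linear n (Y : 'M[R]_n) : reg Y -> linear (DGinf Y).
Proof. exact: (Dquot_is_linear Ginf_intertwine gnear gdiag reg_similar). Qed.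

Lemma Ginf_quad n (Y : 'M[R]_n) : reg Y -> quad_expansion (fun Y => Ginf Y) Y (DGinf Y).
Proof. exact: (f_quad_expansion Ginf_intertwine gnear gdiag reg_similar). Qed.

Lemma near_reg_dom n (Y : 'M[R]_n) : reg Y -> \forall Y' \near Y, reg Y'.
Proof. by move=> /gnear [C]; apply: filterS => Y' []. Qed.

Lemma Ginf_sqr n (Y : 'M[R]_n) : reg Y -> Y *m (Ginf Y *m Ginf Y) = 1%:M.
Proof.
move=> hY; have h := reg_cvg hY.
have : cvm (Z Y) (1%:M - Y *m (Ginf Y *m Ginf Y)).
  apply: cvmD; first exact: cvm_cst.
  by apply: cvmN; apply: cvmM; [exact: cvm_cst|exact: cvmM].
by move=> /(cvm_unique hY.2) /esym /eqP; rewrite subr_eq0 => /eqP.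
Qed.

Lemma reg_unit n (Y : 'M[R]_n) : reg Y -> Y \in unitmx.
Proof. by move=> /Ginf_sqr /mulmx1_unit []. Qed.

End InverseSquareRoot.

(** * Product and chain rules for quadratic expansions *)

Section QuadExpansionCalculus.
Variable R : realType.

Lemma quad_expansion_linear m n r s (g : 'M[R]_(m, n) -> 'M[R]_(r, s)) A :
  linear g -> quad_expansion g A g.
Proof.
move=> lin; exists 0; exists 1 => // H _.
have -> : g (A + H) = g A + g H by have := lin 1 A H; rewrite !scale1r.
by rewrite -addrA -opprD subrr nrm0 mul0r.
Qed.

Lemma quad_expansion_bound m n r s (g : 'M[R]_(m, n) -> 'M[R]_(r, s)) A L :
  linear L -> quad_expansion g A L -> exists C K d, [/\ 0 <= C, 0 <= K, 0 < d &
   forall H, nrm H < d -> [/\ nrm H <= 1, nrm (g (A + H) - g A - L H) <= C * nrm H ^+ 2,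
     nrm (L H) <= K * nrm H & nrm (g (A + H) - g A) <= (K + C) * nrm H]].
Proof.
move=> /linear_nrm [K K0 hK] [C [d d0 h]].
exists `|C|, K, (Num.min d 1); split=> //; first by rewrite lt_min d0 ltr01.
move=> H; rewrite lt_min => /andP[/h h1 /ltW h2].
have h3 : nrm (g (A + H) - g A - L H) <= `|C| * nrm H ^+ 2.
  by apply: le_trans h1 _; rewrite ler_wpM2r ?exprn_ge0 ?nrm_ge0 ?ler_norm.
split=> //; rewrite -(subrK (L H) (g (A + H) - g A)) (le_trans (nrmD _ _)) //.
rewrite mulrDl addrC lerD ?hK // (le_trans h3) // ler_wpM2l // expr2.
by rewrite ler_piMr ?nrm_ge0.
Qed.

Lemma quad_expansionM m n r s t (f : 'M[R]_(m, n) -> 'M[R]_(r, s))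
    (g : 'M[R]_(m, n) -> 'M[R]_(s, t)) A Lf Lg : linear Lf -> linear Lg ->
  quad_expansion f A Lf -> quad_expansion g A Lg ->
  quad_expansion (fun X => f X *m g X) A (fun H => Lf H *m g A + f A *m Lg H).
Proof.
move=> lf lg /(quad_expansion_bound lf) [C [K [d [C0 K0 d0 hf]]]].
move=> /(quad_expansion_bound lg) [C' [K' [d' [C0' K0' d0' hg]]]].
exists ((K + C) * (K' + C') + C * nrm (g A) + nrm (f A) * C').
exists (Num.min d d') => [|H]; first by rewrite lt_min d0 d0'.
rewrite lt_min => /andP[/hf [_ f1 _ f3] /hg [_ g1 _ g3]].
have -> : f (A + H) *m g (A + H) - f A *m g A - (Lf H *m g A + f A *m Lg H) =
    (f (A + H) - f A) *m (g (A + H) - g A) + (f (A + H) - f A - Lf H) *m g A +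
    f A *m (g (A + H) - g A - Lg H).
  rewrite !(mulmxBl, mulmxBr).
  move: (f (A + H) *m g (A + H)) (f A *m g (A + H)) (f (A + H) *m g A) (f A *m g A).
  move: (Lf H *m g A) (f A *m Lg H) => a b c d1 e k.
  by apply/matrixP => i j; rewrite !mxE; ring.
apply: le_trans (nrmD _ _) _; rewrite mulrDl lerD //; last first.
  by rewrite (le_trans (nrmM _ _)) // -mulrA ler_wpM2l ?nrm_ge0.
apply: le_trans (nrmD _ _) _; rewrite mulrDl lerD //.
  rewrite (le_trans (nrmM _ _)) // expr2 mulrACA ler_pM ?nrm_ge0 //.
by rewrite (le_trans (nrmM _ _)) // mulrAC ler_wpM2r ?nrm_ge0.
Qed.

Lemma quad_expansion_comp m n r s t u (f : 'M[R]_(r, s) -> 'M[R]_(t, u))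
    (g : 'M[R]_(m, n) -> 'M[R]_(r, s)) A Lf Lg : linear Lf -> linear Lg ->
  quad_expansion f (g A) Lf -> quad_expansion g A Lg ->
  quad_expansion (fun X => f (g X)) A (fun H => Lf (Lg H)).
Proof.
move=> lf lg /(quad_expansion_bound lf) [C [K [d [C0 K0 d0 hf]]]].
move=> /(quad_expansion_bound lg) [C' [K' [d' [C0' K0' d0' hg]]]].
have [K1 K10 hK1] := linear_nrm lf.
exists (C * (K' + C') ^+ 2 + K1 * C').
exists (Num.min d' (d / (K' + C' + 1))) => [|H].
  by rewrite lt_min d0' divr_gt0 //; lra.
rewrite lt_min ltr_pdivlMr; last by lra.
move=> /andP[/hg [h0 g1 _ g3] g4].
have gd : nrm (g (A + H) - g A) < d.
  apply: le_lt_trans g3 _; apply: le_lt_trans g4; rewrite mulrC ler_wpM2l ?nrm_ge0 //.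
  lra.
have [_ f1 _ _] := hf _ gd.
rewrite [g A + _]addrC subrK in f1.
have elin : Lf (g (A + H) - g A) - Lf (Lg H) = Lf (g (A + H) - g A - Lg H).
  rewrite [_ - Lg H]addrC; have := lf (-1) (Lg H) (g (A + H) - g A).
  by rewrite !scaleN1r => ->; rewrite addrC.
have -> : f (g (A + H)) - f (g A) - Lf (Lg H) =
   (f (g (A + H)) - f (g A) - Lf (g (A + H) - g A)) + Lf (g (A + H) - g A - Lg H).
  by rewrite -elin addrA subrK.
apply: le_trans (nrmD _ _) _; rewrite mulrDl lerD //.
  apply: le_trans f1 _; rewrite -mulrA ler_wpM2l // -exprMn.
  by rewrite ler_pXn2r ?nnegrE ?nrm_ge0 ?mulr_ge0 ?nrm_ge0 ?addr_ge0.
by apply: le_trans (hK1 _) _; rewrite -mulrA ler_wpM2l.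
Qed.

Lemma quad_expansion_eq m n r s (f g : 'M[R]_(m, n) -> 'M[R]_(r, s)) A L :
  (\forall X \near A, f X = g X) -> quad_expansion f A L -> quad_expansion g A L.
Proof.
move=> e [C [d d0 h]]; have eA := nbhs_singleton e.
case/near_nrm: e => d' d0' e; exists C; exists (Num.min d d'); first by rewrite lt_min d0 d0'.
move=> H; rewrite lt_min => /andP[h1 h2]; rewrite -eA -e ?h //.
by rewrite addrC addKr.
Qed.

End QuadExpansionCalculus.

(** * The complex step as a perturbation of dual numbers *)

Section QuadraticBigO.
Variable R : realType.

Definition bO2 m n (X : R -> 'M[R]_(m, n)) L :=
  exists C h0 : R, 0 < h0 /\ forall h, 0 < h < h0 -> nrm (X h - L) <= C * h ^+ 2.

Lemma bO2_nonneg m n (X : R -> 'M[R]_(m, n)) L : bO2 X L ->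
  exists C h0 : R, [/\ 0 <= C, 0 < h0 & forall h, 0 < h < h0 -> h < 1 /\ nrm (X h - L) <= C * h ^+ 2].
Proof.
case=> C [h0 [h00 h]]; exists `|C|, (Num.min h0 1); split=> //.
  by rewrite lt_min h00 ltr01.
move=> x; rewrite lt_min => /andP[x0 /andP[x1 x2]]; split=> //.
by apply: le_trans (h x _) _; rewrite ?x0 // ler_wpM2r ?exprn_ge0 ?ler_norm // ltW.
Qed.

Lemma bO2M m n r (X : R -> 'M[R]_(m, n)) (Y : R -> 'M[R]_(n, r)) L M :
  bO2 X L -> bO2 Y M -> bO2 (fun h => X h *m Y h) (L *m M).
Proof.
move=> /bO2_nonneg [C [a [C0 a0 h]]] /bO2_nonneg [C' [b [C0' b0 h']]].
exists (C * C' + C * nrm M + nrm L * C'), (Num.min a b); split; first by rewrite lt_min a0 b0.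
move=> x; rewrite lt_min => /andP[x0 /andP[xa xb]].
have /h [x1 hx] : 0 < x < a by rewrite x0.
have /h' [_ hy] : 0 < x < b by rewrite x0.
have -> : X x *m Y x - L *m M =
    (X x - L) *m (Y x - M) + (X x - L) *m M + L *m (Y x - M).
  rewrite !(mulmxBl, mulmxBr).
  move: (X x *m Y x) (L *m Y x) (X x *m M) (L *m M) => c d e k.
  by apply/matrixP => i j; rewrite !mxE; ring.
apply: le_trans (nrmD _ _) _; rewrite mulrDl lerD //; last first.
  by rewrite (le_trans (nrmM _ _)) // -mulrA ler_wpM2l ?nrm_ge0.
apply: le_trans (nrmD _ _) _; rewrite mulrDl lerD //; last first.
  by rewrite (le_trans (nrmM _ _)) // mulrAC ler_wpM2r ?nrm_ge0.
rewrite (le_trans (nrmM _ _)) // (le_trans (ler_pM _ _ hx hy)) ?nrm_ge0 //.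
rewrite mulrACA ler_wpM2l ?mulr_ge0 // ler_piMl ?exprn_ge0 ?(ltW x0) //.
by rewrite exprn_ile1 // ltW.
Qed.

Lemma bO2_near m n (X : R -> 'M[R]_(m, n)) L (P : 'M[R]_(m, n) -> Prop) : bO2 X L ->
  (\forall Y \near L, P Y) -> exists h0 : R, 0 < h0 /\ forall h, 0 < h < h0 -> P (X h).
Proof.
move=> /bO2_nonneg [C [a [C0 a0 h]]] /near_nrm [d d0 hP].
exists (Num.min a (d / (C + 1))); split.
  by rewrite lt_min a0 divr_gt0 // ltr_wpDl.
move=> x; rewrite lt_min ltr_pdivlMr ?ltr_wpDl // => /andP[x0 /andP[xa xd]].
have /h [x1 hx] : 0 < x < a by rewrite x0.
apply: hP; apply: le_lt_trans hx _; apply: le_lt_trans xd.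
have /(ler_wpM2l C0) : x ^+ 2 <= x by rewrite expr2 ler_piMl // ltW.
by lra.
Qed.

Lemma bO2_lipat m n r s (f : 'M[R]_(m, n) -> 'M[R]_(r, s)) X L : lipat f L ->
  bO2 X L -> bO2 (fun h => f (X h)) (f L).
Proof.
move=> [K hK] hX; have [b [b0 hb]] := bO2_near hX hK.
have [C [a [C0 a0 h]]] := bO2_nonneg hX.
exists (`|K| * C), (Num.min a b); split; first by rewrite lt_min a0 b0.
move=> x; rewrite lt_min => /andP[x0 /andP[xa xb]].
have /h [x1 hx] : 0 < x < a by rewrite x0.
apply: le_trans (hb x _) _; rewrite ?x0 // -mulrA.
apply: le_trans (_ : `|K| * nrm (X x - L) <= _); last by rewrite ler_wpM2l.
by rewrite ler_wpM2r ?nrm_ge0 ?ler_norm.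
Qed.

Lemma bO2_ul m1 m2 n1 n2 (X : R -> 'M[R]_(m1 + m2, n1 + n2)) L : bO2 X L ->
  bO2 (fun h => ulsubmx (X h)) (ulsubmx L) /\ bO2 (fun h => ursubmx (X h)) (ursubmx L).
Proof.
move=> [C [a [a0 h]]]; split; exists C, a; split=> // x /h; apply: le_trans;
  by rewrite -!linearB; case: (nrm_submx (X x - L)).
Qed.

End QuadraticBigO.

Section Perturbation.
Variables (R : realType) (l : nat) (p q : {poly R}).
Hypotheses (l_gt0 : (1 <= l)%N) (pade : is_pade_invsqrt l p q).
Local Notation G := (Giter p q).
Local Notation Z := (Ziter p q).
Local Notation reg := (reg p q).
Local Notation Ginf := (Ginf p q).

(* Up to the similarity diag(1, h), the real block form of X + i h E; at h = 0
   it is the dual number X + eps E, whose images under matrix functions carry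
   their Frechet derivatives. *)
Definition pert m n (h : R) (X E : 'M[R]_(m, n)) := block_mx X E (- h ^+ 2 *: E) X.

Definition dual m n (X E : 'M[R]_(m, n)) := block_mx X E 0 X.

Lemma dualM m n r (X E : 'M[R]_(m, n)) (X' E' : 'M[R]_(n, r)) :
  dual X E *m dual X' E' = dual (X *m X') (X *m E' + E *m X').
Proof. by rewrite /dual mulmx_block !(mulmx0, mul0mx, addr0, add0r). Qed.

Lemma bO2_pert m n (X E : 'M[R]_(m, n)) : bO2 (fun h => pert h X E) (dual X E).
Proof.
exists (nrm E), 1; split=> // h _.
rewrite opp_block_mx add_block_mx nrm_block !subrr subr0 !nrm0 nrmZ normrN.
by rewrite ger0_norm ?sqr_ge0 // !(addr0, add0r) mulrC.
Qed.

Lemma dual_reg n (Y F : 'M[R]_n) : reg Y -> reg (dual Y F).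
Proof. by move=> hY; exact: (reg_triangular l_gt0 pade). Qed.

Variables (m n : nat) (A E : 'M[R]_(m, n)) (S F : 'M[R]_(n, m)).
Hypothesis regSA : reg (S *m A).

(** The pair (S, F) is (A, E) for the sign iteration and (A^T, E^T) for the polar one, so that
    [gram h] represents the square or the non-conjugate Gram matrix of A + ihE. *)
Definition gram0 := dual S F *m dual A E.
Definition gram h := pert h S F *m pert h A E.

Lemma reg_gram0 : reg gram0.
Proof. by rewrite /gram0 dualM; apply: dual_reg. Qed.

Lemma bO2_gram : bO2 gram gram0.
Proof. by apply: bO2M; exact: bO2_pert. Qed.

(** A single threshold on h covers all stages k, since [reg] concerns the entire sequence. *)
Lemma reg_gram : exists h0 : R, 0 < h0 /\ forall h, 0 < h < h0 -> reg (gram h).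
Proof. by apply: (bO2_near bO2_gram); apply: (near_reg_dom l_gt0 pade); exact: reg_gram0. Qed.

Lemma bO2_iter k : bO2 (fun h => pert h A E *m G (gram h) k) (dual A E *m G gram0 k).
Proof.
apply: bO2M; first exact: bO2_pert.
apply: (bO2_lipat (f := fun Y => G Y k)); last exact: bO2_gram.
by apply: lipat_Giter; case: reg_gram0.
Qed.

Lemma bO2_limit : bO2 (fun h => pert h A E *m Ginf (gram h)) (dual A E *m Ginf gram0).
Proof.
apply: bO2M; first exact: bO2_pert.
apply: (bO2_lipat (f := fun Y => Ginf Y)); last exact: bO2_gram.
by apply: (lipat_Ginf l_gt0 pade); exact: reg_gram0.
Qed.

Lemma dual_limit : dual A E *m Ginf gram0 = dual (A *m Ginf (S *m A))
  (E *m Ginf (S *m A) + A *m DGinf p q (S *m A) (S *m E + F *m A)).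
Proof.
by rewrite /gram0 dualM [X in Ginf X]/dual (Ginf_triangular l_gt0 pade) // -/(dual _ _)
  dualM addrC.
Qed.

End Perturbation.

Section Differentials.
Variables (R : realType) (l : nat) (p q : {poly R}).
Hypotheses (l_gt0 : (1 <= l)%N) (pade : is_pade_invsqrt l p q).
Local Notation G := (Giter p q).
Local Notation Z := (Ziter p q).
Local Notation reg := (reg p q).
Local Notation Ginf := (Ginf p q).

(** The formula for [g] is required at every regular X because a derivative sees a neighbourhood of
    A; regularity being open, such X fill one. *)
Lemma diff_iteration_limit m n (s : 'M[R]_(m, n) -> 'M[R]_(n, m))
    (g : 'M[R]_(m, n) -> 'M[R]_(m, n)) A H :
  linear s -> reg (s A *m A) ->
  (forall X, reg (s X *m X) -> g X = X *m Ginf (s X *m X)) ->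
  'd g A H = H *m Ginf (s A *m A) + A *m DGinf p q (s A *m A) (s A *m H + s H *m A).
Proof.
move=> lins hA eg.
pose Lb H := s H *m A + s A *m H.
have linb : linear Lb.
  move=> a X Y; rewrite /Lb lins !mulmxDl !mulmxDr -scalemxAl -scalemxAr scalerDr.
  by rewrite !addrA; congr (_ + _); rewrite -!addrA; congr (_ + _); rewrite addrC.
have linid : linear (@id 'M[R]_(m, n)) by [].
have linG : linear (DGinf p q (s A *m A)) by exact: (DGinf_linear l_gt0 pade).
have linGb : linear (fun H => DGinf p q (s A *m A) (Lb H)).
  by move=> a X Y; rewrite linb linG.
have qs := quad_expansion_linear A lins.
have qid := quad_expansion_linear A linid.
have qb : quad_expansion (fun X => s X *m X) A Lb := quad_expansionM lins linid qs qid.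
have qG := quad_expansion_comp (g := fun X => s X *m X) linG linb (Ginf_quad l_gt0 pade hA) qb.
have qX := quad_expansionM linid linGb qid qG.
have lb : lipat (fun X => s X *m X) A.
  apply: lipatM; last exact: lipat_id.
  have [K _ hK] := linear_nrm lins; exists K; near=> X.
  have -> : s X - s A = s (X - A).
    rewrite [X - A]addrC; have := lins (-1) A X.
    by rewrite !scaleN1r => ->; rewrite addrC.
  exact: hK.
have near_eq : \forall X \near A, X *m Ginf (s X *m X) = g X.
  near=> X; apply/esym/eg.
  near: X; apply: (lipat_cvg (P := fun Y => reg Y) lb).
  exact: (near_reg_dom l_gt0 pade).
rewrite (quad_expansion_diff H _ (quad_expansion_eq near_eq qX)); last first.
  move=> a X Y; rewrite linGb !mulmxDl !mulmxDr -scalemxAl -scalemxAr scalerDr.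
  by rewrite !addrA; congr (_ + _); rewrite -!addrA; congr (_ + _); rewrite addrC.
by rewrite /Lb [s A *m H + _]addrC.
Unshelve. all: by end_near. Qed.

Lemma sign_iter_fst n (A E : 'M[R]_n) k : (sign_iter p q A E k).1 = A *m G (A *m A) k.
Proof.
rewrite -[RHS]sign_iterE; elim: k => [|k IH]; first by [].
by rewrite iterS -IH.
Qed.

Lemma polar_iter_fst m n (A E : 'M[R]_(m, n)) k :
  (polar_iter p q A E k).1 = A *m G (A^T *m A) k.
Proof.
rewrite -[RHS]polar_iterE; elim: k => [|k IH]; first by [].
by rewrite iterS -IH.
Qed.

End Differentials.

(** * Real representation of complex matrices *)

Section ComplexMatrices.
Variable R : realType.
Local Notation C := R[i].

Lemma complex_ReM (x y : C) : complex.Re (x * y) = complex.Re x * complex.Re y - complex.Im x * complex.Im y.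
Proof. by case: x y => [a b] [c d]. Qed.

Lemma complex_ImM (x y : C) : complex.Im (x * y) = complex.Re x * complex.Im y + complex.Im x * complex.Re y.
Proof. by case: x y => [a b] [c d]; rewrite /= [b * c]mulrC. Qed.

Lemma Re_sum (I : Type) (r : seq I) (F : I -> C) :
  complex.Re (\sum_(i <- r) F i) = \sum_(i <- r) complex.Re (F i).
Proof. by elim/big_rec2 : _ => // i y [a b] _ <-; case: (F i). Qed.

Lemma Im_sum (I : Type) (r : seq I) (F : I -> C) :
  complex.Im (\sum_(i <- r) F i) = \sum_(i <- r) complex.Im (F i).
Proof. by elim/big_rec2 : _ => // i y [a b] _ <-; case: (F i). Qed.

Lemma RemxM m n r (X : 'M[C]_(m, n)) (Y : 'M[C]_(n, r)) :
  Remx (X *m Y) = Remx X *m Remx Y - Immx X *m Immx Y.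
Proof.
apply/matrixP => i j; rewrite !mxE Re_sum -sumrB; apply: eq_bigr => k _.
by rewrite !mxE complex_ReM.
Qed.

Lemma ImmxM m n r (X : 'M[C]_(m, n)) (Y : 'M[C]_(n, r)) :
  Immx (X *m Y) = Remx X *m Immx Y + Immx X *m Remx Y.
Proof.
apply/matrixP => i j; rewrite !mxE Im_sum -big_split; apply: eq_bigr => k _.
by rewrite !mxE complex_ImM.
Qed.

Lemma RemxD m n (X Y : 'M[C]_(m, n)) : Remx (X + Y) = Remx X + Remx Y.
Proof. by apply/matrixP => i j; rewrite !mxE; case: (X i j) (Y i j) => [a b] []. Qed.

Lemma ImmxD m n (X Y : 'M[C]_(m, n)) : Immx (X + Y) = Immx X + Immx Y.
Proof. by apply/matrixP => i j; rewrite !mxE; case: (X i j) (Y i j) => [a b] []. Qed.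

Lemma RemxZ m n c (X : 'M[C]_(m, n)) : Remx ((c%:C)%C *: X) = c *: Remx X.
Proof. by apply/matrixP => i j; rewrite !mxE complex_ReM /= mul0r subr0. Qed.

Lemma ImmxZ m n c (X : 'M[C]_(m, n)) : Immx ((c%:C)%C *: X) = c *: Immx X.
Proof. by apply/matrixP => i j; rewrite !mxE complex_ImM /= mul0r addr0. Qed.

Lemma Remx_cmx m n (X : 'M[R]_(m, n)) : Remx (cmx X) = X.
Proof. by apply/matrixP => i j; rewrite !mxE. Qed.

Lemma Immx_cmx m n (X : 'M[R]_(m, n)) : Immx (cmx X) = 0.
Proof. by apply/matrixP => i j; rewrite !mxE. Qed.

Lemma mx_ReIm m n (X Y : 'M[C]_(m, n)) : Remx X = Remx Y -> Immx X = Immx Y -> X = Y.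
Proof.
move=> /matrixP hr /matrixP hi; apply/matrixP => i j.
have := hr i j; have := hi i j; rewrite !mxE.
by case: (X i j) (Y i j) => [a b] [c d] /= -> ->.
Qed.

Lemma cmxM m n r (X : 'M[R]_(m, n)) (Y : 'M[R]_(n, r)) : cmx (X *m Y) = cmx X *m cmx Y.
Proof.
by apply: mx_ReIm; rewrite ?RemxM ?ImmxM !Remx_cmx !Immx_cmx !(mulmx0, mul0mx) ?subr0 ?addr0.
Qed.

Lemma cmx1 n : cmx (1%:M : 'M[R]_n) = 1%:M.
Proof. by apply/matrixP => i j; rewrite !mxE; case: eqP. Qed.

Lemma cmx_inj m n : injective (@cmx R m n).
Proof. by move=> X Y e; rewrite -(Remx_cmx X) e Remx_cmx. Qed.

Lemma Remx_scalar n (c : R) : Remx ((c%:C)%C%:M : 'M[C]_n) = c%:M.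
Proof. by apply/matrixP => i j; rewrite !mxE; case: eqP. Qed.

Lemma Immx_scalar n (c : R) : Immx ((c%:C)%C%:M : 'M[C]_n) = 0.
Proof. by apply/matrixP => i j; rewrite !mxE; case: eqP. Qed.

(** For h <> 0 an injective algebra embedding that puts Im/h in the upper right block and sends A +
    ihE to [pert h A E]. At h = 1 it is the usual real form, which serves the spectral arguments. *)
Definition tau (h : R) m n (X : 'M[C]_(m, n)) : 'M[R]_(m + m, n + n) :=
  block_mx (Remx X) (h^-1 *: Immx X) (- h *: Immx X) (Remx X).

Variable h : R.
Hypothesis h_neq0 : h != 0.

Lemma tauM m n r (X : 'M[C]_(m, n)) (Y : 'M[C]_(n, r)) : tau h (X *m Y) = tau h X *m tau h Y.
Proof.
rewrite /tau mulmx_block RemxM ImmxM -!scalemxAl -!scalemxAr !scalerA !scalerDr.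
by rewrite mulrN mulVf // mulNr mulfV // !scaleN1r [X in block_mx _ _ _ X]addrC [X in block_mx _ _ X _]addrC.
Qed.

Lemma tauD m n (X Y : 'M[C]_(m, n)) : tau h (X + Y) = tau h X + tau h Y.
Proof. by rewrite /tau RemxD ImmxD !scalerDr add_block_mx. Qed.

Lemma tauZ m n c (X : 'M[C]_(m, n)) : tau h ((c%:C)%C *: X) = c *: tau h X.
Proof.
rewrite /tau RemxZ ImmxZ scale_block_mx !scalerA.
by rewrite [c * h^-1]mulrC [c * - h]mulrC.
Qed.

Lemma tau_scalar n (c : R) : tau h ((c%:C)%C%:M : 'M[C]_n) = c%:M.
Proof. by rewrite /tau Remx_scalar Immx_scalar !scaler0 -scalar_mx_block. Qed.

Lemma tau1 n : tau h (1%:M : 'M[C]_n) = 1%:M.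
Proof. exact: (tau_scalar n 1). Qed.

Lemma tauB m n (X Y : 'M[C]_(m, n)) : tau h (X - Y) = tau h X - tau h Y.
Proof.
rewrite tauD -scaleN1r (_ : -1 = (((-1 : R)%:C)%C)) ?tauZ ?scaleN1r //.
by rewrite rmorphN rmorph1.
Qed.

Lemma tau_inj m n : injective (@tau h m n).
Proof.
move=> X Y /eq_block_mx [e1 e2 _ _]; apply: mx_ReIm => //.
have := congr1 (fun M => h *: M) e2.
by rewrite /= !scalerA mulfV // !scale1r.
Qed.

Lemma tau0 m n : tau h (0 : 'M[C]_(m, n)) = 0.
Proof. by rewrite -(subrr 0) tauB subrr. Qed.

Lemma tau_unit n (X : 'M[C]_n) : (tau h X \in unitmx) = (X \in unitmx).
Proof.
apply/idP/idP => [u|u].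
  apply/mxrow_unitP => v vX; apply: (@tau_inj 1); rewrite tau0.
  by rewrite -[LHS](mulmxK u) -tauM vX tau0 mul0mx.
by have [] := mulmx1_unit (_ : tau h X *m tau h (invmx X) = 1%:M); rewrite -?tauM ?mulmxV ?tau1.
Qed.

Lemma tau_inv n (X : 'M[C]_n) : tau h (invmx X) = invmx (tau h X).
Proof.
have [u|nu] := boolP (X \in unitmx).
  by apply/esym/invmx_eq; rewrite -tauM mulmxV // tau1.
by rewrite /invmx tau_unit (negPf nu).
Qed.

Lemma tau_mpow n (X : 'M[C]_n) k : tau h (mpow X k) = mpow (tau h X) k.
Proof. by elim: k => [|k IH]; rewrite ?tau1 // !mpowS tauM IH. Qed.

Lemma tau_mxeval n (r : {poly R}) (X : 'M[C]_n) :
  tau h (mxeval (cpoly r) X) = mxeval r (tau h X).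
Proof.
have sr : size (cpoly r) = size r by exact: size_map_poly.
rewrite /mxeval sr; elim/big_ind2 : _ => [|a b c d <- <-|i _].
- exact: tau0.
- by rewrite tauD.
by rewrite coef_map tauZ tau_mpow.
Qed.

Lemma tau_rmx n (p q : {poly R}) (X : 'M[C]_n) :
  tau h (rmx (cpoly p) (cpoly q) X) = rmx p q (tau h X).
Proof. by rewrite /rmx tauM tau_inv !tau_mxeval. Qed.

Lemma tau_Giter n (p q : {poly R}) (Y : 'M[C]_n) k :
  tau h (Giter (cpoly p) (cpoly q) Y k) = Giter p q (tau h Y) k.
Proof.
elim: k => [|k IH]; first exact: tau1.
by rewrite !GiterS tauM IH tau_rmx /Ziter tauB tau1 !tauM IH.
Qed.

Lemma tau_start m n (A E : 'M[R]_(m, n)) :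
  tau h (cmx A + ('i)%C *: cmx (h *: E)) = pert h A E.
Proof.
have -> : forall X : 'M[R]_(m, n), tau h (cmx A + ('i)%C *: cmx X) =
    block_mx A (h^-1 *: X) (- h *: X) A.
  move=> X; rewrite /tau RemxD ImmxD Remx_cmx Immx_cmx add0r.
  have -> : Remx ('i%C *: cmx X) = 0 by apply/matrixP => i j; rewrite !mxE complex_ReM /=; ring.
  have -> : Immx ('i%C *: cmx X) = X by apply/matrixP => i j; rewrite !mxE complex_ImM /=; ring.
  by rewrite addr0.
by rewrite !scalerA mulVf // scale1r /pert mulNr expr2.
Qed.

Lemma tau_csign (p q : {poly R}) n (A E : 'M[R]_n) k :
  tau h (csign_iter p q A E h k) = pert h A E *m Giter p q (gram A E A E h) k.
Proof. by rewrite /csign_iter sign_iterE tauM tau_Giter !tauM tau_start. Qed.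

Lemma trmx_start m n (A E : 'M[R]_(m, n)) :
  (cmx A + ('i)%C *: cmx (h *: E))^T = cmx A^T + ('i)%C *: cmx (h *: E^T).
Proof. by apply/matrixP => i j; rewrite !mxE. Qed.

Lemma tau_cpolar (p q : {poly R}) m n (A E : 'M[R]_(m, n)) k :
  tau h (cpolar_iter p q A E h k) = pert h A E *m Giter p q (gram A E A^T E^T h) k.
Proof. by rewrite /cpolar_iter polar_iterE tauM tau_Giter !tauM trmx_start !tau_start. Qed.

Lemma Remx_tau m n (X : 'M[C]_(m, n)) : Remx X = ulsubmx (tau h X).
Proof. by rewrite block_mxKul. Qed.

Lemma Immx_tau m n (X : 'M[C]_(m, n)) : Immx ((h%:C)%C^-1 *: X) = ursubmx (tau h X).
Proof. by rewrite block_mxKur -fmorphV /= ImmxZ. Qed.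

End ComplexMatrices.

(** * The coupled iteration over dual numbers *)

Section CoupledIteration.
Variables (R : realType) (l : nat) (p q : {poly R}).
Hypotheses (l_gt0 : (1 <= l)%N) (pade : is_pade_invsqrt l p q).
Local Notation G := (Giter p q).
Local Notation Z := (Ziter p q).
Local Notation reg := (reg p q).
Local Notation Ginf := (Ginf p q).

(** At late stages Y G^2 = 1 - Z is close to the identity, so G is invertible there; each earlier G
    is a left factor of the later ones. *)
Lemma reg_Giter_unit n (Y : 'M[R]_n) k : reg Y -> G Y k \in unitmx.
Proof.
move=> [_ hz]; pose e := 2^-1 / (n%:R + 1) : R.
have e0 : 0 < e by rewrite divr_gt0 ?invr_gt0 // ltr_wpDl.
have [K /(_ (k + K)%N (leq_addl _ _))] := cvm_near_lt e0 hz; rewrite subr0 => hK.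
have uK : G Y (k + K) \in unitmx.
  have [u _] : 1%:M - Z Y (k + K) \in unitmx /\
      nrm (invmx (1%:M - Z Y (k + K))) <= 2 * nrm (invmx (1%:M : 'M[R]_n)).
    apply: invmx_near; rewrite ?unitmx1 // addrC addKr nrmN invmx1 nrm1.
    rewrite ltr_pdivlMr ?ltr_wpDl // in hK.
    by apply: le_trans (ltW hK); rewrite ler_wpM2l ?nrm_ge0 // lerDl.
  by move: u; rewrite /Ziter subKr !unitmx_mul => /andP[_ /andP[]].
elim: K uK {hK} => [|K IH]; first by rewrite addn0.
by rewrite addnS GiterS unitmx_mul => /andP[/IH].
Qed.

Lemma rmx_dual n (x f : 'M[R]_n) : mxeval q (1%:M - x) \in unitmx ->
  rmx p q (1%:M - dual x f) = dual (rmx p q (1%:M - x)) (Lr p q (1%:M - x) (- f)).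
Proof.
move=> u; have [_ e] := rmx_triangular p (- f) u; rewrite [RHS]/dual -e.
by congr rmx; rewrite /dual scalar_mx_block opp_block_mx add_block_mx !sub0r oppr0.
Qed.

(** The update of E is the product rule, so the pair follows the uncoupled recurrence over dual
    numbers. *)
Lemma sign_iter_dual n (A E : 'M[R]_n) k : reg (A *m A) ->
  dual (sign_iter p q A E k).1 (sign_iter p q A E k).2 =
  dual A E *m G (gram0 A E A E) k.
Proof.
move=> [u _]; pose X j := dual (sign_iter p q A E j).1 (sign_iter p q A E j).2.
have hX j : X j.+1 = X j *m rmx p q (1%:M - X j *m X j).
  rewrite /X dualM rmx_dual; last first.
    rewrite sign_iter_fst -(mulmxA A) (mulmxA _ A) Giter_comm ?mulmxA //.
    by rewrite -!mulmxA mulmxA (u j.+1).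
  by rewrite dualM [_ *m Lr _ _ _ _ + _]addrC.
have [] // := pair_iterE (p := p) (q := q) (X := X) (S := X) hX _ k.
by move=> j; rewrite hX rmx_comm // mulmxBl mulmxBr mulmxA mulmx1 mul1mx.
Qed.

Lemma polar_iter_dual m n (A E : 'M[R]_(m, n)) k : reg (A^T *m A) ->
  dual (polar_iter p q A E k).1 (polar_iter p q A E k).2 =
  dual A E *m G (gram0 A E A^T E^T) k.
Proof.
move=> [u _]; pose x j := (polar_iter p q A E j).1; pose e j := (polar_iter p q A E j).2.
(* [S] transposes inside the blocks: transposing the whole matrix would move the derivative below
   the diagonal. Its recurrence needs the symmetry of [gp] and [Lgp]. *)
pose X j := dual (x j) (e j); pose S j := dual (x j)^T (e j)^T.
have ux j : mxeval q (1%:M - (x j)^T *m x j) \in unitmx.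
  rewrite /x polar_iter_fst trmx_mul trmx_Giter trmx_mul trmxK.
  by rewrite -mulmxA (mulmxA A^T) mulmxA Giter_commY -mulmxA (u j.+1).
have er j : rmx p q (1%:M - S j *m X j) =
    dual (gp p q (x j)) (Lgp p q (x j) (e j)).
  by rewrite dualM rmx_dual.
have hX j : X j.+1 = X j *m rmx p q (1%:M - S j *m X j).
  by rewrite er dualM addrC.
have hS j : S j.+1 = rmx p q (1%:M - S j *m X j) *m S j.
  have gT : (gp p q (x j))^T = gp p q (x j).
    by rewrite /gp trmx_rmx linearB /= trmx1 trmx_mul trmxK.
  have LT : (Lgp p q (x j) (e j))^T = Lgp p q (x j) (e j).
    have eF : (- ((x j)^T *m e j + (e j)^T *m x j))^T = - ((x j)^T *m e j + (e j)^T *m x j).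
      by rewrite linearN linearD /= !trmx_mul !trmxK addrC.
    have eY : (1%:M - (x j)^T *m x j)^T = 1%:M - (x j)^T *m x j.
      by rewrite linearB /= trmx1 trmx_mul trmxK.
    by rewrite /Lgp trmx_Lr // eF eY.
  have ex : x j.+1 = x j *m gp p q (x j) by [].
  have ee : e j.+1 = e j *m gp p q (x j) + x j *m Lgp p q (x j) (e j) by [].
  rewrite er dualM /S ex ee linearD /=.
  by rewrite (trmx_mul (x j)) (trmx_mul (e j)) (trmx_mul (x j)) gT LT.
by have [] // := pair_iterE hX hS k.
Qed.

End CoupledIteration.

(** * Spectral criteria for convergence *)

Section PowersToZero.
Variable R : realType.
Local Notation C := R[i].
Local Notation normc := (@Normc.normc R).

Lemma contraction_cvg0 (r : R) (a b : nat -> R) : 0 <= r < 1 -> (forall k, 0 <= a k) ->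
  (forall k, a k.+1 <= r * a k + b k) -> b @ \oo --> 0 -> a @ \oo --> 0.
Proof.
move=> /andP[r0 r1] a0 hab hb; apply/cvgrPdist_lt => e e0.
(* Chosen so that x -> r x + e (1 - r) / 2 has the fixed point e/2. *)
have d0 : 0 < e * (1 - r) / 2 by rewrite divr_gt0 ?mulr_gt0 ?subr_gt0.
have /cvgrPdist_lt /(_ _ d0) [K _ hK] := hb.
have ar j : a (K + j)%N <= r ^+ j * a K + e / 2.
  elim: j => [|j IH]; first by rewrite addn0 expr0 mul1r lerDl divr_ge0 // ltW.
  rewrite addnS; apply: le_trans (hab _) _.
  have := hK (K + j)%N (leq_addr _ _); rewrite /= sub0r normrN => /ltW.
  move=> /(le_trans (ler_norm _)) => hbj.
  apply: le_trans (lerD (ler_wpM2l r0 IH) hbj) _; rewrite exprS -(mulrA r).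
  by move: (r ^+ j * a K) => x; lra.
have hr : (r ^+ j * a K) @[j --> \oo] --> (0 : R).
  rewrite -[X in _ --> X](mul0r (a K)); apply: cvgM; last exact: cvg_cst.
  by apply: cvg_expr; rewrite ger0_norm.
have e20 : 0 < e / 2 by rewrite divr_gt0.
have /cvgrPdist_lt /(_ _ e20) [J _ hJ] := hr.
exists (K + J)%N => // k /= hk; rewrite sub0r normrN ger0_norm //.
have kK : (K <= k)%N by apply: leq_trans hk; rewrite leq_addr.
rewrite -(subnKC kK); apply: le_lt_trans (ar _) _.
have := hJ (k - K)%N; rewrite /= leq_subRL // => /(_ hk); rewrite sub0r normrN.
by move=> /(le_lt_trans (ler_norm _)); lra.
Qed.

Definition nrmc m n (X : 'M[C]_(m, n)) : R := \sum_i \sum_j normc (X i j).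

Lemma normc_ge0 x : 0 <= normc x.
Proof. by case: x => a b; exact: sqrtr_ge0. Qed.

Lemma nrmc_ge0 m n (X : 'M[C]_(m, n)) : 0 <= nrmc X.
Proof. by rewrite sumr_ge0 // => i _; rewrite sumr_ge0 // => j _; rewrite normc_ge0. Qed.

Lemma nrmcD m n (X Y : 'M[C]_(m, n)) : nrmc (X + Y) <= nrmc X + nrmc Y.
Proof.
rewrite /nrmc -big_split ler_sum //= => i _; rewrite -big_split ler_sum //= => j _.
by rewrite mxE le_normcD.
Qed.

Lemma nrmcZ m n c (X : 'M[C]_(m, n)) : nrmc (c *: X) = normc c * nrmc X.
Proof.
rewrite /nrmc mulr_sumr; apply: eq_bigr => i _; rewrite mulr_sumr.
by apply: eq_bigr => j _; rewrite mxE Normc.normcM.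
Qed.

Lemma nrm_tau m n (X : 'M[C]_(m, n)) : nrm (tau 1 X) <= 4 * nrmc X.
Proof.
have reP : nrm (Remx X) <= nrmc X.
  apply: ler_sum => i _; apply: ler_sum => j _; rewrite mxE; case: (X i j) => a b /=.
  by rewrite -sqrtr_sqr ler_sqrt ?addr_ge0 ?sqr_ge0 // lerDl sqr_ge0.
have imP : nrm (Immx X) <= nrmc X.
  apply: ler_sum => i _; apply: ler_sum => j _; rewrite mxE; case: (X i j) => a b /=.
  by rewrite -sqrtr_sqr ler_sqrt ?addr_ge0 ?sqr_ge0 // lerDr sqr_ge0.
by rewrite /tau nrm_block invr1 scale1r scaleN1r nrmN; lra.
Qed.

(** Peel off one linear factor: M W^(k+1) = z M W^k + M (W - z) W^k, where the last term tends to 0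
    by induction and |z| < 1. This takes the place of a Jordan form. *)
Lemma nrmc_powers_cvg0 n (W : 'M[C]_n) (rs : seq C) (M : 'M[C]_n) :
  (forall z, z \in rs -> normc z < 1) ->
  M *m mxeval (\prod_(z <- rs) ('X - z%:P)) W = 0 ->
  nrmc (M *m mpow W k) @[k --> \oo] --> (0 : R).
Proof.
elim: rs M => [|z rs IH] M hrs.
  rewrite big_nil mxeval1 mulmx1 => ->; under eq_fun do rewrite mul0mx.
  rewrite (_ : (fun=> _) = fun=> 0); first exact: cvg_cst.
  apply/funext => _; rewrite /nrmc big1 // => i _; rewrite big1 // => j _.
  by rewrite mxE Normc.normc0.
rewrite big_cons mxevalM mulmxA => /IH h.
apply: (contraction_cvg0 (r := normc z)) (h _); last first.
- by move=> x xrs; apply: hrs; rewrite in_cons xrs orbT.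
- move=> k; rewrite mpowS mulmxA -nrmcZ; apply: le_trans (nrmcD _ _).
  rewrite mxevalB mxevalX mxevalC mulmxBr mulmxBl mul_mx_scalar -scalemxAl.
  by rewrite addrC subrK.
- by move=> k; exact: nrmc_ge0.
by rewrite normc_ge0 hrs // in_cons eqxx.
Qed.

Lemma eigenvalueP_row n (W : 'M[C]_n) z : root (char_poly W) z ->
  exists2 v : 'rV_n, v *m W = z *: v & v != 0.
Proof. by rewrite -eigenvalue_root_char => /eigenvalueP. Qed.

Lemma row_eigenvalue n (W : 'M[C]_n) z (v : 'rV_n) : v *m W = z *: v -> v != 0 ->
  root (char_poly W) z.
Proof. by move=> e v0; rewrite -eigenvalue_root_char; apply/eigenvalueP; exists v. Qed.

Lemma mxeval_char_poly n (W : 'M[C]_n) : mxeval (char_poly W) W = 0.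
Proof.
case: n W => [|n] W; first exact: mx0E.
by rewrite mxeval_horner Cayley_Hamilton.
Qed.

Lemma spectral_radius_powers n (W : 'M[C]_n) :
  (forall z, root (char_poly W) z -> normc z < 1) -> cvm (fun k => mpow (tau 1 W) k) 0.
Proof.
move=> hW; have [rs ers] := closed_field_poly_normal (char_poly W).
rewrite (monicP (char_poly_monic W)) scale1r in ers.
have h : nrmc (1%:M *m mpow W k) @[k --> \oo] --> (0 : R).
  apply: (@nrmc_powers_cvg0 _ W rs) => [z zrs|].
    by apply: hW; rewrite ers root_prod_XsubC.
  by rewrite -ers mxeval_char_poly mulmx0.
apply: (@cvm_le _ _ _ _ _ (fun k => 4 * nrmc (1%:M *m mpow W k))) => [k|].
  by rewrite subr0 mul1mx -tau_mpow ?oner_eq0 // nrm_tau.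
by rewrite -[X in _ --> X](mulr0 (4 : R)); apply: cvgM; [exact: cvg_cst|].
Qed.

Definition stable n (K : 'M[C]_n) := forall z, root (char_poly K) z -> 0 < complex.Re z.

Lemma stable_unit n (K : 'M[C]_n) : stable K -> 1%:M + K \in unitmx.
Proof.
move=> hK; apply/mxrow_unitP => v; rewrite mulmxDr mulmx1 => e.
apply/eqP; apply: contraT => v0.
have := hK (-1); rewrite (row_eigenvalue (v := v)) // => [/(_ isT)|].
  by rewrite /= oppr_gt0 ltr10.
by rewrite scaleN1r; apply/eqP; rewrite -addr_eq0 addrC e.
Qed.

(** To an eigenvalue z corresponds the eigenvalue w = (1 - z)/(1 + z) of K, and Re(w) |1 + z|^2 = 1
    - |z|^2. *)
Lemma stable_cayley n (K : 'M[C]_n) z : stable K ->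
  root (char_poly ((1%:M - K) *m invmx (1%:M + K))) z -> normc z < 1.
Proof.
move=> hK /eigenvalueP_row [v ev v0]; have u := stable_unit hK.
have eK : v *m (1%:M - K) = z *: (v *m (1%:M + K)).
  by rewrite scalemxAl -ev -mulmxA -mulmxA mulVmx // mulmx1.
have e1 : (1 + z) *: (v *m K) = (1 - z) *: v.
  move: eK; rewrite mulmxBr mulmxDr !mulmx1; move: (v *m K) => w eK.
  apply/matrixP => i j; have /matrixP /(_ i j) := eK; rewrite !mxE => h.
  have -> : (1 + z) * w i j = (1 - z) * v i j - ((v i j - w i j) - z * (v i j + w i j)) by ring.
  by rewrite h subrr subr0.
have z1 : 1 + z != 0.
  apply: contraNneq v0 => z1; move: e1; rewrite z1 scale0r => /esym/eqP.
  have -> : 1 - z = 2 by have /eqP := z1; rewrite addrC addr_eq0 => /eqP ->; ring.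
  by rewrite scaler_eq0 pnatr_eq0.
have hl : root (char_poly K) ((1 - z) / (1 + z)).
  apply: (row_eigenvalue (v := v)) => //.
  by rewrite mulrC -scalerA -e1 scalerA mulVf // scale1r.
have := hK _ hl; have := divfK z1 (1 - z); move: ((1 - z) / (1 + z)) => [c d] eL c0.
case: z z1 eL {ev eK e1 hl} => a b z1 eL /=.
have := congr1 (@complex.Re R) eL; have := congr1 (@complex.Im R) eL.
rewrite complex_ReM complex_ImM /= => eI eR; rewrite /= in c0.
have s0 : 0 < (1 + a) ^+ 2 + b ^+ 2.
  rewrite lt_neqAle addr_ge0 ?sqr_ge0 // andbT eq_sym.
  apply: contra z1; rewrite paddr_eq0 ?sqr_ge0 // !sqrf_eq0 => /andP[/eqP h1 /eqP h2].
  by rewrite eq_complex /= h1 h2 add0r !eqxx.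
rewrite -sqrtr1 ltr_sqrt //.
have : 0 < c * ((1 + a) ^+ 2 + b ^+ 2) by rewrite mulr_gt0.
have -> : c * ((1 + a) ^+ 2 + b ^+ 2) = (c * (1 + a) - d * (0 + b)) * (1 + a) + (c * (0 + b) + d * (1 + a)) * b by ring.
by rewrite eI eR; lra.
Qed.

End PowersToZero.

(** * Convergence through the Cayley transform *)

Section CayleyConvergence.
Variables (R : realType) (l : nat) (p q : {poly R}).
Hypotheses (l_gt0 : (1 <= l)%N) (pade : is_pade_invsqrt l p q).
Local Notation G := (Giter p q).
Local Notation Z := (Ziter p q).
Local Notation reg := (reg p q).
Local Notation Ginf := (Ginf p q).
Let N := (2 * l).+1%N.

Lemma cvm_lipat m n r s (f : 'M[R]_(m, n) -> 'M[R]_(r, s)) X L :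
  lipat f L -> cvm X L -> cvm (fun k => f (X k)) (f L).
Proof.
move=> hf /cvmP hX; apply/cvgrPdist_lt => e e0.
have H : \forall k \near \oo, nrm (f (X k) - f L) < e.
  apply: (hX (fun y => nrm (f y - f L) < e)).
  apply: (lipat_cvg (P := fun z => nrm (z - f L) < e) hf).
  exact: near_nrm_lt.
by apply: filterS H => k /= h; rewrite sub0r normrN ger0_norm ?nrm_ge0.
Qed.

(** A row with v W^M = -v keeps its norm under all powers of W^M, which forces v = 0. *)
Lemma unit_1Dmpow n (W : 'M[R]_n) M : (0 < M)%N -> cvm (fun k => mpow W k) 0 ->
  1%:M + mpow W M \in unitmx.
Proof.
move=> M0 h; apply/mxrow_unitP => v; rewrite mulmxDr mulmx1 => /eqP.
rewrite addrC addr_eq0 => /eqP e.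
have half : 0 < 2^-1 :> R by rewrite invr_gt0.
have [K /(_ (M * K)%N)] := cvm_near_lt half h; rewrite subr0 leq_pmull // => /(_ isT) hK.
have nv : nrm (v *m mpow W (M * K)) = nrm v.
  rewrite mpowM; elim: K {hK} => [|K IH]; first by rewrite mulmx1.
  by rewrite mpowS mulmxA e mulNmx nrmN.
apply: nrm0_eq0; have := nrmM v (mpow W (M * K)); rewrite nv.
have := nrm_ge0 v; move: (nrm v) (nrm (mpow _ _)) hK => x y *; nra.
Qed.

Lemma pade_cayley_mx : exists2 a : R, a != 0 & forall n (X : 'M[R]_n),
  mxeval q (1%:M - X *m X) - X *m mxeval p (1%:M - X *m X) = a *: mpow (1%:M - X) N /\
  mxeval q (1%:M - X *m X) + X *m mxeval p (1%:M - X *m X) = a *: mpow (1%:M + X) N.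
Proof.
have [a a0 [e1 e2]] := pade_cayley pade; exists a => // n X.
have ev (r : {poly R}) : mxeval (r \Po (1 - 'X^2)) X = mxeval r (1%:M - X *m X).
  by rewrite mxeval_comp mxevalB mxeval1 mxevalXn mxevalX !mpowS mulmx1.
have := congr1 (fun r => mxeval r X) e1; have := congr1 (fun r => mxeval r X) e2.
rewrite /= mxevalB !mxevalD !mxevalM !ev !mxevalZ !mxevalXn mxevalB mxevalD mxeval1 !mxevalX.
by split.
Qed.

(* X_k = K G_k(K^2) satisfies I - X_k = W^(N^k) (I + X_k). *)
Lemma cayley_reg n (K : 'M[R]_n) : 1%:M + K \in unitmx ->
  cvm (fun k => mpow ((1%:M - K) *m invmx (1%:M + K)) k) 0 ->
  reg (K *m K) /\ K *m Ginf (K *m K) = 1%:M.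
Proof.
set W := (_ *m invmx _) => uK hW; have [a a0 hc] := pade_cayley_mx.
have [X XE] : exists X : nat -> 'M[R]_n, forall k, X k = K *m G (K *m K) k by eexists.
have XX k : 1%:M - X k *m X k = Z (K *m K) k.
  rewrite /Ziter !XE; congr (_ - _).
  by rewrite -!mulmxA (mulmxA _ K) Giter_comm ?mulmxA.
have XS k : X k.+1 = X k *m rmx p q (1%:M - X k *m X k) by rewrite XX !XE GiterS [LHS]mulmxA.
have comK k : K *m X k = X k *m K by rewrite XE -[RHS]mulmxA Giter_comm ?mulmxA.
have comW k : W *m X k = X k *m W.
  rewrite /W -mulmxA invmx_comm; last by rewrite mulmxDl mulmxDr mul1mx mulmx1 comK.
  by rewrite !mulmxA; congr (_ *m _); rewrite mulmxBl mulmxBr mul1mx mulmx1 comK.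
have main k : [/\ Gdom p q (K *m K) k, 1%:M + X k \in unitmx &
    1%:M - X k = mpow W (N ^ k) *m (1%:M + X k)].
  elim: k => [|k [u u1 eX]].
    split=> //; first by rewrite XE /= mulmx1.
    by rewrite expn0 mpowS !mulmx1 XE /= mulmx1 /W -mulmxA mulVmx ?mulmx1.
  set V := mpow W (N ^ k) in eX.
  have comV : V *m X k = X k *m V by exact: mpow_intertwine.
  have VN : mpow V N = mpow W (N ^ k.+1) by rewrite expnSr mpowM.
  have eXN : mpow (1%:M - X k) N = mpow V N *m mpow (1%:M + X k) N.
    by rewrite eX mpow_mulC // mulmxDl mulmxDr mulmx1 mul1mx comV.
  have [hm hp] := hc n (X k); set Q := mxeval q _ in hm hp; set P := mxeval p _ in hm hp.
  have uN : mpow (1%:M + X k) N \in unitmx.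
    by elim: (N) => [|j IH]; rewrite ?unitmx1 // mpowS unitmx_mul u1.
  (* The sum of the two Cayley identities isolates the denominator; its invertibility extends the
     domain by one stage. *)
  have Q2 : 2 *: Q = a *: ((1%:M + mpow V N) *m mpow (1%:M + X k) N).
    rewrite mulmxDl mul1mx -eXN scalerDr -hm -hp.
    by move: (X k *m P) => T; rewrite scaler_nat mulr2n addrACA subrr addr0.
  have uQ : Q \in unitmx.
    have : 2 *: Q \in unitmx.
      rewrite Q2 unitmxZ ?unitfE // unitmx_mul uN andbT VN unit_1Dmpow //.
      by rewrite expn_gt0.
    by rewrite unitmxZ // unitfE pnatr_eq0.
  have e1 : (1%:M + X k.+1) *m Q = a *: mpow (1%:M + X k) N.
    by rewrite XS mulmxDl mul1mx /rmx -/P -/Q !mulmxA mulmxKV.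
  have e2 : (1%:M - X k.+1) *m Q = a *: mpow (1%:M - X k) N.
    by rewrite XS mulmxBl mul1mx /rmx -/P -/Q !mulmxA mulmxKV.
  split.
  - move=> j; rewrite ltnS leq_eqVlt => /orP[/eqP ->|]; last exact: u.
    by rewrite -XX.
  - have : (1%:M + X k.+1) *m Q \in unitmx by rewrite e1 unitmxZ ?unitfE.
    by rewrite unitmx_mul => /andP[].
  apply: (can_inj (mulmxK uQ)).
  by rewrite e2 eXN -[RHS]mulmxA e1 VN scalemxAr.
have hX : cvm X 1%:M.
  have hV : cvm (fun k => mpow W (N ^ k)) 0.
    move: hW => /cvmP hW; apply/cvmP; apply: cvg_comp hW.
    apply/cvgnyPge => M; near=> k; apply: leq_trans (_ : k <= _)%N; first by near: k; exact: nbhs_infty_ge.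
    by apply: ltnW; apply: ltn_expl; rewrite /N ltnS muln_gt0.
  (* The inverse Cayley transform recovers X_k from the power W^(N^k), and is Lipschitz at 0. *)
  pose f (V : 'M[R]_n) := invmx (1%:M + V) *m (1%:M - V).
  have hf : lipat f 0.
    apply: lipatM.
      apply: lipat_inv; first by rewrite addr0 unitmx1.
      by apply: lipatD; [exact: lipat_cst|exact: lipat_id].
    by apply: lipatD; [exact: lipat_cst|apply: lipatN; exact: lipat_id].
  have -> : 1%:M = f 0 by rewrite /f addr0 subr0 mulmx1 invmx1.
  apply: (cvm_eq (X := fun k => f (mpow W (N ^ k)))); last exact: cvm_lipat.
  move=> k; have [_ _ e] := main k; set V := mpow W _ in e *.
  have uV : 1%:M + V \in unitmx by apply: unit_1Dmpow; rewrite // expn_gt0.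
  rewrite /f -[RHS](mulKmx uV); congr (_ *m _).
  move: e; rewrite mulmxDr mulmxDl mulmx1 mul1mx; move: (V *m X k) => T e.
  by rewrite -{1}(subrK (X k) 1%:M) e addrAC [V + T]addrC addrK addrC.
have hreg : reg (K *m K).
  split=> [k|]; first by case: (main k).
  apply: (cvm_eq (X := fun k => 1%:M - X k *m X k)) => [k|]; first by rewrite XX.
  have -> : 0 = 1%:M - 1%:M *m 1%:M :> 'M[R]_n by rewrite mulmx1 subrr.
  by apply: cvmD; [exact: cvm_cst|apply: cvmN; exact: cvmM].
split=> //; apply: cvm_unique hX; apply: (cvm_eq (fun k => esym (XE k))).
apply: cvmM; first exact: cvm_cst.
exact: (reg_cvg l_gt0 pade).
Unshelve. all: by end_near. Qed.

Local Notation C := R[i].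

Lemma tau1_cmx n (Y : 'M[R]_n) : tau 1 (cmx Y) = block_mx Y 0 0 Y.
Proof. by rewrite /tau Remx_cmx Immx_cmx !scaler0. Qed.

Lemma Ginf_diag n (Y : 'M[R]_n) : reg Y ->
  Ginf (block_mx Y 0 0 Y) = block_mx (Ginf Y) 0 0 (Ginf Y).
Proof.
move=> hY; rewrite (Ginf_triangular l_gt0 pade) //; congr block_mx.
have := DGinf_linear l_gt0 pade hY 1 0 0; rewrite !scale1r addr0 => e.
by apply: (addrI (DGinf p q Y 0)); rewrite -e addr0.
Qed.

(** K may be complex, so the real argument is applied to [tau 1 K], whose square is diag(Y, Y);
    regularity then descends to the block Y. *)
Lemma stable_sqrt_reg n (Y : 'M[R]_n) (K : 'M[C]_n) : cmx Y = K *m K -> stable K ->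
  reg Y /\ K *m cmx (Ginf Y) = 1%:M.
Proof.
move=> eY hK; have u := stable_unit hK.
have hW := spectral_radius_powers (fun z => stable_cayley hK (z := z)).
have [] := @cayley_reg _ (tau 1 K).
- by rewrite -(tau1 (1 : R) n) -tauD tau_unit ?oner_neq0.
- rewrite -(tau1 (1 : R) n) -tauD -tauB ?oner_neq0 //.
  by rewrite -tau_inv ?oner_neq0 // -tauM ?oner_neq0.
rewrite -tauM ?oner_neq0 // -eY tau1_cmx => /reg_diag [hY _].
rewrite Ginf_diag // -tau1_cmx -tauM ?oner_neq0 // -(tau1 (1 : R) n) => /(tau_inj (oner_neq0 R)) e.
by split.
Qed.

End CayleyConvergence.

(** * Identification of the limits *)

Section SignFunction.
Variables (R : realType) (l : nat) (p q : {poly R}).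
Hypotheses (l_gt0 : (1 <= l)%N) (pade : is_pade_invsqrt l p q).
Local Notation G := (Giter p q).
Local Notation Z := (Ziter p q).
Local Notation reg := (reg p q).
Local Notation Ginf := (Ginf p q).
Local Notation C := R[i].

(* K = Q diag(-J1, J2) Q^(-1) is the square root of A^2 with spectrum in the right half
   plane, and A = sign(A) K. *)
Lemma sign_decomposition m n (A : 'M[R]_(m + n)) (Q : 'M[C]_(m + n)) J1 J2 : Q \in unitmx ->
  (forall z, root (char_poly J1) z -> complex.Re z < 0) ->
  (forall z, root (char_poly J2) z -> 0 < complex.Re z) ->
  cmx A = Q *m block_mx J1 0 0 J2 *m invmx Q ->
  reg (A *m A) /\
  cmx (A *m Ginf (A *m A)) = Q *m block_mx (- 1%:M) 0 0 1%:M *m invmx Q.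
Proof.
move=> uQ h1 h2 eA; pose K := Q *m block_mx (- J1) 0 0 J2 *m invmx Q.
have eK : cmx (A *m A) = K *m K.
  have eD : block_mx J1 0 0 J2 *m block_mx J1 0 0 J2 =
      block_mx (- J1) 0 0 J2 *m block_mx (- J1) 0 0 J2.
    by rewrite !mulmx_block_diag mulNmx mulmxN opprK.
  rewrite cmxM eA (mulmx_conj (block_mx J1 0 0 J2) (block_mx J1 0 0 J2) uQ) eD.
  exact: esym (mulmx_conj (block_mx (- J1) 0 0 J2) (block_mx (- J1) 0 0 J2) uQ).
have hK : stable K.
  move=> z /eigenvalueP_row [v ev v0].
  have := eigenrow_conj uQ ev.
  have : v *m Q != 0.
    by apply: contraNneq v0 => w0; rewrite -(mulmxK uQ v) w0 mul0mx.
  rewrite -(hsubmxK (v *m Q)); move: (lsubmx _) (rsubmx _) => w1 w2 w0.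
  rewrite mul_row_block !mulmx0 addr0 add0r scale_row_mx => /eq_row_mx [e1 e2].
  have [w10|w10] := eqVneq w1 0.
    apply: h2; apply: (row_eigenvalue e2); apply: contraNneq w0 => w20.
    by rewrite w10 w20 row_mx0.
  have : root (char_poly J1) (- z).
    by apply: (row_eigenvalue (v := w1)) => //; rewrite scaleNr -e1 mulmxN opprK.
  by move/h1; case: (z) => a b /=; rewrite oppr_lt0.
have [hreg e] := stable_sqrt_reg l_gt0 pade eK hK.
have eAK : cmx A = (Q *m block_mx (- 1%:M) 0 0 1%:M *m invmx Q) *m K.
  by rewrite eA /K (mulmx_conj _ _ uQ) mulmx_block_diag mulNmx mulmxN opprK !mul1mx.
split=> //; rewrite cmxM eAK; move: (Q *m block_mx (- 1%:M) 0 0 1%:M *m invmx Q) => T.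
by rewrite -[LHS]mulmxA e mulmx1.
Qed.

(** Every admissible splitting leads to the same limit, which gives the uniqueness that [xget] asks
    for. *)
Lemma is_sign_of_limit n (A S : 'M[R]_n) : is_sign_of A S ->
  reg (A *m A) /\ A *m Ginf (A *m A) = S.
Proof.
case=> m1 [m2 [e]]; case: n / e A S => A S [Q [J1 [J2 [uQ [h1 [h2 []]]]]]].
rewrite !castmx_id => eA eS; have [hreg e] := sign_decomposition uQ h1 h2 eA.
by split=> //; apply: (@cmx_inj R); rewrite e eS.
Qed.

Lemma invariant_splitting_sign n m1 m2 (e : (m1 + m2)%N = n) (A : 'M[R]_n)
    (V1 : 'M[C]_(m1, n)) (V2 : 'M[C]_(m2, n)) J1 J2 :
  V1 *m cmx A = J1 *m V1 -> V2 *m cmx A = J2 *m V2 -> \rank (col_mx V1 V2) = n ->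
  (forall z, root (char_poly J1) z -> complex.Re z < 0) ->
  (forall z, root (char_poly J2) z -> 0 < complex.Re z) ->
  exists S, is_sign_of A S.
Proof.
case: n / e A V1 V2 => A V1 V2 e1 e2 rk h1 h2.
have uW : col_mx V1 V2 \in unitmx by rewrite -row_free_unit /row_free rk.
have eA : cmx A = invmx (col_mx V1 V2) *m block_mx J1 0 0 J2 *m invmx (invmx (col_mx V1 V2)).
  rewrite invmxK -mulmxA -[LHS](mulKmx uW); congr (_ *m _).
  by rewrite mul_col_mx mul_block_col e1 e2 !mul0mx addr0 add0r.
have uQ : invmx (col_mx V1 V2) \in unitmx by rewrite unitmx_inv.
have [hreg eS] := sign_decomposition uQ h1 h2 eA.
exists (A *m Ginf (A *m A)); exists m1, m2, erefl, (invmx (col_mx V1 V2)), J1, J2.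
by rewrite !castmx_id; do !split.
Qed.

Lemma mx0_char_poly_root (J : 'M[C]_0) z : root (char_poly J) z = false.
Proof.
apply/negP => /eigenvalueP_row [v _]; by rewrite (thinmx0 v) eqxx.
Qed.

Lemma kermxpoly_eigenvalue n (P : {poly C}) (B : 'M[C]_n.+1) m (V : 'M[C]_(m, n.+1)) J z :
  row_free V -> (V <= kermxpoly B P)%MS -> V *m B = J *m V ->
  root (char_poly J) z -> root P z.
Proof.
move=> fV sV eV /eigenvalueP_row [v ev v0]; pose u := v *m V.
have u0 : u != 0 by rewrite mulmx_free_eq0.
have eu : z%:M *m u = u *m B by rewrite /u -mulmxA eV mulmxA ev mul_scalar_mx scalemxAl.
have : u *m mxeval P B = 0.
  by rewrite mxeval_horner; apply/sub_kermxP; apply: submx_trans sV; exact: submxMl.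
rewrite -(mxeval_intertwine P eu) mxeval_scalar mul_scalar_mx => /eqP.
by rewrite scaler_eq0 (negPf u0) orbF.
Qed.

(** The characteristic polynomial factors into two coprime parts, with roots on either side of the
    imaginary axis; their kernels are complementary invariant row spaces. *)
Lemma sign_exists n (A : 'M[R]_n) : no_imag_eig A -> exists S, is_sign_of A S.
Proof.
case: n A => [|n] A hA.
  apply: (@invariant_splitting_sign 0 0 0 erefl A 0 0 0 0).
  - exact: mx0E.
  - exact: mx0E.
  - by apply/eqP; rewrite -leqn0 rank_leq_col.
  - by move=> z; rewrite mx0_char_poly_root.
  - by move=> z; rewrite mx0_char_poly_root.
have [rs ers] := closed_field_poly_normal (char_poly (cmx A)).
rewrite (monicP (char_poly_monic _)) scale1r in ers.
pose neg (z : C) := complex.Re z < 0.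
pose P1 := \prod_(z <- rs | neg z) ('X - z%:P); pose P2 := \prod_(z <- rs | ~~ neg z) ('X - z%:P).
have rP (a : pred C) z : root (\prod_(z <- rs | a z) ('X - z%:P)) z -> (z \in rs) && a z.
  by rewrite -big_filter root_prod_XsubC mem_filter andbC.
have rs_root z : z \in rs -> complex.Re z != 0 by move=> zr; apply: hA; rewrite ers root_prod_XsubC.
have eP : char_poly (cmx A) = P1 * P2 by rewrite ers (bigID neg).
have cop : coprimep P1 P2.
  apply: Pdiv.ClosedField.root_coprimep => z /rP /andP[_ nz].
  by apply/negP => /rP /andP[_]; rewrite nz.
pose B := cmx A; pose U1 := kermxpoly B P1; pose U2 := kermxpoly B P2.
have full : (U1 + U2 :=: 1%:M)%MS.
  apply: eqmx_trans (eqmx_sym (kermxpolyM B cop)) _; apply: kermxpoly_min.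
  by rewrite -eP mxminpoly_dvd_char.
have rk : (\rank U1 + \rank U2)%N = n.+1.
  by rewrite -(mxrank_disjoint_sum (mxdirect_kermxpoly B cop)) full mxrank1.
have st P : exists J, row_base (kermxpoly B P) *m B = J *m row_base (kermxpoly B P).
  by apply/submxP; rewrite -/(stablemx _ _) stablemx_row_base comm_mx_stable_kermxpoly.
have [J1 e1] := st P1; have [J2 e2] := st P2.
apply: (invariant_splitting_sign rk e1 e2).
- rewrite -addsmxE (adds_eqmx (eq_row_base _) (eq_row_base _)) full mxrank1 //.
- move=> z hz; have := kermxpoly_eigenvalue (P := P1) (row_base_free _) _ e1 hz.
  by rewrite eq_row_base submx_refl => /(_ isT) /rP /andP[].
- move=> z hz; have := kermxpoly_eigenvalue (P := P2) (row_base_free _) _ e2 hz.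
  rewrite eq_row_base submx_refl => /(_ isT) /rP /andP[zr nz].
  by rewrite lt_neqAle eq_sym rs_root //= leNgt.
Qed.

(* The eigenvalue of Y G_k^2 on u would be -(b g)^2 <= 0, far from 1. *)
Lemma reg_no_negative_eigenvalue n (Y : 'M[R]_n) (u : 'rV_n) b : reg Y ->
  u *m Y = - b ^+ 2 *: u -> u = 0.
Proof.
move=> [hu hz] e; apply/eqP; apply: contraT => u0.
have scal g k : u *m G Y k = g *: u -> u *m Z Y k = (1 + (b * g) ^+ 2) *: u.
  move=> eg; rewrite /Ziter mulmxBr mulmx1 !mulmxA e -!scalemxAl eg -scalemxAl eg !scalerA.
  by rewrite -{1}(scale1r u) -scalerBl; congr (_ *: _); ring.
have eG k : exists g, u *m G Y k = g *: u.
  elim: k => [|k [g eg]]; first by exists 1; rewrite mulmx1 scale1r.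
  have ez := scal _ _ eg; set z := 1 + _ in ez.
  have e1 : z%:M *m u = u *m Z Y k by rewrite mul_scalar_mx ez.
  have uz : mxeval q (z%:M : 'M[R]_1) \in unitmx.
    rewrite mxeval_scalar -scalemx1 unitmxZ ?unitmx1 // unitfE.
    apply: contraNneq u0 => qz; have := mxeval_intertwine q e1.
    rewrite mxeval_scalar qz mul_scalar_mx scale0r => /esym.
    move/(congr1 (mulmx^~ (invmx (mxeval q (Z Y k))))).
    by rewrite mulmxK ?(hu k.+1) // mul0mx => ->.
  have := rmx_intertwine p uz (hu k.+1 k (leqnn _)) e1.
  have -> : rmx p q (z%:M : 'M[R]_1) = (rmx p q (z%:M : 'M[R]_1) 0 0)%:M by rewrite -mx11_scalar.
  rewrite mul_scalar_mx => er; exists (g * rmx p q (z%:M : 'M[R]_1) 0 0).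
  by rewrite GiterS [LHS]mulmxA eg -scalemxAl -er scalerA.
have half : 0 < 2^-1 :> R by rewrite invr_gt0.
have [k /(_ k (leqnn k))] := cvm_near_lt half hz; rewrite subr0 => hk.
have [g eg] := eG k; have := nrmM u (Z Y k); rewrite (scal _ _ eg) nrmZ.
have nu : 0 < nrm u.
  by rewrite lt_neqAle nrm_ge0 andbT eq_sym; apply: contraNneq u0 => h; apply/eqP/nrm0_eq0; rewrite h.
have b0 := sqr_ge0 (b * g); rewrite ger0_norm ?addr_ge0 //.
have := nrm_ge0 (Z Y k); move: (nrm u) (nrm (Z Y k)) ((b * g) ^+ 2) nu hk b0 => x y t.
by clear; move=> *; nra.
Qed.

(** An eigenvalue ib of A makes the real and imaginary parts of its eigenvector satisfy u A^2 = -b^2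
    u. This converse makes the hypothesis on A an open condition. *)
Lemma reg_no_imag_eig n (A : 'M[R]_n) : reg (A *m A) -> no_imag_eig A.
Proof.
move=> hreg z /eigenvalueP_row [v ev]; apply: contraNneq => z0.
have ev2 : v *m cmx (A *m A) = ((- (complex.Im z) ^+ 2)%:C)%C *: v.
  rewrite cmxM mulmxA ev -scalemxAl ev scalerA; congr (_ *: _).
  case: (z) z0 => a b /= ->; apply/eqP; rewrite eq_complex complex_ReM complex_ImM /=.
  by rewrite !mul0r mulr0 addr0 sub0r expr2 !eqxx.
have h1 : Remx v = 0.
  apply: (reg_no_negative_eigenvalue (b := complex.Im z) hreg).
  by have := congr1 (@Remx R _ _) ev2; rewrite RemxM RemxZ Remx_cmx Immx_cmx mulmx0 subr0.
have h2 : Immx v = 0.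
  apply: (reg_no_negative_eigenvalue (b := complex.Im z) hreg).
  by have := congr1 (@Immx R _ _) ev2; rewrite ImmxM ImmxZ Remx_cmx Immx_cmx mulmx0 add0r.
by apply/eqP/mx_ReIm; rewrite ?h1 ?h2; apply/matrixP => i j; rewrite !mxE.
Qed.

(** The first alternative is available at A, the second at the nearby X where the derivative is
    computed. [polarE] has the same shape. *)
Lemma msignE n (A : 'M[R]_n) : no_imag_eig A \/ reg (A *m A) ->
  reg (A *m A) /\ msign A = A *m Ginf (A *m A).
Proof.
move=> h; have hA : no_imag_eig A by case: h => // /reg_no_imag_eig.
have [S hS] := sign_exists hA; have [hreg eS] := is_sign_of_limit hS.
split=> //; rewrite eS; apply: xget_unique => // S' /is_sign_of_limit [_ <-].
by rewrite eS.
Qed.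

End SignFunction.

(** * Positive definite matrices *)

Section PositiveDefinite.
Variable R : realType.
Local Notation C := R[i].

Definition dot n (x y : 'rV[R]_n) : R := (x *m y^T) 0 0.

Lemma dotC n (x y : 'rV[R]_n) : dot x y = dot y x.
Proof. by rewrite /dot -{1}(trmxK x) -trmx_mul mxE. Qed.

Lemma dot_gt0 n (x : 'rV[R]_n) : x != 0 -> 0 < dot x x.
Proof.
move=> x0; rewrite /dot mxE lt_neqAle sumr_ge0 ?andbT; last first.
  by move=> i _; rewrite mxE -expr2 sqr_ge0.
apply: contraNneq x0 => /esym/eqP; rewrite psumr_eq0 => [/allP h|i _]; last first.
  by rewrite mxE -expr2 sqr_ge0.
apply/eqP/rowP => i; rewrite mxE; have := h i (mem_index_enum i).
by rewrite mxE -expr2 sqrf_eq0 => /eqP.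
Qed.

Lemma dot_ge0 n (x : 'rV[R]_n) : 0 <= dot x x.
Proof. by have [->|/dot_gt0/ltW //] := eqVneq x 0; rewrite /dot mul0mx mxE. Qed.

(** The order on complex numbers makes 0 < z include that z is real. For an eigenvector a + ib,
    symmetry of H kills Im z and positivity on a and b gives the sign of Re z. *)
Lemma spd_eigenvalue n (H : 'M[R]_n) z : is_spd H -> root (char_poly (cmx H)) z -> 0 < z.
Proof.
move=> [symH posH] /eigenvalueP_row [v ev v0].
pose a := Remx v; pose b := Immx v.
case: z ev => c d ev.
have ea : a *m H = c *: a - d *: b.
  have := congr1 (@Remx R _ _) ev; rewrite RemxM Remx_cmx Immx_cmx mulmx0 subr0 => ->.
  by apply/matrixP => i j; rewrite !mxE complex_ReM.
have eb : b *m H = c *: b + d *: a.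
  have := congr1 (@Immx R _ _) ev; rewrite ImmxM Remx_cmx Immx_cmx mulmx0 add0r => ->.
  by apply/matrixP => i j; rewrite !mxE complex_ImM.
have pos (x : 'rV[R]_n) : x != 0 -> 0 < dot (x *m H) x.
  move=> x0; have := posH x^T; rewrite trmxK; apply.
  by apply: contraNneq x0 => e; rewrite -(trmxK x) e trmx0.
have pos0 (x : 'rV[R]_n) : 0 <= dot (x *m H) x.
  by have [->|/pos/ltW //] := eqVneq x 0; rewrite /dot !mul0mx mxE.
have e1 : dot (a *m H) a = c * dot a a - d * dot b a.
  by rewrite ea /dot mulmxBl -!scalemxAl !mxE.
have e2 : dot (b *m H) b = c * dot b b + d * dot a b.
  by rewrite eb /dot mulmxDl -!scalemxAl !mxE.
have e3 : dot (a *m H) b = c * dot a b - d * dot b b.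
  by rewrite ea /dot mulmxBl -!scalemxAl !mxE.
have e4 : dot (b *m H) a = c * dot b a + d * dot a a.
  by rewrite eb /dot mulmxDl -!scalemxAl !mxE.
have e5 : dot (a *m H) b = dot (b *m H) a.
  by rewrite dotC /dot trmx_mul symH mulmxA.
rewrite [dot b a]dotC in e1 e4.
have sum0 : 0 < dot a a + dot b b /\ 0 < dot (a *m H) a + dot (b *m H) b.
  have [a0|a0] := eqVneq a 0; last first.
    by split; [rewrite ltr_pwDl ?dot_gt0 ?dot_ge0|rewrite ltr_pwDl ?pos ?pos0].
  have b0 : b != 0.
    apply: contraNneq v0 => b0; apply/eqP/mx_ReIm; rewrite -/a -/b ?a0 ?b0;
    by apply/matrixP => i j; rewrite !mxE.
  by split; [rewrite ltr_wpDl ?dot_gt0 ?dot_ge0|rewrite ltr_wpDl ?pos ?pos0].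
case: sum0 => s1 s2.
have hd : d = 0.
  have : d * (dot a a + dot b b) = 0 by move: e3 e4 e5 => -> ->; clear; lra.
  by move/eqP; rewrite mulf_eq0 (gt_eqF s1) orbF => /eqP.
have hc : 0 < c * (dot a a + dot b b) by rewrite (_ : _ * _ = dot (a *m H) a + dot (b *m H) b) // e1 e2; ring.
rewrite pmulr_lgt0 // in hc.
by rewrite ltcE /= hd eqxx.
Qed.

Lemma gram_spd m n (A : 'M[R]_(m, n)) : \rank A = n -> is_spd (A^T *m A).
Proof.
move=> rk; split=> [|x x0]; first by rewrite trmx_mul trmxK.
have -> : x^T *m (A^T *m A) *m x = (A *m x)^T *m ((A *m x)^T)^T.
  by rewrite trmxK trmx_mul !mulmxA.
apply: (@dot_gt0 _ (A *m x)^T); rewrite trmx_mul mulmx_free_eq0.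
  by apply: contraNneq x0 => e; rewrite -(trmxK x) e trmx0.
by rewrite /row_free mxrank_tr rk.
Qed.

Lemma symmetric_diagonalization n (Y : 'M[R]_n) : Y^T = Y ->
  exists2 P : 'M[C]_n, P \in unitmx & exists d, cmx Y = invmx P *m diag_mx d *m P.
Proof.
move=> symY; exists (spectralmx (cmx Y)); first exact: spectral_unit.
exists (spectral_diag (cmx Y)); apply/orthomx_spectralP.
have realY : cmx Y \is a mxOver Num.real.
  by apply/mxOverP => i j; rewrite mxE complex_real.
apply: hermitian_normalmx; apply: realsym_hermsym => //.
apply/is_hermitianmxP; rewrite expr0 scale1r map_mx_id //.
by apply/matrixP => i j; rewrite !mxE -{1}symY mxE.
Qed.

Lemma diag_stable n (P : 'M[C]_n) (s : 'rV[C]_n) : P \in unitmx -> (forall i, 0 < s 0 i) ->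
  stable (invmx P *m diag_mx s *m P).
Proof.
move=> uP hs z /eigenvalueP_row [v ev v0].
have uP' : invmx P \in unitmx by rewrite unitmx_inv.
rewrite -{2}(invmxK P) in ev; have := eigenrow_conj uP' ev.
have : v *m invmx P != 0.
  by apply: contraNneq v0 => w0; rewrite -(mulmxKV uP v) w0 mul0mx.
move: (v *m invmx P) => w w0 ew; move: w0; case/rV0Pn => i wi; have /rowP /(_ i) := ew.
rewrite mul_mx_diag !mxE mulrC => /(mulIf wi) <-.
by have := hs i; rewrite ltcE => /andP[].
Qed.

End PositiveDefinite.

Section PolarFactor.
Variables (R : realType) (l : nat) (p q : {poly R}).
Hypotheses (l_gt0 : (1 <= l)%N) (pade : is_pade_invsqrt l p q).
Local Notation G := (Giter p q).
Local Notation Z := (Ziter p q).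
Local Notation reg := (reg p q).
Local Notation Ginf := (Ginf p q).
Local Notation C := R[i].

Lemma trmx_Ginf n (Y : 'M[R]_n) : reg Y -> Y^T = Y -> (Ginf Y)^T = Ginf Y.
Proof.
move=> hY symY; have h := reg_cvg l_gt0 pade hY.
apply: cvm_unique h; apply: cvm_eq (cvm_tr (reg_cvg l_gt0 pade hY)) => k.
by rewrite trmx_Giter symY.
Qed.

(** K is the inverse of the real matrix [Ginf Y]: a stable square root is unique, and real. *)
Lemma real_sqrt n (Y : 'M[R]_n) (K : 'M[C]_n) : cmx Y = K *m K -> stable K ->
  reg Y /\ K = cmx (invmx (Ginf Y)).
Proof.
move=> eY hK; have [hY e] := stable_sqrt_reg l_gt0 pade eY hK; split=> //.
have uG : Ginf Y \in unitmx.
  by have := Ginf_sqr l_gt0 pade hY; rewrite mulmxA => /mulmx1_unit [].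
have e2 : cmx (invmx (Ginf Y)) *m cmx (Ginf Y) = 1%:M by rewrite -cmxM mulVmx // cmx1.
have [_ uc] := mulmx1_unit e2.
by apply: (can_inj (mulmxK uc)); rewrite e e2.
Qed.

(* The limit H is identified twice: as the real square root of Y, and through its own
   square root T, which makes x^T H x = |T x|^2 positive. *)
Lemma spd_sqrtE n (Y : 'M[R]_n) : is_spd Y ->
  reg Y /\ spd_sqrt Y = invmx (Ginf Y).
Proof.
move=> spdY; have symY := spdY.1.
have [P uP [d eY]] := symmetric_diagonalization symY.
have d0 i : 0 < d 0 i.
  apply: (spd_eigenvalue spdY); apply: (row_eigenvalue (v := delta_mx 0 i *m P)).
    by rewrite eY !mulmxA mulmxK // -rowE row_diag_mx -scalemxAl.
  rewrite mulmx_free_eq0 ?row_free_unit //; apply/rV0Pn; exists i.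
  by rewrite mxE !eqxx oner_neq0.
pose s : 'rV[C]_n := map_mx sqrtC d; pose t : 'rV[C]_n := map_mx sqrtC s.
have s0 i : 0 < s 0 i by rewrite mxE sqrtC_gt0.
have t0 i : 0 < t 0 i by rewrite mxE sqrtC_gt0.
have sq (x y : 'rV[C]_n) : (forall i, x 0 i ^+ 2 = y 0 i) ->
    invmx P *m diag_mx y *m P = (invmx P *m diag_mx x *m P) *m (invmx P *m diag_mx x *m P).
  move=> h; rewrite (mulmx_conjV (diag_mx x) (diag_mx x) uP) mulmx_diag.
  by congr (_ *m diag_mx _ *m _); apply/rowP => i; rewrite mxE -expr2 h.
have es : cmx Y = (invmx P *m diag_mx s *m P) *m (invmx P *m diag_mx s *m P).
  by rewrite eY; apply: sq => i; rewrite mxE sqrtCK.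
have et : invmx P *m diag_mx s *m P = (invmx P *m diag_mx t *m P) *m (invmx P *m diag_mx t *m P).
  by apply: sq => i; rewrite [t 0 i]mxE sqrtCK.
have [hY eK] := real_sqrt es (diag_stable uP s0); split=> //.
set H := invmx (Ginf Y) in eK *.
have uG : Ginf Y \in unitmx.
  by have := Ginf_sqr l_gt0 pade hY; rewrite mulmxA => /mulmx1_unit [].
have symH : H^T = H by rewrite /H trmx_inv trmx_Ginf.
have [hH eT] := real_sqrt (etrans (esym eK) et) (diag_stable uP t0).
set T := invmx (Ginf H) in eT.
have symT : T^T = T by rewrite /T trmx_inv trmx_Ginf.
have HTT : H = T *m T by apply: (@cmx_inj R); rewrite cmxM -eT -et eK.
have uT : T \in unitmx.
  rewrite /T unitmx_inv.
  by have := Ginf_sqr l_gt0 pade hH; rewrite mulmxA => /mulmx1_unit [].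
apply: xget_unique.
  split; last first.
    do 2 apply: (can_inj (mulmxK uG)).
    by rewrite mulmxKV // mulVmx // -mulmxA (Ginf_sqr l_gt0 pade).
  split=> // x x0; have -> : x^T *m H *m x = (T *m x)^T *m ((T *m x)^T)^T.
    by rewrite trmxK trmx_mul symT HTT !mulmxA.
  apply: (@dot_gt0 _ _ (T *m x)^T); apply: contraNneq x0 => /(congr1 trmx).
  by rewrite trmxK trmx0 => e; rewrite -(mulKmx uT x) e mulmx0.
(* Uniqueness: any positive definite root is a stable one. *)
move=> H' [spdH' eH']; apply: (@cmx_inj R).
have hK' : stable (cmx H').
  by move=> z /(spd_eigenvalue spdH'); rewrite ltcE => /andP[].
have e' : cmx Y = cmx H' *m cmx H' by rewrite -cmxM eH'.
by have [_ ->] := real_sqrt e' hK'.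
Qed.

Lemma polarE m n (A : 'M[R]_(m, n)) : \rank A = n \/ reg (A^T *m A) ->
  reg (A^T *m A) /\ polar A = A *m Ginf (A^T *m A).
Proof.
move=> h; have rk : \rank A = n.
  case: h => // /(reg_unit l_gt0 pade) u; apply/eqP; rewrite eqn_leq rank_leq_col /=.
  by have := mxrankM_maxr A^T A; rewrite (mxrank_unit u).
have [hY e] := spd_sqrtE (gram_spd rk).
by split=> //; rewrite /polar e invmxK.
Qed.

(** The mirror identities at T and at T^(-1) rewrite both numerators through the denominators, and
    the factors T^l and T^(-l) cancel. *)
Lemma pade_reciprocal n (T : 'M[R]_n) : T \in unitmx ->
  mxeval q (1%:M - T) \in unitmx -> mxeval q (1%:M - invmx T) \in unitmx ->
  rmx p q (1%:M - invmx T) *m rmx p q (1%:M - T) = 1%:M.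
Proof.
move=> uT uQ uQ'; have uT' : invmx T \in unitmx by rewrite unitmx_inv.
have e1 := pade_mirror pade uT; have e2 := pade_mirror pade uT'.
rewrite invmxK in e2; rewrite /rmx -e1 -e2.
have cT : T *m invmx T = invmx T *m T by rewrite mulmxV ?mulVmx.
have c1 : (1%:M - invmx T) *m T = T *m (1%:M - invmx T).
  by rewrite mulmxBl mulmxBr mulmx1 mul1mx cT.
have c2 : (1%:M - T) *m T = T *m (1%:M - T) by rewrite mulmxBl mulmxBr mulmx1 mul1mx.
have c3 : invmx (mxeval q (1%:M - invmx T)) *m mpow T l = mpow T l *m invmx (mxeval q (1%:M - invmx T)).
  apply: invmx_comm; apply: mxeval_comm; apply/esym.
  by apply: mpow_intertwine.
have c4 : mxeval q (1%:M - T) *m mpow T l = mpow T l *m mxeval q (1%:M - T).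
  by apply: mxeval_comm; apply/esym/mpow_intertwine.
set Q := mxeval q (1%:M - T) in uQ c4 *; set Q' := mxeval q (1%:M - invmx T) in uQ' c3 *.
have eTl : mpow (invmx T) l *m mpow T l = 1%:M.
  by rewrite -(mpow_mulC l (esym cT)) (mulVmx uT) mpow1.
clearbody Q Q'; rewrite -!mulmxA (mulmxA (invmx Q')) c3 -!mulmxA (mulmxA Q) c4 -!mulmxA.
by rewrite (mulKmx uQ') (mulmxV uQ) mulmx1.
Qed.

Lemma Giter_inv n (Y : 'M[R]_n) k : Y \in unitmx -> Gdom p q Y k -> Gdom p q (invmx Y) k ->
  G (invmx Y) k *m G Y k = 1%:M.
Proof.
move=> uY; elim: k => [|k IH] u u'; first by rewrite mul1mx.
have e := IH (Gdom_lt (leqnSn k) u) (Gdom_lt (leqnSn k) u').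
have [uG' uG] := mulmx1_unit e.
have eG : G (invmx Y) k = invmx (G Y k) by rewrite -[LHS](mulmxK uG) e mul1mx.
pose T := Y *m (G Y k *m G Y k).
have uT : T \in unitmx by rewrite !unitmx_mul uY uG.
have eT : invmx T = invmx Y *m (G (invmx Y) k *m G (invmx Y) k).
  have -> : T = G Y k *m (G Y k *m Y).
    by rewrite /T Giter_commY [RHS]mulmxA Giter_commY [LHS]mulmxA.
  by apply: invmx_eq; rewrite eG -!mulmxA !mulKVmx // mulmxV.
have eZ : Z Y k = 1%:M - T by [].
have eZ' : Z (invmx Y) k = 1%:M - invmx T by rewrite eT.
have r1 : rmx p q (1%:M - invmx T) *m rmx p q (1%:M - T) = 1%:M.
  by apply: pade_reciprocal => //; [rewrite -eZ; apply: u|rewrite -eZ'; apply: u'].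
have cm : rmx p q (1%:M - invmx T) *m G Y k = G Y k *m rmx p q (1%:M - invmx T).
  apply: rmx_comm; rewrite -eZ'; apply: Ziter_comm.
  by rewrite invmx_comm // Giter_commY.
rewrite !GiterS eZ eZ'; move: (rmx p q _) (rmx p q (1%:M - T)) r1 cm => r r' r1 cm.
by rewrite -!mulmxA (mulmxA r) cm -!mulmxA r1 mulmx1.
Qed.

Lemma Giter_group n (M Y : 'M[R]_n) k : M \in unitmx -> reg Y -> Y^T *m M *m Y = M ->
  (G Y k)^T *m M *m G Y k = M.
Proof.
move=> uM hY eM; have uY := reg_unit l_gt0 pade hY.
have hYT : reg Y^T.
  split=> [j|]; first by apply: Gdom_tr; apply: hY.1.
  have := cvm_tr hY.2; rewrite trmx0; apply: cvm_eq => j; exact: trmx_Ziter.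
have e : Y^T *m M = M *m invmx Y by rewrite -[LHS](mulmxK uY) eM.
have hYi : reg (invmx Y) := reg_similar uM e hYT.
rewrite trmx_Giter (Giter_intertwine (hYT.1 k) (hYi.1 k) e) -mulmxA.
by rewrite Giter_inv ?mulmx1 //; [apply: hY.1|apply: hYi.1].
Qed.

End PolarFactor.

(** * Automorphism groups *)

Section StructureMatrices.
Variable R : realType.

(** Row i has a single nonzero entry, in column i + h or i - h according to its half, so each sum
    collapses to one term. *)
Lemma Jmx_sqr N : ~~ odd N -> Jmx R N *m Jmx R N = - 1%:M.
Proof.
move=> evN; have eN : N = (N./2 + N./2)%N by rewrite addnn even_halfK.
set h := N./2 in eN; apply/matrixP => i j; rewrite !mxE -/h.
have [ih|hi] := ltnP i h.
  have lk : (i + h < N)%N by rewrite {2}eN ltn_add2r.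
  rewrite (bigD1 (Ordinal lk)) //= big1 ?addr0 => [|k kn]; last first.
    rewrite !mxE -/h (_ : (k == i + h :> nat)%N = false); last by apply: contraNF kn => /eqP e; apply/eqP/val_inj.
    rewrite (_ : (i == k + h :> nat)%N = false) ?mul0r //.
    by apply/negbTE; rewrite neq_ltn (leq_trans ih) // leq_addl.
  rewrite !mxE -/h /= eqxx mul1r (_ : (j == i + h + h :> nat)%N = false); last first.
    apply/negbTE; rewrite neq_ltn (leq_trans (ltn_ord j)) //.
    by rewrite {1}eN -addnA leq_addl.
  rewrite eqn_add2r; have [->|ij] := eqVneq i j; first by rewrite eqxx.
  by rewrite (_ : (i == j :> nat)%N = false) ?oppr0 //; apply: contraNF ij => /eqP/val_inj ->.
have lk : (i - h < N)%N by rewrite (leq_ltn_trans (leq_subr _ _)).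
have ih : (i - h < h)%N by rewrite ltn_subLR // -eN.
rewrite (bigD1 (Ordinal lk)) //= big1 ?addr0 => [|k kn]; last first.
  rewrite !mxE -/h (_ : (k == i + h :> nat)%N = false); last first.
    apply/negbTE; rewrite neq_ltn (leq_trans (ltn_ord k)) //.
    by rewrite {1}eN leq_add2r.
  rewrite (_ : (i == k + h :> nat)%N = false) ?mul0r //.
  by apply: contraNF kn => /eqP e; apply/eqP/val_inj; rewrite /= e addnK.
rewrite !mxE -/h /= subnK // eqxx (_ : (i - h == i + h)%N = false); last first.
  by apply/negbTE; rewrite neq_ltn (leq_trans ih) // leq_addl.
rewrite (_ : (i - h == j + h)%N = false); last first.
  by apply/negbTE; rewrite neq_ltn (leq_trans ih) // leq_addl.
have [->|ij] := eqVneq i j; first by rewrite eqxx mulr1.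
rewrite (_ : (j == i :> nat)%N = false) ?mulr0 ?oppr0 //.
by apply: contraNF ij => /eqP/val_inj ->.
Qed.

Lemma Sigmx_sqr N r : Sigmx R N r *m Sigmx R N r = 1%:M.
Proof.
apply/matrixP => i j; rewrite !mxE (bigD1 i) //= big1 ?addr0 => [|k ki]; last first.
  by rewrite !mxE eq_sym (negPf ki) mul0r.
rewrite !mxE eqxx; have [->|] := eqVneq i j; last by rewrite mulr0.
by case: ifP; rewrite ?mul1r ?mulrNN ?mulr1.
Qed.

Lemma addn_rev (N i : nat) : (i < N)%N -> (i + (N - i.+1))%N = N.-1.
Proof. by lia. Qed.

Lemma Rmx_sqr N : Rmx R N *m Rmx R N = 1%:M.
Proof.
apply/matrixP => i j; rewrite !mxE (bigD1 (rev_ord i)) //= big1 ?addr0 => [|k ki]; last first.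
  rewrite !mxE (_ : (i + k == N.-1)%N = false) ?mul0r //.
  apply: contraNF ki => /eqP e; apply/eqP/val_inj => /=.
  by apply/eqP; rewrite -(eqn_add2l i) e addn_rev.
have eN : (i + rev_ord i)%N = N.-1 by exact: addn_rev.
rewrite !mxE eN eqxx mul1r -eN [(_ + j)%N]addnC eqn_add2r.
have [->|ij] := eqVneq i j; first by rewrite eqxx.
by rewrite (_ : (j == i :> nat)%N = false) //; apply: contraNF ij => /eqP/val_inj ->.
Qed.

(** M^2 = I or -I is all that is used of the three matrices: it yields invertibility and closure of
    the group under transposition. *)
Lemma structure_mx_sqr N (M : 'M[R]_N) : structure_mx M ->
  exists2 e : R, e != 0 & M *m M = e%:M.
Proof.
case=> [[evN ->]|[[r [_ ->]]|->]].
- by exists (-1); rewrite ?oppr_eq0 ?oner_neq0 // Jmx_sqr // raddfN.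
- by exists 1; rewrite ?oner_neq0 // Sigmx_sqr.
by exists 1; rewrite ?oner_neq0 // Rmx_sqr.
Qed.

Lemma autgroup_unit N (M A : 'M[R]_N) : M \in unitmx -> A^T *m M *m A = M -> A \in unitmx.
Proof. by move=> uM e; move: uM; rewrite -e !unitmx_mul => /andP[_]. Qed.

Lemma structure_mx_unit N (M : 'M[R]_N) : structure_mx M -> M \in unitmx.
Proof.
case/structure_mx_sqr => e e0 eM.
have : M *m M \in unitmx by rewrite eM -scalemx1 unitmxZ ?unitmx1 ?unitfE.
by rewrite unitmx_mul => /andP[].
Qed.

(** With M^2 = e I, the matrix e^(-1) M A^T M is a left inverse of A, hence also a right inverse. *)
Lemma autgroup_tr N (M A : 'M[R]_N) : structure_mx M -> A^T *m M *m A = M ->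
  A *m M *m A^T = M.
Proof.
move=> sM eA; have uM := structure_mx_unit sM; have [e e0 eM] := structure_mx_sqr sM.
have h : (e^-1 *: (M *m A^T *m M)) *m A = 1%:M.
  by rewrite -scalemxAl -!mulmxA (mulmxA A^T) eA eM scale_scalar_mx mulVf.
have h2 := mulmx1C h; rewrite -scalemxAr !mulmxA in h2.
apply: (can_inj (mulmxK uM)); rewrite eM.
by rewrite -[LHS](scalerKV e0) h2 scalemx1.
Qed.

End StructureMatrices.

(** * Estimates common to the two iterations *)

Section ComplexStep.
Variables (R : realType) (l : nat) (p q : {poly R}).
Hypotheses (l_gt0 : (1 <= l)%N) (pade : is_pade_invsqrt l p q).
Local Notation G := (Giter p q).
Local Notation reg := (reg p q).
Local Notation Ginf := (Ginf p q).
Local Notation C := R[i].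

Lemma bO2_frob m n (X Y : R -> 'M[R]_(m, n)) L : bO2 X L ->
  (forall h, h != 0 -> Y h = X h) ->
  exists C h0 : R, 0 < h0 /\ forall h, 0 < h < h0 -> frob (Y h - L) <= C * h ^+ 2.
Proof.
move=> [c [h0 [h00 H]]] e; exists c, h0; split=> // h hh.
rewrite e; last by case/andP: hh => /gt_eqF ->.
exact: le_trans (frob_nrm _) (H h hh).
Qed.

Lemma dist_set_le N (Y X : 'M[R]_N) (A : set 'M[R]_N) : A X -> dist_set Y A <= frob (Y - X).
Proof.
move=> AX; apply: ge_inf; last by exists X.
by exists 0 => _ [Z _ <-]; exact: sqrtr_ge0.
Qed.

Section Iteration.
Variables (m n : nat) (A E : 'M[R]_(m, n)) (S F : 'M[R]_(n, m)).
Variables (X : R -> nat -> 'M[C]_(m, n)) (x e : nat -> 'M[R]_(m, n)) (L' : 'M[R]_(m, n)).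
Hypothesis regSA : reg (S *m A).
Hypothesis tauX : forall h k, h != 0 -> tau h (X h k) = pert h A E *m G (gram A E S F h) k.
Hypothesis dual_xe : forall k, dual (x k) (e k) = dual A E *m G (gram0 A E S F) k.
Hypothesis diffE : L' = E *m Ginf (S *m A) + A *m DGinf p q (S *m A) (S *m E + F *m A).
Let L := A *m Ginf (S *m A).

Lemma dual_limitE : dual A E *m Ginf (gram0 A E S F) = dual L L'.
Proof. by rewrite (dual_limit l_gt0 pade) // diffE. Qed.

Lemma iterate_ReIm k :
  (exists C h0 : R, 0 < h0 /\ forall h, 0 < h < h0 -> frob (Remx (X h k) - x k) <= C * h ^+ 2) /\
  (exists C h0 : R, 0 < h0 /\ forall h, 0 < h < h0 ->
     frob (Immx ((h%:C)%C^-1 *: X h k) - e k) <= C * h ^+ 2).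
Proof.
have [hr hi] := bO2_ul (bO2_iter l_gt0 pade E F regSA k).
rewrite -dual_xe block_mxKul block_mxKur in hr hi.
split; [apply: (bO2_frob hr) => h h0|apply: (bO2_frob hi) => h h0].
  by rewrite (Remx_tau h) tauX.
by rewrite (Immx_tau h) tauX.
Qed.

Lemma coupled_cvg : x @ \oo --> L /\ e @ \oo --> L'.
Proof.
have h : cvm (fun k => dual A E *m G (gram0 A E S F) k) (dual L L').
  rewrite -dual_limitE; apply: cvmM; first exact: cvm_cst.
  by apply: (reg_cvg l_gt0 pade); exact: (reg_gram0 l_gt0 pade).
have [h1 h2 _ _] := cvm_submx h.
rewrite block_mxKul in h1; rewrite block_mxKur in h2.
split; apply/cvmP.
  by apply: cvm_eq h1 => k; rewrite -dual_xe block_mxKul.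
by apply: cvm_eq h2 => k; rewrite -dual_xe block_mxKur.
Qed.

Lemma limit_ReIm :
  (exists C h0 : R, 0 < h0 /\ forall h, 0 < h < h0 -> exists M : 'M[R]_(m, n),
     (fun k => Remx (X h k)) @ \oo --> M /\ frob (M - L) <= C * h ^+ 2) /\
  (exists C h0 : R, 0 < h0 /\ forall h, 0 < h < h0 -> exists M : 'M[R]_(m, n),
     (fun k => Immx ((h%:C)%C^-1 *: X h k)) @ \oo --> M /\ frob (M - L') <= C * h ^+ 2).
Proof.
have [h1 [h10 hreg]] := reg_gram l_gt0 pade E F regSA.
have := bO2_ul (bO2_limit l_gt0 pade E F regSA).
rewrite dual_limitE block_mxKul block_mxKur => -[[c [h0 [h00 hr]]] [c' [h0' [h00' hi]]]].
have hcv h : 0 < h < h1 -> cvm (fun k => tau h (X h k)) (pert h A E *m Ginf (gram A E S F h)).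
  move=> hh; have h0n : h != 0 by case/andP: hh => /gt_eqF ->.
  apply: (cvm_eq (X := fun k => pert h A E *m G (gram A E S F h) k)) => [k|].
    by rewrite tauX.
  by apply: cvmM; [exact: cvm_cst|apply: (reg_cvg l_gt0 pade); exact: hreg].
split.
  exists c, (Num.min h0 h1); split=> [|h]; first by rewrite lt_min h00 h10.
  rewrite lt_min => /andP[hp /andP[hh0 hh1]].
  exists (ulsubmx (pert h A E *m Ginf (gram A E S F h))); split; last first.
    by apply: le_trans (frob_nrm _) (hr h _); rewrite hp.
  have [|hu _ _ _] := cvm_submx (hcv h _); first by rewrite hp.
  by apply/cvmP; apply: cvm_eq hu => k; rewrite -Remx_tau.
exists c', (Num.min h0' h1); split=> [|h]; first by rewrite lt_min h00' h10.
rewrite lt_min => /andP[hp /andP[hh0 hh1]].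
exists (ursubmx (pert h A E *m Ginf (gram A E S F h))); split; last first.
  by apply: le_trans (frob_nrm _) (hi h _); rewrite hp.
have [|_ hu _ _] := cvm_submx (hcv h _); first by rewrite hp.
by apply/cvmP; apply: cvm_eq hu => k; rewrite -Immx_tau.
Qed.

End Iteration.

Lemma autgroup_iterate N (M A S : 'M[R]_N) k : M \in unitmx -> autgroup M A ->
  reg (S *m A) -> (S *m A)^T *m M *m (S *m A) = M -> autgroup M (A *m G (S *m A) k).
Proof.
move=> uM eA hreg eY; rewrite /autgroup /= trmx_mul -!mulmxA (mulmxA M) (mulmxA A^T) (mulmxA A^T).
rewrite [A^T *m M *m A]eA mulmxA.
exact: (Giter_group l_gt0 pade).
Qed.

Lemma dist_autgroup N (M : 'M[R]_N) (X : R -> 'M[R]_N) (x : 'M[R]_N) : autgroup M x ->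
  (exists C h0 : R, 0 < h0 /\ forall h, 0 < h < h0 -> frob (X h - x) <= C * h ^+ 2) ->
  exists C h0 : R, 0 < h0 /\ forall h, 0 < h < h0 -> dist_set (X h) (autgroup M) <= C * h ^+ 2.
Proof.
move=> hx [c [h0 [h00 h]]]; exists c, h0; split=> // t ht.
exact: le_trans (dist_set_le _ hx) (h t ht).
Qed.

End ComplexStep.

Theorem theorem4 (R : realType) (l : nat) (p q : {poly R}) :
  (1 <= l)%N -> is_pade_invsqrt l p q ->
  (* Part 1: sign iteration *)
  (forall (n : nat) (A E : 'M[R]_n), no_imag_eig A ->
    (exists h0 : R, 0 < h0 /\ forall h, 0 < h < h0 ->
        forall k, csign_iter p q A E h k \in unitmx) /\
    (forall k, exists C h0 : R, 0 < h0 /\ forall h, 0 < h < h0 ->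
        frob (Remx (csign_iter p q A E h k) - (sign_iter p q A E k).1) <= C * h ^+ 2) /\
    (forall k, exists C h0 : R, 0 < h0 /\ forall h, 0 < h < h0 ->
        frob (Immx ((h%:C)%C^-1 *: csign_iter p q A E h k) - (sign_iter p q A E k).2)
          <= C * h ^+ 2) /\
    (fun k => (sign_iter p q A E k).1) @ \oo --> msign A /\
    (fun k => (sign_iter p q A E k).2) @ \oo --> 'd (@msign R n) A E /\
    (exists C h0 : R, 0 < h0 /\ forall h, 0 < h < h0 -> exists L : 'M[R]_n,
        (fun k => Remx (csign_iter p q A E h k)) @ \oo --> L /\
        frob (L - msign A) <= C * h ^+ 2) /\
    (exists C h0 : R, 0 < h0 /\ forall h, 0 < h < h0 -> exists L : 'M[R]_n,
        (fun k => Immx ((h%:C)%C^-1 *: csign_iter p q A E h k)) @ \oo --> L /\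
        frob (L - 'd (@msign R n) A E) <= C * h ^+ 2) /\
    (forall M : 'M[R]_n, structure_mx M -> A \in autgroup M ->
      forall k, exists C h0 : R, 0 < h0 /\ forall h, 0 < h < h0 ->
        dist_set (Remx (csign_iter p q A E h k)) (autgroup M) <= C * h ^+ 2)) /\
  (* Part 2: polar iteration *)
  (forall (m n : nat) (A E : 'M[R]_(m, n)), (n <= m)%N -> \rank A = n ->
    (exists h0 : R, 0 < h0 /\ forall h, 0 < h < h0 ->
        forall k, \rank (cpolar_iter p q A E h k) = n) /\
    (forall k, exists C h0 : R, 0 < h0 /\ forall h, 0 < h < h0 ->
        frob (Remx (cpolar_iter p q A E h k) - (polar_iter p q A E k).1) <= C * h ^+ 2) /\
    (forall k, exists C h0 : R, 0 < h0 /\ forall h, 0 < h < h0 ->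
        frob (Immx ((h%:C)%C^-1 *: cpolar_iter p q A E h k) - (polar_iter p q A E k).2)
          <= C * h ^+ 2) /\
    (fun k => (polar_iter p q A E k).1) @ \oo --> polar A /\
    (fun k => (polar_iter p q A E k).2) @ \oo --> 'd (@polar R m n) A E /\
    (exists C h0 : R, 0 < h0 /\ forall h, 0 < h < h0 -> exists L : 'M[R]_(m, n),
        (fun k => Remx (cpolar_iter p q A E h k)) @ \oo --> L /\
        frob (L - polar A) <= C * h ^+ 2) /\
    (exists C h0 : R, 0 < h0 /\ forall h, 0 < h < h0 -> exists L : 'M[R]_(m, n),
        (fun k => Immx ((h%:C)%C^-1 *: cpolar_iter p q A E h k)) @ \oo --> L /\
        frob (L - 'd (@polar R m n) A E) <= C * h ^+ 2)) /\
  (* Part 2 with m = n and A in the automorphism group *)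
  (forall (n : nat) (A E : 'M[R]_n) (M : 'M[R]_n), structure_mx M -> A \in autgroup M ->
    forall k, exists C h0 : R, 0 < h0 /\ forall h, 0 < h < h0 ->
      dist_set (Remx (cpolar_iter p q A E h k)) (autgroup M) <= C * h ^+ 2).
Proof.
move=> l_gt0 pade; split; [|split].
- move=> n A E hA.
  have [hreg eS] := msignE l_gt0 pade (or_introl hA).
  have tauX h k : h != 0 -> tau h (csign_iter p q A E h k) = pert h A E *m Giter p q (gram A E A E h) k.
    by move=> h0; exact: tau_csign.
  have dualX k := sign_iter_dual E k hreg.
  have eL : 'd (@msign R n) A E = E *m Ginf p q (A *m A) +
      A *m DGinf p q (A *m A) (A *m E + E *m A).
    have linid : linear (@id 'M[R]_n) by [].
    apply: (diff_iteration_limit l_gt0 pade E linid hreg).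
    by move=> X hX; case: (msignE l_gt0 pade (or_intror hX)).
  have ReIm := iterate_ReIm l_gt0 pade hreg tauX dualX.
  have [cx ce] := coupled_cvg l_gt0 pade hreg dualX eL.
  have [lr li] := limit_ReIm l_gt0 pade hreg tauX eL.
  rewrite eS; do ![split] => //.
  + have [h0 [h00 hr]] := reg_gram l_gt0 pade E E hreg.
    exists h0; split=> // h hh k; have h0n : h != 0 by case/andP: hh => /gt_eqF ->.
    rewrite -(tau_unit h0n) tauX // unitmx_mul reg_Giter_unit ?andbT; last exact: hr.
    by have := reg_unit l_gt0 pade (hr h hh); rewrite unitmx_mul => /andP[].
  + by move=> k; case: (ReIm k).
  + by move=> k; case: (ReIm k).
  move=> M sM; rewrite inE => eA k.
  apply: (@dist_autgroup _ _ _ _ (sign_iter p q A E k).1); last by case: (ReIm k).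
  rewrite sign_iter_fst; apply: (autgroup_iterate l_gt0 pade _ (structure_mx_unit sM)) => //.
  have eA' : A^T *m M *m A = M := eA.
  transitivity (A^T *m (A^T *m M *m A) *m A); first by rewrite trmx_mul !mulmxA.
  by rewrite !eA'.
- move=> m n A E _ rk.
  have [hreg eP] := polarE l_gt0 pade (or_introl rk).
  have tauX h k : h != 0 ->
      tau h (cpolar_iter p q A E h k) = pert h A E *m Giter p q (gram A E A^T E^T h) k.
    by move=> h0; exact: tau_cpolar.
  have dualX k := polar_iter_dual E k hreg.
  have eL : 'd (@polar R m n) A E = E *m Ginf p q (A^T *m A) +
      A *m DGinf p q (A^T *m A) (A^T *m E + E^T *m A).
    have lint : linear (@trmx R m n) by move=> a X Y; rewrite linearP.
    apply: (diff_iteration_limit l_gt0 pade E lint hreg).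
    by move=> X hX; case: (polarE l_gt0 pade (or_intror hX)).
  have ReIm := iterate_ReIm l_gt0 pade hreg tauX dualX.
  have [cx ce] := coupled_cvg l_gt0 pade hreg dualX eL.
  have [lr li] := limit_ReIm l_gt0 pade hreg tauX eL.
  rewrite eP; do ![split] => //.
  + have [h0 [h00 hr]] := reg_gram l_gt0 pade E E^T hreg.
    exists h0; split=> // h hh k; have h0n : h != 0 by case/andP: hh => /gt_eqF ->.
    (* The iterate is X0 times an invertible matrix, so its rank is that of X0, which has full
       column rank because X0^T X0 is invertible. *)
    rewrite /cpolar_iter polar_iterE; set X0 := _ + _.
    have eX : tau h (X0^T *m X0) = gram A E A^T E^T h.
      by rewrite tauM // trmx_start !tau_start.
    have uG : Giter (cpoly p) (cpoly q) (X0^T *m X0) k \in unitmx.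
      by rewrite -(tau_unit h0n) tau_Giter // eX reg_Giter_unit //; exact: hr.
    have uX : X0^T *m X0 \in unitmx.
      by rewrite -(tau_unit h0n) eX; apply: (reg_unit l_gt0 pade); exact: hr.
    rewrite mxrankMfree ?row_free_unit //; apply/eqP; rewrite eqn_leq rank_leq_col /=.
    by have := mxrankM_maxr X0^T X0; rewrite (mxrank_unit uX).
  + by move=> k; case: (ReIm k).
  by move=> k; case: (ReIm k).
move=> n A E M sM; rewrite inE => eA k; have uM := structure_mx_unit sM.
have eA' : A^T *m M *m A = M := eA.
have rk : \rank A = n by apply: mxrank_unit; exact: autgroup_unit uM eA'.
have [hreg _] := polarE l_gt0 pade (or_introl rk).
have tauX h k' : h != 0 ->
    tau h (cpolar_iter p q A E h k') = pert h A E *m Giter p q (gram A E A^T E^T h) k'.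
  by move=> h0; exact: tau_cpolar.
have dualX k' := polar_iter_dual E k' hreg.
apply: (@dist_autgroup _ _ _ _ (polar_iter p q A E k).1); last first.
  by case: (iterate_ReIm l_gt0 pade hreg tauX dualX k).
rewrite polar_iter_fst; apply: (autgroup_iterate l_gt0 pade _ uM) => //.
(* A^T A lies in the group because A^T does. *)
transitivity (A^T *m (A *m M *m A^T) *m A); first by rewrite trmx_mul trmxK !mulmxA.
by rewrite (autgroup_tr sM eA').
Qed.
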